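(* Fix an integer $p\ge3$ and suppose $(\beta,h)\in\Theta=[0,\infty)\times\mathbb{R}$ is $p$-critical. Assume $\beta$ is known, $\boldsymbol\sigma\sim\mathbb{P}_{\beta,h,p}$, and let $\hat h_N$ be the maximum likelihood estimate of $h$. Denote the $K\in\{2,3\}$ global maximizers of $H=H_{\beta,h,p}$ by $m_1<\dots<m_K$, and for $1\le k\le K$ let $$p_k=\frac{[(m_k^2-1)H''(m_k)]^{-1/2}}{\sum_{i=1}^K[(m_i^2-1)H''(m_i)]^{-1/2}}.$$ (1) If $p\ge3$ is odd, then $H$ has exactly two (asymmetric) global maximizers $m_1<m_2$ and, as $N\to\infty$, $$N^{1/2}(\hat h_N-h)\xrightarrow{D}\tfrac{p_1}{2}N^-(0,-H''(m_1))+\tfrac{1-p_1}{2}N^+(0,-H''(m_2))+\tfrac12\delta_0.$$ (2) If $p\ge4$ is even, then: - If $h\ne0$, then $H$ has exactly two (asymmetric) global maximizers $m_1<m_2$ and, as $N\to\infty$, $$N^{1/2}(\hat h_N-h)\xrightarrow{D}\tfrac{p_1}{2}N^-(0,-H''(m_1))+\tfrac{1-p_1}{2}N^+(0,-H''(m_2))+\tfrac12\delta_0.$$ - If $h=0$ and $\beta>\tilde\beta_p$, then $H$ has exactly two symmetric global maximizers $m_2=-m_1=m_*$ for some $m_*=m_*(\beta,h,p)>0$, and, as $N\to\infty$, $$N^{1/2}\hat h_N\xrightarrow{D}\tfrac12N(0,-H''(m_* ))+\tfrac12\delta_0.$$ - If $h=0$ and $\beta=\tilde\beta_p$, then $H$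 has three global maximizers $m_1=-m_*$, $m_2=0$, $m_3=m_*$, where $m_*=m_*(\beta,h,p)>0$, and, as $N\to\infty$, $$N^{1/2}\hat h_N\xrightarrow{D}p_1N(0,-H''(m_1))+(1-p_1)\delta_0.$$
   Context: The $p$-spin Curie-Weiss model is the probability measure on $\{-1,1\}^N$ given by $\mathbb{P}_{\beta,h,p}(\boldsymbol\sigma)=\frac{1}{2^NZ_N(\beta,h,p)}\exp\{N(\beta\overline\sigma_N^p+h\overline\sigma_N)\}$, where $\overline\sigma_N=\frac1N\sum_{i=1}^N\sigma_i$ and $Z_N$ is the normalizing constant; expectation is $\mathbb{E}_{\beta,h,p}$. For fixed known $\beta$, the maximum likelihood estimate $\hat h_N\in[-\infty,\infty]$ is the solution in $h$ of $\mathbb{E}_{\beta,h,p}(\overline\sigma_N)=\overline\sigma_N$ (with value $\pm\infty$ when $\overline\sigma_N=\pm1$). Define $H_{\beta,h,p}:[-1,1]\to\mathbb{R}$ by $H_{\beta,h,p}(x)=\beta x^p+hx-I(x)$, $I(x)=\frac12\{(1+x)\log(1+x)+(1-x)\log(1-x)\}$. The point $(\beta,h)$ is $p$-critical if $H_{\beta,h,p}$ has more than one global maximizer (it is known that there are then 2 or 3 of them, all in $(-1,1)$). Define $\tilde\beta_p=\sup\{\beta\ge0:\sup_{x\in[-1,1]}H_{\beta,0,p}(x)=0\}$. For $\sigma>0$, $N^+(0,\sigma^2)$ and $N^-(0,\sigma^2)$ denote the laws of $|Z|$ and $-|Z|$, respectively, where $Z\sim N(0,\sigma^2)$. $\delta_x$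 is the point mass at $x$. A weighted sum of distributions denotes the corresponding mixture. *)

(* Defs.v *)
From mathcomp Require Import all_boot all_order all_algebra.
From mathcomp Require Import all_classical all_reals all_analysis.

Set Implicit Arguments.
Unset Strict Implicit.
Unset Printing Implicit Defensive.

Import Order.TTheory GRing.Theory Num.Theory.
Import numFieldNormedType.Exports.

Local Open Scope classical_set_scope.
Local Open Scope ring_scope.

Section CurieWeiss.
Context {R : realType}.

(* A configuration in {-1,1}^N is a boolean vector; [true] stands for the spin
   +1 and [false] for the spin -1. *)
Definition config (N : nat) := {ffun 'I_N -> bool}.

Definition spin (b : bool) : R := if b then 1 else -1.

Definition magnetization (N : nat) (s : config N) : R :=
  (\sum_(i < N) spin (s i)) / N%:R.

Definition gibbs_weight (p : nat) (beta h : R) (N : nat) (s : config N) : R :=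
  expR (N%:R * (beta * magnetization s ^+ p + h * magnetization s)).

(* The model is P(s) = gibbs_weight s / (2^N Z_N), where Z_N carries the factor
   2^-N below. *)
Definition partition_fun (p : nat) (beta h : R) (N : nat) : R :=
  (2 ^+ N)^-1 * \sum_(s : config N) gibbs_weight p beta h s.

Definition gibbs (p : nat) (beta h : R) (N : nat) (s : config N) : R :=
  gibbs_weight p beta h s / (2 ^+ N * partition_fun p beta h N).

Definition mean_magnetization (p : nat) (beta h : R) (N : nat) : R :=
  \sum_(s : config N) gibbs p beta h s * magnetization s.

Definition mle_equation (p : nat) (beta : R) (N : nat) (s : config N)
    (e : \bar R) : Prop :=
  match e with
  | r%:E => mean_magnetization p beta r N = magnetization s
  | +oo%E => magnetization s = 1
  | -oo%E => magnetization s = -1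
  end.

(* For N > 0 the equation has exactly one solution in [-oo, +oo], because
   r |-> mean_magnetization p beta r N increases strictly and continuously from
   -1 to 1; the default value 0 only matters for N = 0. *)
Definition mle (p : nat) (beta : R) (N : nat) (s : config N) : \bar R :=
  xget 0%E [set e | mle_equation p beta s e].

Definition scaled_error (p : nat) (beta h : R) (N : nat) (s : config N)
    : \bar R :=
  ((Num.sqrt N%:R)%:E * (mle p beta s - h%:E))%E.

(* [ln 0 = 0] in the library, which gives 0 log 0 = 0 at the endpoints. *)
Definition entropy (x : R) : R :=
  2^-1 * ((1 + x) * ln (1 + x) + (1 - x) * ln (1 - x)).

(* Defined on all of R, but only meaningful on [-1, 1]. *)
Definition Hfun (p : nat) (beta h : R) (x : R) : R :=
  beta * x ^+ p + h * x - entropy x.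

Definition Hfun'' (p : nat) (beta h : R) (x : R) : R :=
  derive1n 2 (Hfun p beta h) x.

Definition global_maximizers (p : nat) (beta h : R) : set R :=
  [set x | x \in `[-1, 1] /\
           forall y, y \in `[-1, 1] -> Hfun p beta h y <= Hfun p beta h x].

Definition critical (p : nat) (beta h : R) : Prop :=
  exists x y, [/\ global_maximizers p beta h x,
                  global_maximizers p beta h y & x != y].

Definition beta_tilde (p : nat) : R :=
  sup [set beta : R | 0 <= beta /\
         sup [set Hfun p beta 0 x | x in [set` `[-1, 1]]] = 0].

Definition unnormalized_mode_weight (p : nat) (beta h m : R) : R :=
  ((m ^+ 2 - 1) * Hfun'' p beta h m) `^ (- 2^-1).

(* The weight p_k of the maximizer m = m_k; the sum is the finitely supported
   sum over the set of all global maximizers. *)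
Definition mode_weight (p : nat) (beta h m : R) : R :=
  unnormalized_mode_weight p beta h m /
  \sum_(x \in global_maximizers p beta h) unnormalized_mode_weight p beta h x.

End CurieWeiss.

Section Laws.
Context {R : realType}.

(* Normal laws are parametrized by the variance; [normal_prob] takes the
   standard deviation. *)
Definition centered_normal (v : R) : set R -> \bar R :=
  normal_prob 0 (Num.sqrt v).

Definition half_normal_pos (v : R) : set R -> \bar R :=
  pushforward (centered_normal v) (fun z : R => `|z|).

Definition half_normal_neg (v : R) : set R -> \bar R :=
  pushforward (centered_normal v) (fun z : R => - `|z|).

Definition point_mass (x : R) : set R -> \bar R := \d_x.

Definition mixture (l : seq (R * (set R -> \bar R))) : set R -> \bar R :=
  fun A => (\sum_(c <- l) c.1%:E * c.2 A)%E.

Definition law_cdf (mu : set R -> \bar R) (t : R) : R := fine (mu [set` `]-oo, t]]).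

(* Convergence in distribution, to a law mu on R, of extended-real-valued
   variables X N on finite probability spaces with mass functions P N:
   the distribution functions converge at every continuity point of that of
   mu. *)
Definition cvg_in_distribution (Omega : nat -> finType)
    (P : forall N, Omega N -> R) (X : forall N, Omega N -> \bar R)
    (mu : set R -> \bar R) : Prop :=
  forall t : R, {for t, continuous (law_cdf mu)} ->
    (\sum_(w : Omega N | (X N w <= t%:E)%E) P N w) @[N --> \oo]
      --> law_cdf mu t.

Definition mle_cvg (p : nat) (beta h : R) (mu : set R -> \bar R) : Prop :=
  @cvg_in_distribution config (@gibbs R p beta h) (@scaled_error R p beta h) mu.

End Laws.

(* Main.v *)
(* For [r] in [[-oo, +oo]] the event [mle <= r] is the event that the
   magnetization is at most its mean under the field [r].  At the field
   [h + t / sqrt N] with [t != 0] the measure concentrates at the extreme maximizer [m] of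
   [H] on the side of the sign of [t]; with [v = - H'' m], the mean there is
   [m + t / (v sqrt N) + o(1 / sqrt N)].  Under the field [h] the magnetization
   is within [O(1 / sqrt N)] of the maximizer [m_k] with limiting probability
   [p_k], and [v sqrt N] times its deviation from [m_k] is then asymptotically
   [N(0, v)].  Hence the limiting distribution function at [t] is
   [p_1 P(N(0, v_1) <= t)] for [t < 0] and [1 - p_K P(N(0, v_K) > t)] for
   [t > 0]; [t = 0] is an atom of the limit law and needs no convergence.

   Both asymptotics come from Laplace's method for sums over the lattice of
   magnetizations: Stirling's formula (only up to a constant, which cancels),
   a second-order expansion of [H], and dominated convergence of step
   functions.  The shape of the set of maximizers follows by Rolle's theorem
   from the fact that [H''] has at most two zeros in [(0, 1)]. *)

Require Import Defs.
From mathcomp Require Import all_boot all_order all_algebra.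
From mathcomp Require Import all_classical all_reals all_analysis.
From mathcomp Require Import measurable_realfun ring lra zify.
Import Order.TTheory GRing.Theory Num.Theory.
Import numFieldNormedType.Exports.
Set Implicit Arguments.
Unset Strict Implicit.
Unset Printing Implicit Defensive.
Local Open Scope classical_set_scope.
Local Open Scope ring_scope.

(** * Derivatives and maximizers of the energy function *)

(** A field increment t / sqrt N leaves the maximizers of H tied at order N: it separates them only
    by factors e^(t sqrt N (x - m)). Hence the terms away from the selected maximizer are bounded by
    e^(-c sqrt N) and not by e^(-cN). The mean under that field would call for Laplace's method with
    an unbounded integrand; instead the generating function of the deviation is computed for all
    tilts tau of the sign of t, and the mean is squeezed out of it by convexity, so that test
    functions stay in [0, 1].

    The coordinate v sqrt N (x - m) is used at each maximizer because a tilt by tau then turns the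
    limit N(0, v) into N(tau, v), and the mean that cuts the event [mle <= r] sits at t in the
    limit. That cut moves with N: the test functions are indicators depending on N whose limit has a
    jump, which almost everywhere convergence absorbs.

    Laplace's method needs H'' < 0 at every maximizer. The zero count of H'' that locates the
    maximizers also excludes a degenerate nonzero one: it would be one zero too many. *)

Section Energy.
Context {R : realType}.
Implicit Types (p : nat) (b h x y m : R).

Definition Hfun_deriv p b h x : R :=
  b * p%:R * x ^+ p.-1 + h - 2^-1 * (ln (1 + x) - ln (1 - x)).

Definition Hfun_deriv2 p b x : R :=
  b * p%:R * p.-1%:R * x ^+ p.-2 - (1 - x ^+ 2)^-1.

Lemma is_derive_exp n x : is_derive x 1 (fun y : R => y ^+ n) (n%:R * x ^+ n.-1).
Proof.
split; last by rewrite exp_derive /GRing.scale /= mulr1.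
exact: exprn_derivable.
Qed.

Lemma is_derive_ln1D x : -1 < x -> is_derive x 1 (fun y => ln (1 + y)) (1 + x)^-1.
Proof.
move=> x1; have /is_derive1_ln d : 0 < 1 + x by lra.
rewrite -[X in is_derive _ _ _ X]mulr1.
apply: (@is_derive1_comp _ _ (fun y => 1 + y)) => //.
by apply: is_derive_eq; rewrite /GRing.scale /=; lra.
Qed.

Lemma is_derive_ln1B x : x < 1 -> is_derive x 1 (fun y => ln (1 - y)) (- (1 - x)^-1).
Proof.
move=> x1; have /is_derive1_ln d : 0 < 1 - x by lra.
rewrite -mulrN1.
apply: (@is_derive1_comp _ _ (fun y => 1 - y)) => //.
by apply: is_derive_eq; rewrite /GRing.scale /=; lra.
Qed.

Lemma is_derive_Hfun p b h x : -1 < x < 1 ->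
  is_derive x 1 (Hfun p b h) (Hfun_deriv p b h x).
Proof.
move=> /andP[x1 x2].
have dX := is_derive_exp p x.
have l1 := is_derive_ln1D x1.
have l2 := is_derive_ln1B x2.
rewrite /Hfun /entropy; apply: is_derive_eq.
rewrite /Hfun_deriv /GRing.scale /=; field; lra.
Qed.

Lemma is_derive_Hfun_deriv p b h x : -1 < x < 1 ->
  is_derive x 1 (Hfun_deriv p b h) (Hfun_deriv2 p b x).
Proof.
move=> /andP[x1 x2].
have dX := is_derive_exp p.-1 x.
have l1 := is_derive_ln1D x1.
have l2 := is_derive_ln1B x2.
rewrite /Hfun_deriv; apply: is_derive_eq.
rewrite /Hfun_deriv2 /GRing.scale /=.
have x0 : 1 - x ^+ 2 != 0 by nra.
by field; apply/and3P; split => //; lra.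
Qed.

(** The inner derivative is known only on (-1, 1); agreement on this neighbourhood of x is enough
    for the outer one. *)
Lemma Hfun''E p b h x : -1 < x < 1 -> Hfun'' p b h x = Hfun_deriv2 p b x.
Proof.
move=> x1; rewrite /Hfun'' derive1nS derive1n1.
have nearE : \forall y \near x, (Hfun p b h)^`()%classic y = Hfun_deriv p b h y.
  have : x \in `]-1, 1[ by rewrite in_itv.
  move/near_in_itvoo; apply: filterS => y; rewrite in_itv /= => y1.
  by rewrite derive1E; have [_ ->] := is_derive_Hfun p b h y1.
rewrite derive1E (near_eq_derive _ nearE) //.
by have [_ ->] := is_derive_Hfun_deriv p b h x1.
Qed.

(** Writing ln x = -2 ln (x^(-1/2)) and using ln y < y gives a bound that vanishes at 0, as needed
    for continuity of the entropy at the endpoints. *)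
Lemma norm_mul_ln_le x : x <= 1 -> `|x * ln x| <= 2 * Num.sqrt `|x|.
Proof.
move=> x1; have [x0|x0] := leP x 0.
  by rewrite ln0// mulr0 normr0 mulr_ge0.
have s0 : 0 < Num.sqrt x by rewrite sqrtr_gt0.
have sK : Num.sqrt x ^+ 2 = x by rewrite sqr_sqrtr// ltW.
have lnE : ln x = - 2 * ln (Num.sqrt x)^-1.
  by rewrite lnV ?posrE// -{1}sK lnXn// mulNr mulrN opprK mulr_natl.
have l0 : ln x <= 0 by rewrite ln_le0.
have : ln (Num.sqrt x)^-1 <= (Num.sqrt x)^-1.
  by rewrite ltW// ln_sublinear// invr_gt0.
rewrite (ger0_norm (ltW x0)) ler0_norm; last by rewrite pmulr_rle0.
move=> le; rewrite lnE -{1}sK.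
have -> : - (Num.sqrt x ^+ 2 * (- 2 * ln (Num.sqrt x)^-1)) =
  2 * Num.sqrt x ^+ 2 * ln (Num.sqrt x)^-1 by ring.
have -> : 2 * Num.sqrt x = 2 * Num.sqrt x ^+ 2 * (Num.sqrt x)^-1 by field; lra.
by rewrite ler_pM2l// mulr_gt0// exprn_gt0.
Qed.

Lemma continuous_mul_ln : continuous (fun x : R => x * ln x).
Proof.
move=> x; have [x0|x0|->] := ltgtP x 0; last first.
- rewrite /continuous_at mul0r.
  apply/cvgr0Pnorm_lt => e e0.
  have : Num.sqrt `|y| @[y --> (0:R)] --> Num.sqrt `|0 : R|.
    apply: (cvg_comp (fun y : R => `|y|)); first by apply: cvg_norm; exact: cvg_id.
    exact: sqrt_continuous.
  rewrite normr0 sqrtr0 => /cvgr0Pnorm_lt /(_ (e / 2)) h.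
  near=> y; apply: (le_lt_trans (norm_mul_ln_le _)).
    by apply: ltW; near: y; apply: (@lt_nbhsl R); rewrite ltr01.
  rewrite -ltr_pdivlMl// mulrC -[ltLHS]ger0_norm//.
  by near: y; apply: h; lra.
- by apply: cvgM; [exact: cvg_id|exact: continuous_ln].
(* To the left of 0 the logarithm has the default value 0. *)
- apply: (@near_cst_continuous _ _ 0); near=> y.
  rewrite ln0 ?mulr0//; apply: ltW; near: y; exact: lt_nbhsl.
Unshelve. all: by end_near. Qed.

Lemma continuous_Hfun p b h : continuous (Hfun p b h).
Proof.
move=> x.
have cX : {for x, continuous (fun y : R => y ^+ p)} by exact: exprn_continuous.
have c1 : {for x, continuous (fun y : R => (1 + y) * ln (1 + y))}.
  apply: (@continuous_comp _ _ _ (fun y : R => 1 + y) (fun z => z * ln z)); last exact: continuous_mul_ln.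
  by apply: cvgD; [exact: cvg_cst|exact: cvg_id].
have c2 : {for x, continuous (fun y : R => (1 - y) * ln (1 - y))}.
  apply: (@continuous_comp _ _ _ (fun y : R => 1 - y) (fun z => z * ln z)); last exact: continuous_mul_ln.
  by apply: cvgB; [exact: cvg_cst|exact: cvg_id].
apply: cvgB; first apply: cvgD.
- by apply: cvgM; [exact: cvg_cst|exact: cX].
- by apply: cvgM; [exact: cvg_cst|exact: cvg_id].
- by apply: cvgM; [exact: cvg_cst|apply: cvgD].
Qed.

(** Reflection exchanges the endpoints at the price of the sign (-1)^p on b, so the estimate at the
    endpoint 1 must allow b < 0. *)
Lemma Hfun_opp p b h x : Hfun p b h (- x) = Hfun p ((-1) ^+ p * b) (- h) x.
Proof.
rewrite /Hfun /entropy opprK (exprNn x); ring.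
Qed.

Lemma Hfun_deriv2_opp p b x :
  Hfun_deriv2 p.+2 b (- x) = Hfun_deriv2 p.+2 ((-1) ^+ p * b) x.
Proof. by rewrite /Hfun_deriv2 /= sqrrN (exprNn x); ring. Qed.

(** The slope of the entropy is infinite at 1. At distance e = e^(-2C) from 1 the term - e ln e / 2
    gains C e, while the polynomial part loses at most (|b| p + |h|) e; the choice of C leaves a
    surplus of e. *)
Lemma Hfun1_not_max p b h : exists2 x, x \in `[-1, 1] & Hfun p b h 1 < Hfun p b h x.
Proof.
pose C := `|b| * p%:R + `|h| + 1.
have C0 : 0 < C by rewrite ltr_wpDl// addr_ge0// mulr_ge0.
pose e : R := expR (- 2 * C).
have e0 : 0 < e by exact: expR_gt0.
have e1 : e < 1 by rewrite expR_lt1; lra.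
have lne : ln e = - 2 * C by rewrite expRK.
have pow : 1 - p%:R * e <= (1 - e) ^+ p <= 1.
  rewrite exprn_ile1 ?andbT; [|lra..].
  elim: p {C C0 e e0 e1 lne} (e) (e0) (e1) => [|p IH] e e0 e1; first by rewrite mul0r subr0.
  have {}IH := IH _ e0 e1.
  rewrite exprSr -natr1.
  have : (1 - p%:R * e) * (1 - e) <= (1 - e) ^+ p * (1 - e) by rewrite ler_pM2r//; lra.
  have : 0 <= p%:R * e * e by rewrite !mulr_ge0// ltW.
  lra.
have ln2e : ln (2 - e) <= ln 2 by rewrite ler_ln ?posrE; lra.
have ln20 : 0 <= ln 2 :> R by rewrite ln_ge0; lra.
exists (1 - e); first by rewrite in_itv /=; apply/andP; split; lra.
rewrite /Hfun /entropy.
have -> : 1 + (1 - e) = 2 - e by ring.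
have -> : 1 - (1 - e) = e by ring.
have -> : 1 + 1 = 2 :> R by [].
rewrite subrr mul0r addr0 lne expr1n.
have bpow : - (`|b| * (p%:R * e)) <= b * ((1 - e) ^+ p - 1).
  have : `|b * ((1 - e) ^+ p - 1)| <= `|b| * (p%:R * e).
    rewrite normrM ler_wpM2l// ler_norml; lra.
  by rewrite ler_norml => /andP[].
have he : - (`|h| * e) <= - (h * e).
  by rewrite lerN2 ler_wpM2r ?ler_norm// ltW.
have l2 : (2 - e) * ln (2 - e) <= (2 - e) * ln 2 by rewrite ler_pM2l//; lra.
have l3 : 0 <= e * ln 2 by rewrite mulr_ge0// ltW.
have eC : e * C = `|b| * (p%:R * e) + `|h| * e + e by rewrite /C; ring.
lra.
Qed.

Lemma maximizer_interior p b h m : global_maximizers p b h m -> -1 < m < 1.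
Proof.
case; rewrite in_itv /= => /andP[m1 m2] mmax.
apply/andP; split; rewrite lt_neqAle ?m1 ?m2 andbT; apply/eqP => mE.
- have [x xI] := Hfun1_not_max p ((-1) ^+ p * b) (- h).
  rewrite -!Hfun_opp mE; apply/negP; rewrite -leNgt; apply: mmax.
  by move: xI; rewrite !in_itv /= => /andP[? ?]; lra.
- have [x xI] := Hfun1_not_max p b h.
  by rewrite -mE; apply/negP; rewrite -leNgt; exact: mmax.
Qed.

Lemma maximizer_crit p b h m : global_maximizers p b h m -> Hfun_deriv p b h m = 0.
Proof.
move=> mm; have m1 := maximizer_interior mm.
have [_ <-] := is_derive_Hfun p b h m1.
suff : is_derive m 1 (Hfun p b h) 0 by case.
apply: (@derive1_at_max _ _ (-1) 1); [lra| | |] => [t| |t].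
- by rewrite in_itv /= => /(is_derive_Hfun p b h) [].
- by rewrite in_itv.
- rewrite in_itv /= => /andP[? ?]; apply: mm.2.
  by rewrite in_itv /=; apply/andP; split; exact: ltW.
Qed.


End Energy.

(** * Mean value theorem and second-order expansion *)

Section Calculus.
Context {R : realType}.
Implicit Types (f : R -> R) (a b c m r x : R).

Lemma is_derive_within_continuous f (f' : R -> R) a b :
  (forall x, a <= x <= b -> is_derive x 1 f (f' x)) ->
  {within `[a, b], continuous f}.
Proof.
move=> df; apply: derivable_within_continuous => x.
by rewrite in_itv /= => /df [].
Qed.

Lemma MVT_ex f (f' : R -> R) a b : a < b ->
  (forall x, a <= x <= b -> is_derive x 1 f (f' x)) ->
  exists2 c, a < c < b & f b - f a = f' c * (b - a).
Proof.
move=> ab df; have cf := is_derive_within_continuous df.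
have df' x : x \in `]a, b[ -> is_derive x 1 f (f' x).
  by rewrite in_itv /= => /andP[? ?]; apply: df; rewrite !ltW.
by have [c + fE] := MVT ab df' cf; rewrite in_itv => cab; exists c.
Qed.

Lemma Rolle_zero f (f' : R -> R) a b : a < b ->
  (forall x, a <= x <= b -> is_derive x 1 f (f' x)) -> f a = f b ->
  exists2 c, a < c < b & f' c = 0.
Proof.
move=> ab df fab; have [c cab fE] := MVT_ex ab df; exists c => //.
apply: (@mulIf _ (b - a)); first by rewrite subr_eq0 gt_eqF.
by rewrite -fE fab subrr mul0r.
Qed.

(** f' needs a derivative at m only. The mean value theorem is applied to f minus its quadratic
    part, whose derivative is at most e |x - m| between m and x. *)
Lemma Taylor2_Peano f (f' : R -> R) m c r : 0 < r ->
  (forall x, `|x - m| < r -> is_derive x 1 f (f' x)) ->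
  is_derive m 1 f' c -> f' m = 0 ->
  forall e : R, 0 < e -> exists2 d : R, 0 < d &
    forall x, `|x - m| < d -> `|f x - f m - c / 2 * (x - m) ^+ 2| <= e * (x - m) ^+ 2.
Proof.
move=> r0 df df' f'm e e0.
have f'_near : \forall x \near m, `|f' x - c * (x - m)| <= e * `|x - m|.
  have [/cvg_ex [l hl] dE] := df'.
  have lc : l = c by rewrite -dE; apply/esym/cvg_lim.
  move: hl; rewrite lc => /cvgrPdist_le /(_ _ e0) [d /= d0 hd].
  exists d => //= x xd.
  have [->|xm] := eqVneq x m; first by rewrite !subrr f'm mulr0 subrr normr0 mulr0.
  have xm0 : x - m != 0 by rewrite subr_eq0.
  have := hd (x - m).
  rewrite /ball_ /= sub0r normrN => /(_ _ xm0).
  rewrite [X in X < d]distrC => /(_ xd).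
  rewrite /GRing.scale /= mulr1 subrK f'm subr0 => h.
  have -> : f' x - c * (x - m) = - ((c - (x - m)^-1 * f' x) * (x - m)).
    by field.
  by rewrite normrN normrM ler_pM2r// normr_gt0.
have [d /= d0 hd] := f'_near.
exists (Num.min d r); first by rewrite lt_min d0.
move=> x; rewrite lt_min => /andP[xd xr].
pose g y := f y - c / 2 * (y - m) ^+ 2.
have dg y : `|y - m| < r -> is_derive y 1 g (f' y - c * (y - m)).
  move=> /df dfy; rewrite /g.
  have d1 : is_derive y 1 (fun y : R => y - m) 1.
    by apply: is_derive_eq; rewrite subr0.
  have d2 : is_derive y 1 (fun y : R => (y - m) ^+ 2) (2 * (y - m)).
    rewrite -[X in is_derive _ _ _ X]mulr1.
    apply: (@is_derive1_comp _ (fun z => z ^+ 2) (fun z => z - m)) => //.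
    exact: is_derive_eq (is_derive_exp 2 (y - m)) _.
  by apply: is_derive_eq; rewrite /GRing.scale /=; field.
have gE : f x - f m - c / 2 * (x - m) ^+ 2 = g x - g m.
  by rewrite /g subrr expr0n /= mulr0; ring.
have bnd y : `|y - m| <= `|x - m| -> `|f' y - c * (y - m)| <= e * `|x - m|.
  move=> yx; have : `|f' y - c * (y - m)| <= e * `|y - m|.
    by apply: hd; rewrite /ball_ /= distrC (le_lt_trans yx).
  by move/le_trans; apply; rewrite ler_pM2l.
have sqE : (x - m) ^+ 2 = `|x - m| * `|x - m|.
  by rewrite -[LHS]ger0_norm ?sqr_ge0// expr2 normrM.
rewrite gE {gE} sqE mulrA.
have [xm|xm|->] := ltgtP x m; last by rewrite !subrr normr0 mulr0.
- have [|y /andP[y1 y2] gE] := MVT_ex xm (f' := fun y => f' y - c * (y - m)) (f := g).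
    move=> y /andP[y1 y2]; apply: dg; apply: le_lt_trans xr.
    by rewrite !ler0_norm; lra.
  rewrite -normrN opprB gE normrM (distrC m x) ler_wpM2r//; apply: bnd.
  by rewrite !ler0_norm; lra.
- have [|y /andP[y1 y2] gE] := MVT_ex xm (f' := fun y => f' y - c * (y - m)) (f := g).
    move=> y /andP[y1 y2]; apply: dg; apply: le_lt_trans xr.
    by rewrite !ger0_norm; lra.
  rewrite gE normrM ler_wpM2r//; apply: bnd.
  by rewrite !ger0_norm; lra.
Qed.

End Calculus.

(** * Counting maximizers by Rolle's theorem *)

Section Maximizers.
Context {R : realType}.
Implicit Types (p : nat) (b h x y m e : R).

Lemma Hfun_Taylor p b h m e : -1 < m < 1 -> Hfun_deriv p b h m = 0 -> 0 < e ->
  exists2 d : R, 0 < d & forall x, `|x - m| < d ->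
    `|Hfun p b h x - Hfun p b h m - Hfun_deriv2 p b m / 2 * (x - m) ^+ 2|
      <= e * (x - m) ^+ 2.
Proof.
move=> m1 mcrit e0.
have dd := is_derive_Hfun_deriv p b h m1.
have r0 : 0 < Num.min (m + 1) (1 - m) by rewrite lt_min; lra.
apply: (Taylor2_Peano r0 _ dd mcrit e0).
move=> x; rewrite lt_min !ltr_norml => /andP[/andP[? ?] /andP[? ?]].
by apply: is_derive_Hfun; lra.
Qed.

Lemma maximizer_deriv2_le0 p b h m : global_maximizers p b h m ->
  Hfun_deriv2 p b m <= 0.
Proof.
move=> mm; rewrite leNgt; apply/negP => c0.
have mI := maximizer_interior mm; have /andP[m1 m2] := mI.
have c4 : 0 < Hfun_deriv2 p b m / 4 by lra.
have [d d0 hd] := Hfun_Taylor mI (maximizer_crit mm) c4.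
pose x := m + Num.min (d / 2) ((1 - m) / 2).
have xm0 : 0 < x - m by rewrite addrAC subrr add0r lt_min; lra.
have [xd xm] : x - m <= d / 2 /\ x - m <= (1 - m) / 2.
  by rewrite addrAC subrr add0r; split; rewrite ge_min lexx ?orbT.
have := hd x; rewrite gtr0_norm// => /(_ ltac:(lra)).
have : Hfun p b h x <= Hfun p b h m.
  by apply: mm.2; rewrite in_itv /=; apply/andP; split; lra.
have : 0 < Hfun_deriv2 p b m / 4 * (x - m) ^+ 2 by rewrite mulr_gt0 ?exprn_gt0; lra.
rewrite ler_norml => ? ? /andP[? ?]; lra.
Qed.

Lemma Hfun_Rolle p b h x y : x < y -> -1 < x -> y < 1 ->
  Hfun p b h x = Hfun p b h y -> exists2 t, x < t < y & Hfun_deriv p b h t = 0.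
Proof.
move=> xy ? ? hxy; apply: (Rolle_zero xy _ hxy) => t /andP[? ?].
by apply: is_derive_Hfun; lra.
Qed.

Lemma Hfun_deriv_Rolle p b h x y : x < y -> -1 < x -> y < 1 ->
  Hfun_deriv p b h x = 0 -> Hfun_deriv p b h y = 0 ->
  exists2 t, x < t < y & Hfun_deriv2 p b t = 0.
Proof.
move=> xy ? ? hx hy; have hxy : Hfun_deriv p b h x = Hfun_deriv p b h y by rewrite hx.
apply: (Rolle_zero xy _ hxy) => t /andP[? ?].
by apply: is_derive_Hfun_deriv; lra.
Qed.

(* A zero [t] solves [t ^ (p - 2) - t ^ p = const]; the left-hand side has only
   one positive critical point. *)
Lemma Hfun_deriv2_no_three_zeros p b x y z : (3 <= p)%N -> 0 < x -> x < y -> y < z ->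
  z < 1 -> Hfun_deriv2 p b x = 0 -> Hfun_deriv2 p b y = 0 ->
  Hfun_deriv2 p b z = 0 -> False.
Proof.
case: p => [//|[//|[//|n]]] _ x0 xy yz z1 hx hy hz.
pose g (t : R) := t ^+ n.+1 - t ^+ n.+3.
pose g' (t : R) := n.+1%:R * t ^+ n - n.+3%:R * t ^+ n.+2.
have dg (t : R) : is_derive t 1 g (g' t).
  have d1 := is_derive_exp n.+1 t; have d3 := is_derive_exp n.+3 t.
  by rewrite /g; apply: is_derive_eq; rewrite /g' /=.
have zeroE (t : R) : 0 < t -> t < 1 -> Hfun_deriv2 n.+3 b t = 0 ->
    b * n.+3%:R * n.+2%:R * g t = 1.
  move=> t0 t1 /eqP; rewrite subr_eq0 /= => /eqP tE.
  have t2 : 1 - t ^+ 2 != 0 by nra.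
  have -> : b * n.+3%:R * n.+2%:R * g t =
      (b * n.+3%:R * n.+2%:R * t ^+ n.+1) * (1 - t ^+ 2).
    by rewrite /g !exprS; ring.
  by rewrite tE mulVf.
have C0 : b * n.+3%:R * n.+2%:R != 0.
  apply/eqP => C0; have := zeroE x x0 ltac:(lra) hx; rewrite C0 mul0r => /eqP.
  by rewrite eq_sym oner_eq0.
have gxy : g x = g y.
  by apply: (mulfI C0); rewrite !zeroE//; lra.
have gyz : g y = g z.
  by apply: (mulfI C0); rewrite !zeroE//; lra.
have [u /andP[u1 u2] hu] := Rolle_zero xy (fun t _ => dg t) gxy.
have [w /andP[w1 w2] hw] := Rolle_zero yz (fun t _ => dg t) gyz.
have crit (t : R) : 0 < t -> g' t = 0 -> n.+1%:R = n.+3%:R * t ^+ 2.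
  move=> t0; have -> : g' t = t ^+ n * (n.+1%:R - n.+3%:R * t ^+ 2).
    by rewrite /g' !exprS; ring.
  move=> /eqP; rewrite mulf_eq0 expf_eq0 gt_eqF// andbF /= subr_eq0.
  by move=> /eqP.
have : n.+3%:R * u ^+ 2 = n.+3%:R * w ^+ 2 by rewrite -!crit//; lra.
move/mulfI => /(_ ltac:(by rewrite pnatr_eq0)).
nra.
Qed.

Lemma maximizers_same_value p b h x y : global_maximizers p b h x ->
  global_maximizers p b h y -> Hfun p b h x = Hfun p b h y.
Proof. by move=> [xI hx] [yI hy]; apply: le_anti; rewrite hx// hy. Qed.

(** Two intermediate critical points u, w give zeros x < u < y < w < z of H', hence three zeros of
    H''. The hypothesis on signs places them in (0, 1), where three is too many. *)
Lemma no_three_maximizers p b h x y z : (3 <= p)%N ->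
  (forall t, x < t < z -> Hfun_deriv2 p b t = 0 -> 0 < t) ->
  x < y -> y < z -> global_maximizers p b h x -> global_maximizers p b h y ->
  global_maximizers p b h z -> False.
Proof.
move=> p3 pos xy yz mx my mz.
have /andP[x1 _] := maximizer_interior mx.
have /andP[_ z1] := maximizer_interior mz.
have [u /andP[u1 u2] hu] := Hfun_Rolle xy x1 ltac:(lra) (maximizers_same_value mx my).
have [w /andP[w1 w2] hw] := Hfun_Rolle yz ltac:(lra) z1 (maximizers_same_value my mz).
have cx := maximizer_crit mx.
have cy := maximizer_crit my.
have [a /andP[a1 a2] ha] := Hfun_deriv_Rolle u1 x1 ltac:(lra) cx hu.
have [c /andP[c1 c2] hc] := Hfun_deriv_Rolle u2 ltac:(lra) ltac:(lra) hu cy.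
have [d /andP[d1 d2] hd] := Hfun_deriv_Rolle w1 ltac:(lra) ltac:(lra) cy hw.
have a0 : 0 < a by apply: pos => //; lra.
by apply: (@Hfun_deriv2_no_three_zeros p b a c d) => //; lra.
Qed.

(** Two equal maxima already force two zeros of H'' strictly between them; a degenerate endpoint
    would be a third. *)
Lemma maximizer_pair_nondegenerate p b h x y : (3 <= p)%N ->
  (forall t, x <= t <= y -> Hfun_deriv2 p b t = 0 -> 0 < t) ->
  x < y -> global_maximizers p b h x -> global_maximizers p b h y ->
  Hfun_deriv2 p b x < 0 /\ Hfun_deriv2 p b y < 0.
Proof.
move=> p3 pos xy mx my.
have /andP[x1 _] := maximizer_interior mx.
have /andP[_ y1] := maximizer_interior my.
have [u /andP[u1 u2] hu] := Hfun_Rolle xy x1 ltac:(lra) (maximizers_same_value mx my).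
have cx := maximizer_crit mx.
have cy := maximizer_crit my.
have [a /andP[a1 a2] ha] := Hfun_deriv_Rolle u1 x1 ltac:(lra) cx hu.
have [c /andP[c1 c2] hc] := Hfun_deriv_Rolle u2 ltac:(lra) ltac:(lra) hu cy.
have a0 : 0 < a by apply: pos => //; lra.
split; rewrite lt_neqAle (maximizer_deriv2_le0 (h := h)) // andbT; apply/eqP => h0.
- have x0 : 0 < x by apply: pos => //; lra.
  by apply: (@Hfun_deriv2_no_three_zeros p b x a c) => //; lra.
- by apply: (@Hfun_deriv2_no_three_zeros p b a c y) => //; lra.
Qed.

(** For x <= 0 and odd p both terms of H'' are nonpositive, and the second is negative. *)
Lemma Hfun_deriv2_odd_zero p b x : odd p -> 0 <= b -> -1 < x < 1 ->
  Hfun_deriv2 p b x = 0 -> 0 < x.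
Proof.
case: p => [//|[|n]] /=.
  rewrite /Hfun_deriv2 /= mulr0 mul0r sub0r => _ _ ? /eqP.
  by rewrite oppr_eq0 invr_eq0; nra.
rewrite negbK => on b0 x1 /eqP; rewrite subr_eq0 /= => /eqP xE.
rewrite ltNge; apply/negP => x0.
have : 0 < (1 - x ^+ 2)^-1 by rewrite invr_gt0; nra.
rewrite -xE; apply/negP; rewrite -leNgt.
rewrite mulr_ge0_le0 ?mulr_ge0//.
have -> : n = (n./2.*2).+1 by rewrite -[LHS]odd_double_half on.
rewrite exprS -mul2n exprM mulr_le0_ge0// exprn_ge0// sqr_ge0//.
Qed.

Lemma Hfun_deriv2_at0 p b : (3 <= p)%N -> Hfun_deriv2 p b 0 = -1.
Proof.
by case: p => [//|[//|[//|n]]] _; rewrite /Hfun_deriv2 /= expr0n !expr0n /= mulr0 subr0 invr1 sub0r.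
Qed.

Lemma Hfun_deriv2_at_zero_pos p b x : (3 <= p)%N -> 0 <= x ->
  Hfun_deriv2 p b x = 0 -> 0 < x.
Proof.
move=> p3 x0 hx; rewrite lt_neqAle x0 andbT; apply/eqP => xE.
by move: hx; rewrite -xE Hfun_deriv2_at0// => /eqP; rewrite oppr_eq0 oner_eq0.
Qed.

(** The second hypothesis is the common form in which odd p, and even p with h > 0, supply the
    positivity of the zeros of H''. *)
Lemma two_maximizers p b h : (3 <= p)%N ->
  (forall m t, global_maximizers p b h m -> m <= t < 1 ->
    Hfun_deriv2 p b t = 0 -> 0 < t) ->
  critical p b h -> exists m1 m2, [/\ m1 < m2,
    global_maximizers p b h = [set m1; m2], Hfun_deriv2 p b m1 < 0 &
    Hfun_deriv2 p b m2 < 0].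
Proof.
move=> p3 pos [x [y [mx my xy]]].
wlog {xy} xy : x y mx my / x < y.
  move=> W; have [] := ltgtP x y; [exact: W|exact: W|].
  by move/eqP; rewrite (negPf xy).
have no3 x1 x2 x3 : x1 < x2 -> x2 < x3 -> global_maximizers p b h x1 ->
    global_maximizers p b h x2 -> global_maximizers p b h x3 -> False.
  move=> x12 x23 m1 m2 m3; apply: (no_three_maximizers p3 _ x12 x23 m1 m2 m3).
  have /andP[_ ?] := maximizer_interior m3.
  by move=> t /andP[? ?]; apply: (pos x1) => //; lra.
have [|d1 d2] := maximizer_pair_nondegenerate p3 _ xy mx my.
  have /andP[_ ?] := maximizer_interior my.
  by move=> t /andP[? ?]; apply: (pos x) => //; lra.
exists x, y; split=> //; apply/seteqP; split => [z mz /=|z /= [->|->]//].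
have [zx|zx|] := ltgtP z x; [by case: (no3 z x y)| |by left].
have [zy|zy|] := ltgtP z y; [by case: (no3 x z y)|by case: (no3 x y z)|by right].
Qed.

(** Asymmetry: if m1 = - m2, equality of the values gives b m^p + h m = 0, and the two critical
    equations give b p m^(p-1) + h = 0. Together they force b = h = 0, and then H' vanishes only at
    0. *)
Lemma critical_odd p b h : (3 <= p)%N -> odd p -> 0 <= b -> critical p b h ->
  exists m1 m2, [/\ m1 < m2, global_maximizers p b h = [set m1; m2],
    m1 != - m2, Hfun_deriv2 p b m1 < 0 & Hfun_deriv2 p b m2 < 0].
Proof.
move=> p3 op b0 crit; have [|m1 [m2 [m12 mE d1 d2]]] := two_maximizers p3 _ crit.
  move=> m t /maximizer_interior /andP[? ?] /andP[? ?].
  by apply: Hfun_deriv2_odd_zero => //; lra.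
exists m1, m2; split=> //; apply/eqP => m1E.
have mm1 : global_maximizers p b h m1 by rewrite mE; left.
have mm2 : global_maximizers p b h m2 by rewrite mE; right.
have m20 : 0 < m2 by lra.
have /andP[_ m21] := maximizer_interior mm2.
have vE := maximizers_same_value mm1 mm2.
have c1 := maximizer_crit mm1.
have c2 := maximizer_crit mm2.
move: vE; rewrite m1E Hfun_opp -signr_odd op /= expr1 /Hfun => vE.
have {}vE : b * m2 ^+ p = - (h * m2) by lra.
move: c1 c2; rewrite m1E /Hfun_deriv opprK exprNn -signr_odd.
case: p p3 op {crit mE mm1 mm2 d1 d2} vE => [//|p] p3 /= op vE.
rewrite (negPf op) expr0 mul1r => c1 c2.
have {}vE : b * m2 ^+ p = - h.
  apply: (@mulIf _ m2); first by rewrite gt_eqF.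
  by rewrite -mulrA -exprSr vE mulNr.
have bE : b * p.+1%:R * m2 ^+ p = - h by lra.
have b00 : b * m2 ^+ p = 0.
  have : p.+1%:R * (b * m2 ^+ p) = b * m2 ^+ p.
    by rewrite [RHS]vE -bE; ring.
  rewrite -natr1 mulrDl mul1r => pE.
  have /eqP : p%:R * (b * m2 ^+ p) = 0 by lra.
  rewrite mulf_eq0 pnatr_eq0; case: p {op vE c1 c2 bE pE} p3 => [//|p] _ /=.
  by move/eqP.
move: vE; rewrite b00 => h0.
have {b00} b00 : b = 0.
  by move/eqP: b00; rewrite mulf_eq0 expf_eq0 (gt_eqF m20) andbF orbF => /eqP.
move: c2; rewrite b00 !mul0r add0r -(opprK h) -h0 oppr0 sub0r => /eqP.
rewrite oppr_eq0 mulf_eq0 invr_eq0 pnatr_eq0 /= subr_eq0 => /eqP lnE.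
have : 1 + m2 = 1 - m2 by apply: ln_inj => //; rewrite posrE; lra.
lra.
Qed.

End Maximizers.

(** * Even exponents, reflection symmetry and the threshold [beta_tilde] *)

Section Critical.
Context {R : realType}.
Implicit Types (p : nat) (b h x y m e : R).

Lemma global_maximizers_opp p b h m :
  global_maximizers p b h (- m) <-> global_maximizers p ((-1) ^+ p * b) (- h) m.
Proof.
rewrite /global_maximizers /= !in_itv /= -Hfun_opp; split => -[mI hm].
  split=> [|y yI]; first by move: mI => /andP[? ?]; lra.
  by rewrite -Hfun_opp; apply: hm; move: yI; rewrite !in_itv /= => /andP[? ?]; lra.
split=> [|y yI]; first by move: mI => /andP[? ?]; lra.
rewrite -(opprK y) [leLHS]Hfun_opp; apply: hm.
by move: yI; rewrite !in_itv /= => /andP[? ?]; lra.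
Qed.

Lemma global_maximizers_even p b h m : ~~ odd p ->
  global_maximizers p b h (- m) <-> global_maximizers p b (- h) m.
Proof.
by move=> op; rewrite -[X in _ <-> X](_ : global_maximizers p ((-1) ^+ p * b) (- h) m = _);
  [exact: global_maximizers_opp|rewrite -signr_odd (negPf op) mul1r].
Qed.

Lemma Hfun_even p b h x : ~~ odd p -> Hfun p b h (- x) = Hfun p b (- h) x.
Proof. by move=> op; rewrite Hfun_opp -signr_odd (negPf op) mul1r. Qed.

Lemma Hfun_fieldD p b h x : Hfun p b h x = Hfun p b 0 x + h * x.
Proof. by rewrite /Hfun; ring. Qed.

Lemma Hfun_even_field p b h x : ~~ odd p ->
  Hfun p b h x - Hfun p b h (- x) = 2 * h * x.
Proof. by move=> op; rewrite Hfun_even// (Hfun_fieldD p b h) (Hfun_fieldD p b (- h)); ring. Qed.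

(** By H(m) - H(- m) = 2 h m a positive field makes every maximizer nonnegative. Zeros of H'' to the
    right of one are then positive, because H''(0) = -1, and 0 <= m1 < m2 excludes symmetry. *)
Lemma critical_even_pos p b h : (3 <= p)%N -> ~~ odd p -> 0 < h -> critical p b h ->
  exists m1 m2, [/\ m1 < m2, global_maximizers p b h = [set m1; m2],
    m1 != - m2, Hfun_deriv2 p b m1 < 0 & Hfun_deriv2 p b m2 < 0].
Proof.
move=> p3 op h0 crit.
have pos m : global_maximizers p b h m -> 0 <= m.
  case=> mI mm; have := Hfun_even_field b h m op.
  have : Hfun p b h (- m) <= Hfun p b h m.
    by apply: mm; move: mI; rewrite !in_itv /= => /andP[? ?]; lra.
  move=> ? ?; have : 0 <= h * m by lra.
  by rewrite pmulr_rge0.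
have [|m1 [m2 [m12 mE d1 d2]]] := two_maximizers p3 _ crit.
  move=> m t /pos m0 /andP[? ?]; apply: Hfun_deriv2_at_zero_pos => //; lra.
exists m1, m2; split=> //.
have : 0 <= m1 by apply: pos; rewrite mE; left.
by move=> m10; apply/eqP; lra.
Qed.

Lemma Hfun_deriv2_even p b x : (3 <= p)%N -> ~~ odd p ->
  Hfun_deriv2 p b (- x) = Hfun_deriv2 p b x.
Proof.
case: p => [|[|p]]// _; rewrite /= negbK => op.
by rewrite Hfun_deriv2_opp -signr_odd (negPf op) mul1r.
Qed.

Lemma critical_even p b h : (3 <= p)%N -> ~~ odd p -> h != 0 -> critical p b h ->
  exists m1 m2, [/\ m1 < m2, global_maximizers p b h = [set m1; m2],
    m1 != - m2, Hfun_deriv2 p b m1 < 0 & Hfun_deriv2 p b m2 < 0].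
Proof.
move=> p3 op; rewrite neq_lt => /orP[h0 crit|]; last exact: critical_even_pos.
have [||m1 [m2 [m12 mE m1E d1 d2]]] := @critical_even_pos p b (- h) p3 op.
- lra.
- case: crit => x [y [mx my xy]]; exists (- x), (- y); split.
  + by apply/global_maximizers_even; rewrite ?opprK.
  + by apply/global_maximizers_even; rewrite ?opprK.
  + by rewrite eqr_opp.
exists (- m2), (- m1); rewrite !Hfun_deriv2_even//; split => //.
- by rewrite ltrN2.
- apply/seteqP; split => m /=.
    rewrite -{1}(opprK m) => /(global_maximizers_even _ _ _ op).
    by rewrite mE => -[] <-; rewrite opprK; [right|left].
  by case=> ->; apply/(global_maximizers_even _ _ _ op); rewrite mE; [right|left].
- by rewrite eqr_opp eq_sym eqr_oppLR.
Qed.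

Lemma Hfun_at0 p b h : (0 < p)%N -> Hfun p b h 0 = 0.
Proof.
move=> p0; rewrite /Hfun /entropy expr0n gtn_eqF//= !addr0 subr0 ln1.
by rewrite !mulr0 !addr0 !mulr0 subr0.
Qed.

Lemma Hfun_deriv_at0 p b : (3 <= p)%N -> Hfun_deriv p b 0 0 = 0.
Proof.
by case: p => [|[|p]]// _; rewrite /Hfun_deriv /= expr0n /= !addr0 !subr0 subrr !mulr0 subr0.
Qed.

(* [0] is a strict local maximizer, so [H] has an interior minimum on [[0, m]]. *)
Lemma pos_maximizer_dip p b m : (3 <= p)%N -> 0 < m -> global_maximizers p b 0 m ->
  exists2 t, 0 < t < m & Hfun_deriv p b 0 t = 0.
Proof.
move=> p3 m0 mm; have /andP[_ m1] := maximizer_interior mm.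
have p0 : (0 < p)%N by exact: leq_trans p3.
have Hm : Hfun p b 0 0 <= Hfun p b 0 m by apply: mm.2; rewrite in_itv /=; lra.
have I0 : -1 < (0 : R) < 1 by lra.
have e0 : 0 < 4^-1 :> R by lra.
have [d d0] := Hfun_Taylor I0 (Hfun_deriv_at0 b p3) e0.
rewrite Hfun_deriv2_at0// => hd.
(* With error 1/4 the expansion gives H(x) <= H(0) - x^2 / 4, which is below both endpoint values on
   [0, m]; the minimum is therefore interior. *)
pose x := Num.min (d / 2) (m / 2).
have x0 : 0 < x by rewrite lt_min; lra.
have [xd xm] : x <= d / 2 /\ x <= m / 2.
  by split; rewrite ge_min lexx ?orbT.
have Hx : Hfun p b 0 x < Hfun p b 0 0.
  have := hd x; rewrite subr0 gtr0_norm// => /(_ ltac:(lra)).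
  have : 0 < x ^+ 2 by rewrite exprn_gt0.
  rewrite ler_norml => ? /andP[? ?]; lra.
have cH : {within `[0, m], continuous (Hfun p b 0)}.
  by apply: continuous_subspaceT; exact: continuous_Hfun.
have [c + cmin] := EVT_min (ltW m0) cH.
rewrite in_itv /= => /andP[c0 cm].
have Hcx : Hfun p b 0 c <= Hfun p b 0 x by apply: cmin; rewrite in_itv /=; lra.
have {}c0 : 0 < c.
  by rewrite lt_neqAle c0 andbT; apply/eqP => cE; move: Hcx; rewrite -cE leNgt Hx.
have {}cm : c < m.
  rewrite lt_neqAle cm andbT; apply/eqP => cE; move: Hcx.
  by rewrite cE leNgt (lt_le_trans Hx).
exists c; first by rewrite c0.
have cI : -1 < c < 1 by lra.
have [_ <-] := is_derive_Hfun p b 0 cI.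
suff : is_derive c 1 (Hfun p b 0) 0 by case.
apply: (derive1_at_min (ltW m0)); last by move=> t; rewrite in_itv /= => /andP[? ?];
  apply: cmin; rewrite in_itv /=; lra.
  move=> t; rewrite in_itv /= => /andP[? ?].
  have tI : -1 < t < 1 by lra.
  by have [] := is_derive_Hfun p b 0 tI.
by rewrite in_itv /= c0.
Qed.

(** The zeros 0 < t < m of H' give two zeros of H'' inside (0, m), so m cannot be a third. *)
Lemma pos_maximizer_nondegenerate p b m : (3 <= p)%N -> 0 < m ->
  global_maximizers p b 0 m -> Hfun_deriv2 p b m < 0.
Proof.
move=> p3 m0 mm; have /andP[_ m1] := maximizer_interior mm.
have [t /andP[t0 tm] ht] := pos_maximizer_dip p3 m0 mm.
have [x /andP[? ?] hx] := Hfun_deriv_Rolle t0 ltac:(lra) ltac:(lra) (Hfun_deriv_at0 b p3) ht.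
have [y /andP[? ?] hy] := Hfun_deriv_Rolle tm ltac:(lra) m1 ht (maximizer_crit mm).
rewrite lt_neqAle (maximizer_deriv2_le0 mm) andbT; apply/eqP => h0.
by apply: (@Hfun_deriv2_no_three_zeros _ p b x y m) => //; lra.
Qed.

(** With the critical point t between them, H' would vanish at 0 < m < t < m' and H'' three times in
    (0, 1). *)
Lemma pos_maximizer_unique p b m m' : (3 <= p)%N -> 0 < m -> m < m' ->
  global_maximizers p b 0 m -> global_maximizers p b 0 m' -> False.
Proof.
move=> p3 m0 mm' hm hm'; have /andP[_ m1] := maximizer_interior hm'.
have [t /andP[t0 tm] ht] := Hfun_Rolle mm' ltac:(lra) m1 (maximizers_same_value hm hm').
have cm := maximizer_crit hm.
have [x /andP[? ?] hx] := Hfun_deriv_Rolle m0 ltac:(lra) ltac:(lra) (Hfun_deriv_at0 b p3) cm.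
have [y /andP[? ?] hy] := Hfun_deriv_Rolle t0 ltac:(lra) ltac:(lra) cm ht.
have [z /andP[? ?] hz] := Hfun_deriv_Rolle tm ltac:(lra) m1 ht (maximizer_crit hm').
by apply: (@Hfun_deriv2_no_three_zeros _ p b x y z) => //; lra.
Qed.

Lemma sup_Hfun_eq0 p b : (0 < p)%N ->
  sup [set Hfun p b 0 x | x in [set` `[-1, 1]]] = 0 <->
  forall x, x \in `[-1, 1] -> Hfun p b 0 x <= 0.
Proof.
move=> p0; have I0 : (0 : R) \in `[-1, 1] by rewrite in_itv /=; lra.
split=> [s0 x xI|h].
  rewrite -[leRHS]s0; apply: sup_upper_bound; last by exists x.
  apply: compact_has_sup; first by exists (Hfun p b 0 0), 0.
  apply: continuous_compact; last exact: segment_compact.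
  by apply: continuous_subspaceT; exact: continuous_Hfun.
apply: le_anti; apply/andP; split.
  by apply: ge_sup; [by exists (Hfun p b 0 0), 0|move=> _ [x xI <-]; exact: h].
apply: ub_le_sup; last by exists 0 => //; rewrite Hfun_at0.
by exists 0 => _ [x xI <-]; exact: h.
Qed.

Lemma mul_ln_ge x : 0 <= x -> x - 1 <= x * ln x.
Proof.
rewrite le_eqVlt => /orP[/eqP <-|x0]; first by rewrite mul0r; lra.
have : ln (1 + (x^-1 - 1)) <= x^-1 - 1 by apply: le_ln1Dx; rewrite ltrBrDl subrr invr_gt0.
rewrite addrC subrK lnV ?posrE// -(ler_pM2l x0) mulrBr mulfV ?gt_eqF//.
lra.
Qed.

Lemma beta_tilde_has_sup p : (0 < p)%N ->
  has_sup [set b : R | 0 <= b /\ sup [set Hfun p b 0 x | x in [set` `[-1, 1]]] = 0].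
Proof.
move=> p0; split.
  exists 0; split=> //; apply/sup_Hfun_eq0 => // x; rewrite in_itv /= => /andP[x1 x2].
  rewrite /Hfun !mul0r addr0 sub0r oppr_le0 /entropy mulr_ge0//.
  have := @mul_ln_ge (1 + x) ltac:(lra); have := @mul_ln_ge (1 - x) ltac:(lra).
  lra.
(* At x = 1 the condition reads b - ln 2 <= 0. *)
exists (ln 2) => b [_ /sup_Hfun_eq0] /(_ p0 1).
rewrite in_itv /= /Hfun /entropy subrr mul0r addr0 expr1n mulr1 mul0r addr0.
have -> : 1 + 1 = 2 :> R by [].
by rewrite mulKf ?pnatr_eq0// subr_le0 => /(_ ltac:(lra)).
Qed.

(** The supremum is attained: replacing b by b' moves H(x) by at most |b - b'|, so H(x) > 0 would
    persist at an element b' of the set within H(x) of b. *)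
Lemma beta_tilde_ge p b x : (0 < p)%N -> b = beta_tilde p -> x \in `[-1, 1] ->
  Hfun p b 0 x <= 0.
Proof.
move=> p0 bE xI; rewrite leNgt; apply/negP => Hx.
have [b' b'S b'b] := sup_adherent Hx (beta_tilde_has_sup p0).
have b'le : b' <= b.
  by rewrite bE; apply: sup_upper_bound => //; exact: beta_tilde_has_sup.
have [_ /(sup_Hfun_eq0 _ p0) /(_ x xI) Hb'] := b'S.
move: b'b; rewrite -[sup _]/(beta_tilde p) -bE => b'b.
have xp : x ^+ p <= 1.
  apply: le_trans (ler_norm _) _; rewrite normrX exprn_ile1//.
  by move: xI; rewrite in_itv /= ler_norml.
have : (b - b') * x ^+ p <= b - b' by rewrite ler_piMr// subr_ge0.
have -> : (b - b') * x ^+ p = Hfun p b 0 x - Hfun p b' 0 x by rewrite /Hfun; ring.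
lra.
Qed.

Lemma beta_tilde_lt p b : (0 < p)%N -> 0 <= b -> beta_tilde p < b ->
  exists2 x, x \in `[-1, 1] & 0 < Hfun p b 0 x.
Proof.
move=> p0 b0 bb; apply: contrapT => Hle; suff : b <= beta_tilde p by lra.
apply: sup_upper_bound; first exact: beta_tilde_has_sup.
split=> //; apply/sup_Hfun_eq0 => // x xI; rewrite leNgt; apply/negP => Hx.
by apply: Hle; exists x.
Qed.

Lemma critical_has_pos_maximizer p b : ~~ odd p -> critical p b 0 ->
  exists2 m, 0 < m & global_maximizers p b 0 m.
Proof.
move=> op [x [y [mx my xy]]].
have key z : z != 0 -> global_maximizers p b 0 z ->
    exists2 m, 0 < m & global_maximizers p b 0 m.
  rewrite neq_lt => /orP[z0 mz|z0 mz]; last by exists z.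
  by exists (- z); [rewrite oppr_gt0|apply/global_maximizers_even; rewrite // oppr0].
have [x0|x0] := eqVneq x 0; last exact: key mx.
by apply: key my; rewrite -x0 eq_sym.
Qed.

(** As H(0) = 0, the sign of H(m) decides whether 0 is a third maximizer; comparing b with
    [beta_tilde] decides that sign. *)
Lemma critical_symmetric p b : (3 <= p)%N -> ~~ odd p -> critical p b 0 ->
  exists m, [/\ 0 < m, Hfun_deriv2 p b m < 0,
    0 < Hfun p b 0 m -> global_maximizers p b 0 = [set - m; m] &
    Hfun p b 0 m <= 0 -> global_maximizers p b 0 = [set - m; 0; m]].
Proof.
move=> p3 op crit; have p0 : (0 < p)%N by exact: leq_trans p3.
have [m m0 mm] := critical_has_pos_maximizer op crit.
have mN : global_maximizers p b 0 (- m).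
  by apply/global_maximizers_even; rewrite // oppr0.
have pos z : 0 < z -> global_maximizers p b 0 z -> z = m.
  move=> z0 mz; have [zm|mz'|//] := ltgtP z m.
    by case: (pos_maximizer_unique p3 z0 zm mz mm).
  by case: (pos_maximizer_unique p3 m0 mz' mm mz).
have all z : z != 0 -> global_maximizers p b 0 z -> z = - m \/ z = m.
  rewrite neq_lt => /orP[z0 mz|z0 mz]; last by right; exact: pos.
  left; rewrite -(@pos (- z)) ?opprK ?oppr_gt0//.
  by apply/global_maximizers_even; rewrite // oppr0.
exists m; split => //; first exact: pos_maximizer_nondegenerate mm.
- move=> Hm; apply/seteqP; split => z /=; last by case=> ->.
  move=> mz; apply: all (mz); apply/eqP => z0.
  by move: Hm; rewrite -(maximizers_same_value mz mm) z0 Hfun_at0// ltxx.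
- move=> Hm; apply/seteqP; split => z /=.
    move=> mz; have [->|z0] := eqVneq z 0; first by left; right.
    by have [->|->] := all z z0 mz; [left; left|right].
  case=> [[->//|->]|->//]; split; first by rewrite in_itv /=; lra.
  by move=> y /mm.2 /le_trans; apply; rewrite Hfun_at0.
Qed.

End Critical.

(** * Gap and curvature at the maximizers, Stirling's formula *)

Section Gap.
Context {R : realType}.
Implicit Types (p : nat) (b h x m e d : R).

(** Compactness makes the loss off the maximizers uniform, so that a factor e^(-eN) is available
    there. *)
Lemma Hfun_gap p b h (K : set R) m : closed K ->
  (forall x, K x -> x \in `[-1, 1] /\ ~ global_maximizers p b h x) ->
  global_maximizers p b h m ->
  exists2 e, 0 < e & forall x, K x -> Hfun p b h x <= Hfun p b h m - e.
Proof.
move=> cK K1 mm; have [[x0 Kx0]|K0] := pselect (K !=set0); last first.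
  by exists 1 => // x Kx; case: K0; exists x.
have coK : compact K.
  have -> : K = K `&` [set` `[-1, 1]].
    by apply/seteqP; split=> [x Kx|x []//]; split=> //; exact: (K1 x Kx).1.
  by rewrite setIC; apply: compact_closedI => //; exact: segment_compact.
have cH : {within K, continuous (Hfun p b h)}.
  by apply: continuous_subspaceT; exact: continuous_Hfun.
have [c + cmax] := compact_EVT_max (ex_intro _ x0 Kx0) coK cH.
rewrite inE => Kc; have [cI cN] := K1 c Kc.
exists (Hfun p b h m - Hfun p b h c).
  rewrite subr_gt0 lt_neqAle mm.2// andbT; apply/eqP => cE; apply: cN.
  by split=> // y /mm.2; rewrite cE.
by move=> x Kx; rewrite opprB addrC subrK cmax// inE.
Qed.

(** Half of the curvature is given up to absorb the Taylor error; the rest yields a Gaussian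
    majorant. *)
Lemma Hfun_local_quadratic p b h m : global_maximizers p b h m ->
  Hfun_deriv2 p b m < 0 -> exists2 d, 0 < d & forall x, `|x - m| < d ->
    Hfun p b h x <= Hfun p b h m + Hfun_deriv2 p b m / 4 * (x - m) ^+ 2.
Proof.
move=> mm v0; have e0 : 0 < - Hfun_deriv2 p b m / 4 by lra.
have [d d0 hd] := Hfun_Taylor (maximizer_interior mm) (maximizer_crit mm) e0.
exists d => // x /hd; rewrite ler_norml => /andP[_ ?].
lra.
Qed.

End Gap.

(** * Stirling's formula up to its constant *)

Section Stirling.
Context {R : realType}.

(** At u = (n + 1) / n the left-hand side times n + 1/2 is exactly 1, which makes the Stirling
    defect nonincreasing. *)
Lemma ln_ge_frac (u : R) : 1 <= u -> 2 * (u - 1) / (u + 1) <= ln u.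
Proof.
rewrite le_eqVlt => /orP[/eqP <-|u1]; first by rewrite subrr mulr0 mul0r ln1.
pose f (y : R) := ln y - (2 - 4 * (y + 1)^-1).
pose f' (y : R) := y^-1 - 4 * ((y + 1) ^+ 2)^-1.
have df y : 1 <= y <= u -> is_derive y 1 f (f' y).
  move=> /andP[y1 yu].
  have d1 : is_derive y 1 (@ln R) y^-1 by apply: is_derive1_ln; lra.
  have d2 : is_derive y 1 (fun y : R => y + 1) 1.
    by apply: is_derive_eq; rewrite addr0.
  have d3 : is_derive y 1 (fun y : R => (y + 1)^-1) (- ((y + 1) ^+ 2)^-1).
    have y0 : y + 1 != 0 by lra.
    have := @is_deriveV _ (fun y => y + 1) y 1 1 y0 d2.
    by rewrite /GRing.scale /= mulr1.
  rewrite /f; apply: is_derive_eq; rewrite /GRing.scale /f' /=; ring.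
have [c /andP[c1 c2] fE] := MVT_ex u1 df.
have : 0 <= f u - f 1.
  rewrite fE; apply: mulr_ge0; [rewrite /f'|lra].
  have -> : c^-1 - 4 * ((c + 1) ^+ 2)^-1 = (c - 1) ^+ 2 * (c * (c + 1) ^+ 2)^-1.
    by field; apply/andP; split; lra.
  by rewrite mulr_ge0 ?sqr_ge0// invr_ge0 mulr_ge0 ?sqr_ge0//; lra.
have f1 : f 1 = 0 by rewrite /f ln1; field.
rewrite f1 subr0 /f subr_ge0; apply: le_trans.
suff -> : 2 * (u - 1) / (u + 1) = 2 - 4 * (u + 1)^-1 by [].
by field; lra.
Qed.

(** At u = (n + 1) / n the right-hand side times n + 1/2 exceeds 1 by (1/n - 1/(n + 1)) / 4, an
    error that telescopes. *)
Lemma ln_le_frac (u : R) : 1 <= u -> ln u <= (u - u^-1) / 2.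
Proof.
rewrite le_eqVlt => /orP[/eqP <-|u1]; first by rewrite ln1 invr1 subrr mul0r.
pose f (y : R) := 2^-1 * (y - y^-1) - ln y.
pose f' (y : R) := 2^-1 * (1 + (y ^+ 2)^-1) - y^-1.
have df y : 1 <= y <= u -> is_derive y 1 f (f' y).
  move=> /andP[y1 yu].
  have d1 : is_derive y 1 (@ln R) y^-1 by apply: is_derive1_ln; lra.
  have d3 : is_derive y 1 (fun y : R => y^-1) (- (y ^+ 2)^-1).
    have y0 : y != 0 by lra.
    have := @is_deriveV _ id y 1 1 y0 (is_derive_id y 1).
    by rewrite /GRing.scale /= mulr1.
  rewrite /f; apply: is_derive_eq; rewrite /GRing.scale /f' /=; ring.
have [c /andP[c1 c2] fE] := MVT_ex u1 df.
have : 0 <= f u - f 1.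
  rewrite fE; apply: mulr_ge0; [rewrite /f'|lra].
  have -> : 2^-1 * (1 + (c ^+ 2)^-1) - c^-1 = 2^-1 * (1 - c^-1) ^+ 2.
    by field; lra.
  by rewrite mulr_ge0 ?sqr_ge0.
have f1 : f 1 = 0 by rewrite /f ln1 invr1 subrr mulr0 subr0.
by rewrite f1 subr0 /f subr_ge0 mulrC.
Qed.

(** For n > 0, the logarithm of n! e^n / n^(n + 1/2). *)
Definition stirling_defect (n : nat) : R :=
  ln n`!%:R - (n%:R + 2^-1) * ln n%:R + n%:R.

Lemma stirling_defect_step n : (0 < n)%N ->
  0 <= stirling_defect n - stirling_defect n.+1 <= 4^-1 * (n%:R^-1 - n.+1%:R^-1).
Proof.
move=> n0; have n0R : 0 < n%:R :> R by rewrite ltr0n.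
have S0R : 0 < n.+1%:R :> R by rewrite ltr0n.
pose u : R := n.+1%:R / n%:R.
have u1 : 1 <= u by rewrite ler_pdivlMr// mul1r ler_nat.
have -> : stirling_defect n - stirling_defect n.+1 = (n%:R + 2^-1) * ln u - 1.
  rewrite /stirling_defect /u factS natrM lnM ?posrE ?ltr0n ?fact_gt0//.
  rewrite ln_div ?posrE// -(natr1 n); ring.
have := ln_ge_frac u1; have := ln_le_frac u1.
have SE : n.+1%:R = n%:R + 1 :> R by rewrite natr1.
have hp : 0 < n%:R + 2^-1 :> R by lra.
rewrite -(ler_pM2l hp) -[_ <= ln u](ler_pM2l hp).
have -> : (n%:R + 2^-1) * (2 * (u - 1) / (u + 1)) = 1.
  rewrite /u SE; field; apply/andP; split; lra.
have -> : (n%:R + 2^-1) * ((u - u^-1) / 2) = 1 + 4^-1 * (n%:R^-1 - n.+1%:R^-1).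
  rewrite /u SE; field; apply/andP; split; lra.
by rewrite subr_ge0 lerBlDr [_ + 1]addrC => -> ->.
Qed.

(** The total telescoped loss from the value 1 at n = 1 is at most 1/4. The window is narrow enough
    that one defect minus two others is negative, as [stirling_factor_bound] requires. *)
Lemma stirling_defect_bounds n : (0 < n)%N -> 3 / 4 <= stirling_defect n <= 1.
Proof.
have d1 : stirling_defect 1 = 1 by rewrite /stirling_defect /= ln1 mulr0 subr0 add0r.
elim: n => [//|[|n] IH] _; first by rewrite d1; lra.
suff H : forall n, 1 - 4^-1 * (1 - n.+1%:R^-1) <= stirling_defect n.+1 <= 1.
  have /andP[] := H n.+1; have : 0 < n.+2%:R^-1 :> R by rewrite invr_gt0.
  by move: (n.+2%:R^-1) => x ? ? ->; rewrite andbT; lra.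
move=> {IH} k; elim: k => [|k IH]; first by rewrite d1 invr1; lra.
have /(_ isT)/andP[] := @stirling_defect_step k.+1.
case/andP: IH; move: (k.+1%:R^-1) (k.+2%:R^-1) => x y *.
by apply/andP; split; lra.
Qed.

Lemma stirling_defect_cvg : exists D : R, stirling_defect n @[n --> \oo] --> D.
Proof.
have nonincr : nonincreasing_seq (fun n => stirling_defect n.+1).
  apply/nonincreasing_seqP => n.
  by have /(_ isT)/andP[+ _] := @stirling_defect_step n.+1; rewrite subr_ge0.
have lb : has_lbound (range (fun n => stirling_defect n.+1)).
  exists (3 / 4) => _ [n _ <-].
  by have /(_ isT)/andP[] := @stirling_defect_bounds n.+1.
have := nonincreasing_is_cvgn nonincr lb => /cvg_ex [D hD].
by exists D; rewrite -(cvg_shiftS stirling_defect).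
Qed.

End Stirling.

(** * The finite model and its maximum likelihood estimate *)

Section ExponentialTilting.
Context {R : realType} (T : finType) (w m : T -> R).
Hypothesis w0 : forall s, 0 < w s.

Definition tilted_mass r := \sum_s w s * expR (r * m s).
Definition tilted_mean r := (\sum_s w s * expR (r * m s) * m s) / tilted_mass r.
(** Its sign is that of [tilted_mean r - c], and it has no denominator. *)
Definition tilted_moment c r := \sum_s w s * expR (r * m s) * (m s - c).

Let we0 r s : 0 < w s * expR (r * m s).
Proof. by rewrite mulr_gt0 ?expR_gt0. Qed.

Lemma sum_gt0_witness (f : T -> R) s0 : (forall s, 0 <= f s) -> 0 < f s0 ->
  0 < \sum_s f s.
Proof.
move=> f0 fs0; rewrite (bigD1 s0)//= ltr_pwDl// sumr_ge0 //.
Qed.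

Lemma tilted_mass_gt0 (s0 : T) r : 0 < tilted_mass r.
Proof. by apply: (@sum_gt0_witness _ s0) => [s|]; [exact: ltW|exact: we0]. Qed.

Lemma tilted_momentE (s0 : T) c r :
  tilted_moment c r = (tilted_mean r - c) * tilted_mass r.
Proof.
rewrite mulrBl divfK ?gt_eqF ?(tilted_mass_gt0 s0)// /tilted_mass mulr_sumr -sumrB.
by apply: eq_bigr => s _; rewrite mulrBr (mulrC c).
Qed.

Lemma tilted_mean_gtE (s0 : T) c r : (c < tilted_mean r) = (0 < tilted_moment c r).
Proof. by rewrite (tilted_momentE s0) pmulr_lgt0 ?(tilted_mass_gt0 s0)// subr_gt0. Qed.

Lemma tilted_mean_ltE (s0 : T) c r : (tilted_mean r < c) = (tilted_moment c r < 0).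
Proof. by rewrite (tilted_momentE s0) pmulr_llt0 ?(tilted_mass_gt0 s0)// subr_lt0. Qed.

Lemma tilted_mean_lt c r s0 : (forall s, m s <= c) -> m s0 < c -> tilted_mean r < c.
Proof.
move=> mc ms; rewrite (tilted_mean_ltE s0) -oppr_gt0 -sumrN.
apply: (@sum_gt0_witness _ s0) => [s|]; rewrite -mulrN opprB.
  by rewrite mulr_ge0 ?(ltW (we0 _ _))// subr_ge0.
by rewrite mulr_gt0// subr_gt0.
Qed.

Lemma tilted_mean_gt c r s0 : (forall s, c <= m s) -> c < m s0 -> c < tilted_mean r.
Proof.
move=> mc ms; rewrite (tilted_mean_gtE s0).
apply: (@sum_gt0_witness _ s0) => [s|].
  by rewrite mulr_ge0 ?(ltW (we0 _ _))// subr_ge0.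
by rewrite mulr_gt0// subr_gt0.
Qed.

(* With [u = tilted_mean r], the sum [\sum_s w s e^(r m s) (m s - u)] vanishes,
   and multiplying its terms by [e^((r' - r) m s)] increases it strictly. *)
Lemma tilted_mean_incr s0 s1 r r' : m s0 < m s1 -> r < r' ->
  tilted_mean r < tilted_mean r'.
Proof.
move=> ms rr'; set u := tilted_mean r; rewrite (tilted_mean_gtE s0).
have u0 : tilted_moment u r = 0 by rewrite (tilted_momentE s0) subrr mul0r.
have -> : tilted_moment u r' = \sum_s w s * expR (r * m s) *
    ((m s - u) * (expR ((r' - r) * m s) - expR ((r' - r) * u))).
  under [RHS]eq_bigr do rewrite mulrBr mulrBr.
  rewrite sumrB -[LHS]subr0; congr (_ - _).
    apply: eq_bigr => s _; rewrite -!mulrA; congr (_ * _).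
    by rewrite mulrCA -expRD -mulrDl (addrC r) subrK mulrC.
  under eq_bigr do rewrite mulrA.
  by rewrite -mulr_suml -/(tilted_moment u r) u0 mul0r.
have d0 : 0 < r' - r by rewrite subr_gt0.
have pos x : x != u -> 0 < (x - u) * (expR ((r' - r) * x) - expR ((r' - r) * u)).
  rewrite neq_lt => /orP[xu|ux].
    by rewrite nmulr_rgt0 ?subr_lt0// ltr_expR ltr_pM2l.
  by rewrite mulr_gt0 ?subr_gt0// ltr_expR ltr_pM2l.
have [s su] : exists s, m s != u.
  have [m0|] := eqVneq (m s0) u; last by exists s0.
  by exists s1; rewrite -m0 gt_eqF.
apply: (@sum_gt0_witness _ s) => [s'|].
  rewrite mulr_ge0 ?(ltW (we0 _ _))//.
  have [->|/pos/ltW//] := eqVneq (m s') u.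
  by rewrite subrr mul0r.
by rewrite mulr_gt0 ?pos.
Qed.

Lemma continuous_tilted_moment c : continuous (tilted_moment c).
Proof.
apply: continuous_big => [|s _ r]; first exact: add_continuous.
apply: cvgM; last exact: cvg_cst.
apply: cvgM; first exact: cvg_cst.
apply: (cvg_comp (fun r : R => r * m s) expR); last exact: continuous_expR.
by apply: cvgM; [exact: cvg_id|exact: cvg_cst].
Qed.

(** After a factor e^(rc) is removed, the states other than s0 contribute at least - A, and r is
    chosen so that the inequality 1 + x <= e^x makes s0 contribute at least A + B. *)
Lemma tilted_mean_unbounded c s0 : c < m s0 -> exists2 r : R, 0 <= r & c < tilted_mean r.
Proof.
move=> ms.
pose A := \sum_s w s * `|m s - c|.
pose B := w s0 * (m s0 - c).
have B0 : 0 < B by rewrite mulr_gt0// subr_gt0.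
have A0 : 0 <= A by apply: sumr_ge0 => s _; rewrite mulr_ge0// ltW.
pose r := (A / B) / (m s0 - c).
have r0 : 0 <= r.
  by rewrite /r divr_ge0 ?subr_ge0 ?(ltW ms)// divr_ge0// ltW.
exists r => //; rewrite (tilted_mean_gtE s0).
rewrite -(pmulr_rgt0 _ (expR_gt0 (- (r * c)))) mulr_sumr.
have E s : expR (- (r * c)) * (w s * expR (r * m s) * (m s - c)) =
    w s * (expR (r * (m s - c)) * (m s - c)).
  by rewrite [r * (m s - c)]mulrBr expRD; ring.
under eq_bigr do rewrite E.
rewrite (bigD1 s0)//=.
have h1 : A + B <= w s0 * (expR (r * (m s0 - c)) * (m s0 - c)).
  rewrite mulrCA -/B.
  have : (1 + r * (m s0 - c)) * B <= expR (r * (m s0 - c)) * B.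
    by rewrite ler_pM2r// expR_ge1Dx.
  have -> : r * (m s0 - c) = A / B by rewrite /r divfK// gt_eqF// subr_gt0.
  by rewrite mulrDl mul1r divfK ?gt_eqF// addrC.
have h2 : - A <= \sum_(s | s != s0) w s * (expR (r * (m s - c)) * (m s - c)).
  rewrite lerNl -sumrN; apply: (@le_trans _ _ (\sum_(s | s != s0) w s * `|m s - c|)).
    apply: ler_sum => s _; rewrite -mulrN ler_pM2l// -mulrN.
    have [mc|mc] := leP (m s) c.
      rewrite ler0_norm ?subr_le0// ler_piMl ?oppr_ge0 ?subr_le0//.
      by rewrite expR_le1 mulr_ge0_le0// subr_le0.
    rewrite gtr0_norm ?subr_gt0//; apply: (@le_trans _ _ 0); last by rewrite subr_ge0 ltW.
    by rewrite mulr_ge0_le0 ?expR_ge0// oppr_le0 subr_ge0 ltW.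
  rewrite /A [leRHS](bigD1 s0)//= lerDr mulr_ge0//; exact: ltW.
lra.
Qed.

End ExponentialTilting.

Section TiltedMeanSurjective.
Context {R : realType} (T : finType) (w m : T -> R).
Hypothesis w0 : forall s, 0 < w s.

Lemma tilted_mean_opp r : tilted_mean w (fun s => - m s) r = - tilted_mean w m (- r).
Proof.
have E s : expR (r * - m s) = expR (- r * m s) by congr expR; ring.
rewrite /tilted_mean /tilted_mass -mulNr -sumrN; congr (_ / _);
  by apply: eq_bigr => s _; rewrite E ?mulrN.
Qed.

(** The intermediate value theorem is applied to the moment; the left end of the interval comes from
    the reflected statistic - m. *)
Lemma tilted_mean_surj c s0 s1 : m s0 < c -> c < m s1 -> exists r, tilted_mean w m r = c.
Proof.
move=> m0 m1.
have [r1 r10] := tilted_mean_unbounded w0 m1; rewrite (tilted_mean_gtE m w0 s0) => h1.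
have [|r0 r00] := @tilted_mean_unbounded _ _ w (fun s => - m s) w0 (- c) s0.
  by rewrite ltrN2.
rewrite tilted_mean_opp ltrN2 (tilted_mean_ltE m w0 s0) => h0.
have cM : {within `[- r0, r1], continuous (tilted_moment w m c)}.
  by apply: continuous_subspaceT; exact: continuous_tilted_moment.
have r01 : - r0 <= r1 by lra.
have zmid : Num.min (tilted_moment w m c (- r0)) (tilted_moment w m c r1) <= 0 <=
    Num.max (tilted_moment w m c (- r0)) (tilted_moment w m c r1).
  by rewrite ge_min le_max (ltW h0) (ltW h1) orbT.
have [r _ hr] := IVT r01 cM zmid.
exists r; apply/eqP; rewrite -subr_eq0.
move/eqP: hr; rewrite (tilted_momentE m w0 s0) mulf_eq0 => /orP[//|].
by rewrite gt_eqF// tilted_mass_gt0.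
Qed.

End TiltedMeanSurjective.

(** * Reduction of the model to the lattice of magnetizations *)

Section FiniteModel.
Context {R : realType}.
Implicit Types (p N : nat) (b h t : R).

(** The magnetization attained with k spins +1 among N. *)
Definition grid N (k : nat) : R := (2 * k%:R - N%:R) / N%:R.

Definition nb_plus N (s : config N) : nat := #|[pred i | s i]|.

Lemma magnetization_grid N (s : config N) : magnetization s = grid N (nb_plus s).
Proof.
rewrite /magnetization /grid /nb_plus; congr (_ / _).
have -> : \sum_(i < N) spin (s i) = \sum_(i < N) ((s i)%:R * 2 - 1 : R).
  by apply: eq_bigr => i _; case: (s i); rewrite /= ?mul1r ?mul0r /spin; lra.
rewrite sumrB sumr_const card_ord -mulr_suml mulrC; congr (2 * _ - _).
rewrite -sum1_card natr_sum [RHS]big_mkcond /=; apply: eq_bigr => i _.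
by rewrite inE; case: (s i).
Qed.

Lemma sum_config N (f : R -> R) :
  \sum_(s : config N) f (magnetization s) =
  \sum_(k < N.+1) 'C(N, k)%:R * f (grid N k).
Proof.
under eq_bigr do rewrite magnetization_grid.
pose F k := f (grid N k).
rewrite (reindex (fun A : {set 'I_N} => [ffun i => i \in A])) /=; last first.
  exists (fun s : config N => [set i | s i]%SET) => [A _|s _].
    by apply/setP => i; rewrite inE ffunE.
  by apply/ffunP => i; rewrite ffunE inE.
have nbE (A : {set 'I_N}) : nb_plus [ffun i => i \in A] = #|A|.
  by apply: eq_card => i; rewrite inE ffunE.
under eq_bigr do rewrite nbE.
have ltA (A : {set 'I_N}) : (#|A| < N.+1)%N.
  by rewrite ltnS -[leqRHS](card_ord N) max_card.
rewrite (partition_big (fun A : {set 'I_N} => Ordinal (ltA A)) predT) //=.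
apply: eq_bigr => k _.
rewrite (eq_bigr (fun _ => f (grid N k))); last by move=> A /eqP <-.
rewrite sumr_const [RHS]mulr_natl; congr (_ *+ _).
have <- : 'C(#|'I_N|, k) = 'C(N, k) by rewrite card_ord.
rewrite -card_draws; apply: eq_card => A.
by rewrite !inE.
Qed.

Lemma magnetization_bounds N (s : config N) : -1 <= (magnetization s : R) <= 1.
Proof.
case: N s => [|N] s; first by rewrite /magnetization big_ord0 mul0r; lra.
rewrite -ler_norml /magnetization normrM normfV [X in _ / X]ger0_norm//.
rewrite ler_pdivrMr ?ltr0n// mul1r.
apply: le_trans (ler_norm_sum _ _ _) _.
have -> : N.+1%:R = \sum_(i < N.+1) (1 : R) by rewrite sumr_const card_ord.
by apply: ler_sum => i _; rewrite /spin; case: (s i); rewrite ?normrN normr1.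
Qed.

Lemma magnetization_const N a : (0 < N)%N ->
  magnetization ([ffun=> a] : config N) = spin a :> R.
Proof.
move=> N0; rewrite /magnetization (eq_bigr (fun=> spin a)) => [|i _]; last by rewrite ffunE.
by rewrite sumr_const card_ord -[X in X / _]mulr_natr mulfK// pnatr_eq0 -lt0n.
Qed.

Lemma mean_magnetizationE p b h N :
  mean_magnetization p b h N =
  tilted_mean (fun s : config N => expR (N%:R * (b * magnetization s ^+ p)))
    (fun s => magnetization s) (N%:R * h).
Proof.
have wE (s : config N) : gibbs_weight p b h s =
    expR (N%:R * (b * magnetization s ^+ p)) * expR (N%:R * h * magnetization s).
  by rewrite -expRD /gibbs_weight; congr expR; ring.
rewrite /mean_magnetization /tilted_mean mulr_suml.
apply: eq_bigr => s _; rewrite /gibbs /partition_fun mulVKf ?expf_neq0 ?pnatr_eq0//.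
rewrite mulrAC wE; congr (_ / _).
by apply: eq_bigr => s' _; rewrite wE.
Qed.

Lemma mean_magnetization_incr p b N h h' : (0 < N)%N -> h < h' ->
  mean_magnetization p b h N < mean_magnetization p b h' N.
Proof.
move=> N0 hh; rewrite !mean_magnetizationE.
apply: (@tilted_mean_incr _ _ _ _ _ [ffun=> false] [ffun=> true]).
- by move=> s; exact: expR_gt0.
- by rewrite !magnetization_const// /spin; lra.
- by rewrite ltr_pM2l ?ltr0n.
Qed.

Lemma mean_magnetization_bounds p b N h : (0 < N)%N ->
  -1 < mean_magnetization p b h N < 1.
Proof.
move=> N0; rewrite mean_magnetizationE; apply/andP; split.
- apply: (@tilted_mean_gt _ _ _ _ _ _ _ [ffun=> true]).
  + by move=> s; exact: expR_gt0.
  + by move=> s; have /andP[] := magnetization_bounds s.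
  + by rewrite magnetization_const//=; lra.
- apply: (@tilted_mean_lt _ _ _ _ _ _ _ [ffun=> false]).
  + by move=> s; exact: expR_gt0.
  + by move=> s; have /andP[] := magnetization_bounds s.
  + by rewrite magnetization_const//=; lra.
Qed.

Lemma mean_magnetization_surj p b N (x : R) : (0 < N)%N -> -1 < x < 1 ->
  exists r, mean_magnetization p b r N = x.
Proof.
move=> N0 /andP[x1 x2].
pose w (s : config N) := expR (N%:R * (b * magnetization s ^+ p)).
have w0 s : 0 < w s by exact: expR_gt0.
have [||r rE] := @tilted_mean_surj _ _ w (fun s => magnetization s) w0 x
    [ffun=> false] [ffun=> true].
- by rewrite magnetization_const.
- by rewrite magnetization_const.
exists (r / N%:R); rewrite mean_magnetizationE mulrC divfK// pnatr_eq0 -lt0n//.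
Qed.

Lemma mle_solves p b N (s : config N) : (0 < N)%N -> mle_equation p b s (mle p b s).
Proof.
move=> N0; apply: (@xgetPex _ 0%E [set e | mle_equation p b s e]) => /=.
have [s1|s1] := eqVneq (magnetization s) (1 : R); first by exists +oo%E.
have [sN1|sN1] := eqVneq (magnetization s) (-1 : R); first by exists -oo%E.
have [|r rE] := @mean_magnetization_surj p b N (magnetization s) N0.
  have /andP[? ?] := @magnetization_bounds N s.
  by rewrite !lt_neqAle eq_sym sN1 s1; apply/andP; split.
by exists r%:E.
Qed.

Lemma scaled_error_le p b h t N (s : config N) : (0 < N)%N ->
  (scaled_error p b h s <= t%:E)%E =
  (magnetization s <= mean_magnetization p b (h + t / Num.sqrt N%:R) N).
Proof.
move=> N0; have := mle_solves p b s N0; rewrite /scaled_error.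
have sN0 : 0 < Num.sqrt N%:R :> R by rewrite sqrtr_gt0 ltr0n.
have /andP[u1 u2] := mean_magnetization_bounds p b (h + t / Num.sqrt N%:R) N0.
case: (mle p b s) => [r| |] /= sE.
- have mono := le_mono (fun h h' => @mean_magnetization_incr p b N h h' N0).
  by rewrite -EFinB -EFinM lee_fin -sE mono -ler_pdivlMl// lerBlDl [_^-1 * t]mulrC.
(* At magnetization 1 the error is infinite and the right-hand side fails as well, since a mean
   stays below 1; the next case is its mirror image. *)
- by rewrite addye// gt0_muley ?lte_fin// leye_eq sE leNgt u2.
- by rewrite addNye gt0_muleNy ?lte_fin// leNye sE ltW.
Qed.

Lemma mle_cdf p b h t N : (0 < N)%N ->
  \sum_(s : config N | (scaled_error p b h s <= t%:E)%E) gibbs p b h s =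
  (\sum_(k < N.+1 | grid N k <= mean_magnetization p b (h + t / Num.sqrt N%:R) N)
     'C(N, k)%:R * expR (N%:R * (b * grid N k ^+ p + h * grid N k))) /
  (\sum_(k < N.+1)
     'C(N, k)%:R * expR (N%:R * (b * grid N k ^+ p + h * grid N k))).
Proof.
move=> N0; under eq_bigl do rewrite scaled_error_le//.
set u := mean_magnetization _ _ _ _.
pose f x := expR (N%:R * (b * x ^+ p + h * x)).
rewrite -(sum_config N f) big_mkcond /=.
pose g x := if x <= u then f x else 0.
transitivity ((\sum_(s : config N) g (magnetization s)) / \sum_(s : config N) f (magnetization s)).
  rewrite mulr_suml; apply: eq_bigr => s _.
  rewrite /g; case: ifPn => _; last by rewrite mul0r.
  by rewrite /gibbs /partition_fun mulVKf ?expf_neq0 ?pnatr_eq0.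
rewrite sum_config; congr (_ / _); rewrite [RHS]big_mkcond /=.
by apply: eq_bigr => k _; rewrite /g; case: ifP => //; rewrite mulr0.
Qed.

End FiniteModel.

(** * Riemann sums by dominated convergence *)

Section RiemannSums.
Context {R : realType}.
Variables (n : nat -> nat) (a w : nat -> R) (c : nat -> nat -> R).
Hypothesis w0 : forall N, 0 < w N.
Hypothesis c0 : forall N k, 0 <= c N k.

Local Notation mu := (@lebesgue_measure R).

Definition node N k : R := a N + k%:R * w N.
Definition node_cell N k : set R := [set` `[node N k, node N k.+1[ ].
Definition step_fun N (y : R) : R := \sum_(k < n N) c N k * \1_(node_cell N k) y.

Lemma nodeS N k : node N k.+1 = node N k + w N.
Proof. by rewrite /node -natr1 mulrDl mul1r addrA. Qed.

Lemma step_fun_ge0 N y : 0 <= step_fun N y.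
Proof. by apply: sumr_ge0 => k _; rewrite mulr_ge0. Qed.

Lemma measurable_step_fun N : measurable_fun setT (step_fun N).
Proof.
apply: measurable_sum => k; apply: measurable_funM => //.
by apply: measurable_indic; exact: measurable_itv.
Qed.

Lemma integral_step_fun N :
  (\int[mu]_y (step_fun N y)%:E = (w N * \sum_(k < n N) c N k)%:E)%E.
Proof.
under eq_integral do rewrite -sumEFin.
rewrite ge0_integral_sum//=; first last.
- by move=> k y _; rewrite lee_fin mulr_ge0.
- move=> k; apply/measurable_EFinP; apply: measurable_funM => //.
  by apply: measurable_indic; exact: measurable_itv.
rewrite mulr_sumr -sumEFin; apply: eq_bigr => k _.
under eq_integral do rewrite EFinM.
rewrite ge0_integralZl//=; first last.
- by rewrite lee_fin.
- by apply/measurable_EFinP; apply: measurable_indic; exact: measurable_itv.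
rewrite integral_indic//=; last exact: measurable_itv.
rewrite setIT lebesgue_measure_itv /= lte_fin nodeS ltrDl w0.
by rewrite -EFinB -EFinM addrAC subrr add0r mulrC.
Qed.

Lemma step_funE N k y : (k < n N)%N -> node N k <= y < node N k.+1 ->
  step_fun N y = c N k.
Proof.
move=> kn /andP[y1 y2]; rewrite /step_fun (bigD1 (Ordinal kn))//= big1 ?addr0.
  rewrite indicE mem_set ?mulr1//; rewrite /node_cell /= in_itv /= y1//.
move=> i ik; rewrite indicE memNset ?mulr0// /node_cell /= in_itv /= => /andP[i1 i2].
have lt2 j j' : node N j <= y -> y < node N j'.+1 -> (j <= j')%N.
  move=> h1 h2; have := le_lt_trans h1 h2.
  by rewrite /node ltrD2l ltr_pM2r// ltr_nat ltnS.
move/eqP: ik; apply; apply: val_inj => /=; apply/eqP.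
by rewrite eqn_leq !lt2.
Qed.

Lemma step_fun_support N y : step_fun N y = 0 \/
  exists k, [/\ (k < n N)%N, node N k <= y < node N k.+1 & step_fun N y = c N k].
Proof.
have [[k [kn ky]]|none] := pselect (exists k, (k < n N)%N /\ node N k <= y < node N k.+1).
  by right; exists k; split => //; exact: step_funE.
left; rewrite /step_fun big1// => k _; rewrite indicE memNset ?mulr0//.
by rewrite /node_cell /= in_itv /= => ky; apply: none; exists k.
Qed.

Hypothesis w_cvg : w N @[N --> \oo] --> 0.
Hypothesis a_cvg : a N @[N --> \oo] --> -oo.
Hypothesis b_cvg : node N (n N) @[N --> \oo] --> +oo.

(** Only the cell containing y matters, and [k N] is its index. It exists eventually because the
    nodes exhaust the line, and its left node tends to y because the width vanishes. *)
Lemma step_fun_cvg (y l : R) :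
  (forall k : nat -> nat, (\forall N \near \oo, (k N < n N)%N) ->
     node N (k N) @[N --> \oo] --> y -> c N (k N) @[N --> \oo] --> l) ->
  step_fun N y @[N --> \oo] --> l.
Proof.
move=> H; pose k N := Num.truncn ((y - a N) / w N).
have kP : \forall N \near \oo, (k N < n N)%N /\ node N (k N) <= y < node N (k N).+1.
  near=> N.
  have aN : a N <= y by near: N; move/cvgrNyPle : a_cvg; exact.
  have bN : y < node N (n N) by near: N; move/cvgryPgt : b_cvg; exact.
  have q0 : 0 <= (y - a N) / w N by rewrite divr_ge0 ?subr_ge0// ltW.
  split; first by rewrite /k truncn_lt_nat// ltr_pdivrMr// ltrBlDl.
  have /andP[k1 k2] := truncn_itv q0; rewrite -/(k N) in k1 k2.
  move: k1 k2; rewrite ler_pdivlMr// ltr_pdivrMr// => k1 k2.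
  by rewrite /node -lerBrDl k1 /= -ltrBlDl.
have kn : \forall N \near \oo, (k N < n N)%N by apply: filterS kP => N [].
have ky : node N (k N) @[N --> \oo] --> y.
  apply: (@squeeze_cvgr _ _ _ _ (fun N => y - w N) (cst y)).
  - apply: filterS kP => N [_ /andP[k1]]; rewrite nodeS => k2.
    by rewrite k1 andbT lerBlDr ltW.
  - by rewrite -[X in _ --> X]subr0; apply: cvgB => //; exact: cvg_cst.
  - exact: cvg_cst.
apply: cvg_trans (H k kn ky); apply: near_eq_cvg.
by apply: filterS kP => N [k1 k2]; rewrite (step_funE k1 k2).
Unshelve. all: by end_near. Qed.

(** The left-hand side is the integral of the step function. The majorant G has to dominate on whole
    cells, not only at nodes; the exempt point t0 leaves room for a jump of the limit. *)
Lemma riemann_sum_dominated (g G : R -> R) (t0 : R) :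
  measurable_fun setT g -> mu.-integrable setT (EFin \o G) ->
  (forall N k y, (k < n N)%N -> node N k <= y < node N k.+1 -> c N k <= G y) ->
  (forall y, 0 <= G y) ->
  (forall y (k : nat -> nat), y != t0 -> (\forall N \near \oo, (k N < n N)%N) ->
     node N (k N) @[N --> \oo] --> y -> c N (k N) @[N --> \oo] --> g y) ->
  w N * (\sum_(k < n N) c N k) @[N --> \oo] --> fine (\int[mu]_y (g y)%:E)%E.
Proof.
move=> mg iG cG G0 cg.
have [||||[ig _ +]] := @dominated_convergence _ _ R mu setT measurableT
    (fun N y => (step_fun N y)%:E) (EFin \o g) (EFin \o G) _ _ _ iG.
- by move=> N; apply/measurable_EFinP; exact: measurable_step_fun.
- exact/measurable_EFinP.
- exists [set t0]; split => //; first exact: lebesgue_measure_set1.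
  move=> y /= /not_implyP[_ ny]; apply: contrapT => yt0; apply: ny.
  apply: cvg_EFin; first exact: nearW.
  by apply: step_fun_cvg => k; apply: cg; exact/eqP.
- apply: aeW => /= y N _; rewrite lee_fin ger0_norm ?step_fun_ge0//.
  by have [->//|[k [kn ky ->]]] := step_fun_support N y; exact: cG kn ky.
have gfin : (\int[mu]_y (g y)%:E)%E \is a fin_num by exact: integrable_fin_num ig.
have -> : (\int[mu]_x (EFin \o g) x = (fine (\int[mu]_y (g y)%:E))%:E)%E by rewrite fineK.
move=> /fine_cvgP[_]; apply: cvg_trans; apply: near_eq_cvg; apply: nearW => N /=.
by rewrite integral_step_fun.
Qed.

End RiemannSums.

(** * Laplace's method on the magnetization lattice *)

Section StirlingFactor.
Context {R : realType}.
Implicit Types (N k : nat) (x y : R).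

(** What remains of the binomial weight, normalized by 2^N / sqrt N, once the exponential e^(-N
    entropy) is taken out. *)
Definition stirling_factor N k : R :=
  Num.sqrt N%:R * 'C(N, k)%:R / 2 ^+ N * expR (N%:R * entropy (grid N k)).

Lemma grid1D N k : (0 < N)%N -> 1 + grid N k = 2 * k%:R / N%:R :> R.
Proof.
move=> N0; rewrite /grid; field.
by rewrite pnatr_eq0 -lt0n.
Qed.

Lemma grid1B N k : (0 < N)%N -> (k <= N)%N -> 1 - grid N k = 2 * (N - k)%:R / N%:R :> R.
Proof.
move=> N0 kN; rewrite /grid natrB//; field.
by rewrite pnatr_eq0 -lt0n.
Qed.

Lemma grid_bounds N k : (0 < N)%N -> (k <= N)%N -> -1 <= (grid N k : R) <= 1.
Proof.
move=> N0 kN; have h1 : 0 <= 1 + grid N k :> R by rewrite grid1D// divr_ge0// mulr_ge0.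
have h2 : 0 <= 1 - grid N k :> R by rewrite grid1B// divr_ge0// mulr_ge0.
lra.
Qed.

Lemma expR_mul_ln k y : 0 < y \/ k = 0%N -> expR (k%:R * ln y) = y ^+ k.
Proof. by case=> [y0|->]; [rewrite expRM_natl lnK|rewrite mul0r expR0]. Qed.

Lemma expR_entropy_grid N k : (0 < N)%N -> (k <= N)%N ->
  expR (N%:R * entropy (grid N k)) = (1 + grid N k) ^+ k * (1 - grid N k) ^+ (N - k) :> R.
Proof.
move=> N0 kN; have N0R : 0 < N%:R :> R by rewrite ltr0n.
rewrite -!expR_mul_ln; last first.
- have [->|k0] := posnP k; [by right|left].
  by rewrite grid1D// divr_gt0// mulr_gt0// ltr0n.
- have [->|k0] := posnP (N - k); [by right|left].
  by rewrite grid1B// divr_gt0// mulr_gt0// ltr0n.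
rewrite -expRD; congr expR.
have -> : k%:R = N%:R * (2^-1 * (1 + grid N k)) :> R.
  by rewrite grid1D//; field; rewrite gt_eqF.
have -> : (N - k)%:R = N%:R * (2^-1 * (1 - grid N k)) :> R.
  by rewrite grid1B//; field; rewrite gt_eqF.
by rewrite /entropy; ring.
Qed.

Lemma stirling_factor_ge0 N k : 0 <= stirling_factor N k.
Proof. by rewrite mulr_ge0 ?expR_ge0// divr_ge0 ?exprn_ge0// mulr_ge0. Qed.

(** The binomial weight times e^(N entropy) is one term of the expansion of ((1 - g) + (1 + g))^N =
    2^N. The bound reaches the endpoints, where Stirling's formula gives nothing. *)
Lemma stirling_factor_le_sqrt N k : (0 < N)%N -> (k <= N)%N ->
  stirling_factor N k <= Num.sqrt N%:R.
Proof.
move=> N0 kN; rewrite /stirling_factor -!mulrA ler_piMr ?sqrtr_ge0//.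
rewrite expR_entropy_grid// mulrCA ler_pdivrMl ?exprn_gt0// mulr1.
have /andP[g1 g2] := grid_bounds N0 kN.
pose u : R := 1 + grid N k; pose v : R := 1 - grid N k.
have u0 : 0 <= u by rewrite /u; lra.
have v0 : 0 <= v by rewrite /v; lra.
have -> : 2 = v + u by rewrite /u /v; ring.
rewrite [leRHS]exprDn (bigD1 (Ordinal (kN : (k < N.+1)%N)))//= -[leLHS]addr0 lerD//.
  by rewrite -/u -/v mulr_natl [u ^+ k * _]mulrC.
apply: sumr_ge0 => i _; rewrite mulrn_wge0// mulr_ge0// exprn_ge0//.
Qed.

Lemma expR_half_ln x : 0 < x -> expR (2^-1 * ln x) = Num.sqrt x.
Proof. by move=> x0; rewrite -powR12_sqrt ?ltW// /powR gt_eqF. Qed.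

Lemma fact_stirling N : N`!%:R =
  expR (stirling_defect N + (N%:R + 2^-1) * ln N%:R - N%:R) :> R.
Proof.
rewrite /stirling_defect -[LHS]lnK ?posrE ?ltr0n ?fact_gt0//; congr expR.
ring.
Qed.

(** An exact identity: all approximation is confined to the defects. The last factor is N / sqrt (k
    (N - k)), because k / N = (1 + g) / 2. *)
Lemma stirling_factorE N k : (0 < k)%N -> (k < N)%N ->
  stirling_factor N k =
  expR (stirling_defect N - stirling_defect k - stirling_defect (N - k)) *
  (2 * (1 - grid N k ^+ 2) `^ (- 2^-1)).
Proof.
move=> k0 kN; have kN' := ltnW kN; have N0 : (0 < N)%N := leq_trans k0 kN'.
have l0 : (0 < N - k)%N by rewrite subn_gt0.
have NR : 0 < N%:R :> R by rewrite ltr0n.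
have kR : 0 < k%:R :> R by rewrite ltr0n.
have lR : 0 < (N - k)%:R :> R by rewrite ltr0n.
have ln1g : ln (1 + grid N k) = ln 2 + ln k%:R - ln N%:R :> R.
  by rewrite grid1D// ln_div ?posrE ?mulr_gt0// lnM ?posrE.
have ln1g' : ln (1 - grid N k) = ln 2 + ln (N - k)%:R - ln N%:R :> R.
  by rewrite grid1B// ln_div ?posrE ?mulr_gt0// lnM ?posrE.
have g1 : 0 < 1 + grid N k :> R by rewrite grid1D// divr_gt0// mulr_gt0.
have g2 : 0 < 1 - grid N k :> R by rewrite grid1B// divr_gt0// mulr_gt0.
have binE : 'C(N, k)%:R = N`!%:R / (k`!%:R * (N - k)`!%:R) :> R.
  apply: (@mulIf _ (k`!%:R * (N - k)`!%:R)).
    by rewrite mulf_neq0// pnatr_eq0 -lt0n fact_gt0.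
  rewrite divfK; last by rewrite mulf_neq0// pnatr_eq0 -lt0n fact_gt0.
  by rewrite -!natrM bin_fact.
rewrite /stirling_factor expR_entropy_grid// binE !fact_stirling.
rewrite -(expR_mul_ln (or_introl g1)) -(expR_mul_ln (or_introl g2)) ln1g ln1g'.
rewrite -(expR_mul_ln (or_introl (ltr0n R 2))) -expR_half_ln//.
have -> : 1 - grid N k ^+ 2 = (1 + grid N k) * (1 - grid N k) :> R by ring.
rewrite /powR gt_eqF ?mulr_gt0// lnM ?posrE// ln1g ln1g'.
rewrite -[X in _ * (X * _)](@lnK _ 2) ?posrE// -!expRN -!expRD -!expRN -!expRD.
by congr expR; rewrite natrB//; field.
Qed.

Lemma stirling_factor_bound N k x : (0 < N)%N -> (k <= N)%N -> 0 < x ->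
  x <= 1 - grid N k ^+ 2 -> stirling_factor N k <= 2 * x `^ (- 2^-1).
Proof.
move=> N0 kN x0 xg; have /andP[g1 g2] := @grid_bounds N k N0 kN.
have k0 : (0 < k)%N.
  rewrite lt0n; apply/eqP => kE; have := @grid1D N k N0.
  rewrite kE mulr0 mul0r => gE; have gN : grid N 0 = -1 :> R by lra.
  by move: xg; rewrite kE gN expr2; lra.
have {}kN : (k < N)%N.
  rewrite ltn_neqAle kN andbT; apply/eqP => kE; have := @grid1B N k N0 kN.
  rewrite kE subnn mulr0 mul0r => gE; have gN : grid N N = 1 :> R by lra.
  by move: xg; rewrite kE gN expr2; lra.
rewrite stirling_factorE// -[leRHS]mul1r ler_pM ?expR_ge0 ?mulr_ge0 ?powR_ge0//.
  rewrite expR_le1.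
  have /andP[? ?] := stirling_defect_bounds N0 (R := R).
  have /andP[? ?] := stirling_defect_bounds k0 (R := R).
  have l0 : (0 < N - k)%N by rewrite subn_gt0.
  have /andP[? ?] := stirling_defect_bounds l0 (R := R).
  lra.
rewrite ler_pM2l// /powR !gt_eqF//; last exact: lt_le_trans xg.
rewrite ler_expR ler_nM2l ?oppr_lt0// ler_ln ?posrE//; exact: lt_le_trans xg.
Qed.

Lemma cvg_powR_pos (c l : R) (f : nat -> R) : 0 < l ->
  f N @[N --> \oo] --> l -> f N `^ c @[N --> \oo] --> l `^ c.
Proof.
move=> l0 fl; have fpos : \forall N \near \oo, 0 < f N by exact: cvgr_gt fl _ l0.
rewrite [X in _ --> X]/powR gt_eqF//.
have : expR (c * ln (f N)) @[N --> \oo] --> expR (c * ln l).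
  apply: (cvg_comp _ expR); last exact: continuous_expR.
  apply: cvgM; first exact: cvg_cst.
  by apply: (cvg_comp _ (@ln R) fl); exact: continuous_ln.
apply: cvg_trans; apply: near_eq_cvg; apply: filterS fpos => N f0.
by rewrite /powR gt_eqF.
Qed.

(** Both counts must diverge for their defects to reach the limit D. *)
Lemma grid_interior_infty (m : R) (k : nat -> nat) : -1 < m < 1 ->
  (\forall N \near \oo, (k N <= N.+1)%N) ->
  grid N.+1 (k N) @[N --> \oo] --> m ->
  k N @[N --> \oo] --> \oo /\ (N.+1 - k N)%N @[N --> \oo] --> \oo.
Proof.
move=> /andP[m1 m2] kN gm.
have ge_M (c : R) (M : nat) : 0 < c -> \forall N \near \oo, M%:R <= c * N.+1%:R.
  move=> c0; near=> N; rewrite -ler_pdivrMl//.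
  apply: (@le_trans _ _ N%:R); last by rewrite ler_nat.
  by near: N; exact: nbhs_infty_ger.
split; apply/cvgnyPge => M; near=> N.
- have N0 : (0 < N.+1)%N by [].
  have h1 : (m - 1) / 2 <= grid N.+1 (k N).
    by near: N; apply: cvgr_ge gm _ _; lra.
  have h2 : M%:R <= (m + 1) / 4 * N.+1%:R by near: N; apply: ge_M; lra.
  have : (m + 1) / 4 * N.+1%:R <= (k N)%:R.
    rewrite -ler_pdivlMr ?ltr0n//; have := @grid1D N.+1 (k N) N0; rewrite -mulrA.
    by move: (_ / N.+1%:R) => q; lra.
  by move=> /(le_trans h2); rewrite ler_nat.
- have N0 : (0 < N.+1)%N by [].
  have kN' : (k N <= N.+1)%N by near: N.
  have h1 : grid N.+1 (k N) <= (m + 1) / 2.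
    by near: N; apply: cvgr_le gm _ _; lra.
  have h2 : M%:R <= (1 - m) / 4 * N.+1%:R by near: N; apply: ge_M; lra.
  have : (1 - m) / 4 * N.+1%:R <= (N.+1 - k N)%:R.
    rewrite -ler_pdivlMr ?ltr0n//; have := @grid1B N.+1 (k N) N0 kN'; rewrite -mulrA.
    by move: (_ / N.+1%:R) => q; lra.
  by move=> /(le_trans h2); rewrite ler_nat.
Unshelve. all: by end_near. Qed.

Lemma stirling_factor_cvg (D m : R) (k : nat -> nat) :
  stirling_defect N @[N --> \oo] --> D -> -1 < m < 1 ->
  (\forall N \near \oo, (k N <= N.+1)%N) ->
  grid N.+1 (k N) @[N --> \oo] --> m ->
  stirling_factor N.+1 (k N) @[N --> \oo] -->
    expR (- D) * (2 * (1 - m ^+ 2) `^ (- 2^-1)).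
Proof.
move=> dD m1 kN gm; have [k_oo l_oo] := grid_interior_infty m1 kN gm.
have lim : expR (stirling_defect N.+1 - stirling_defect (k N) - stirling_defect (N.+1 - k N)) *
    (2 * (1 - grid N.+1 (k N) ^+ 2) `^ (- 2^-1)) @[N --> \oo] -->
    expR (- D) * (2 * (1 - m ^+ 2) `^ (- 2^-1)).
  apply: cvgM.
    apply: (cvg_comp _ expR); last exact: continuous_expR.
    have <- : D - D - D = - D by ring.
    apply: cvgB; last exact: cvg_comp l_oo dD.
    by apply: cvgB; [rewrite (cvg_shiftS stirling_defect)|exact: cvg_comp k_oo dD].
  apply: cvgM; first exact: cvg_cst.
  apply: cvg_powR_pos; first by case/andP: m1 => ? ?; nra.
  apply: cvgB; first exact: cvg_cst.
  by rewrite expr2; apply: cvgM.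
apply: cvg_trans lim; apply: near_eq_cvg; near=> N; rewrite stirling_factorE//.
- by near: N; move/cvgnyPge : k_oo => /(_ 1%N).
- by rewrite -subn_gt0; near: N; move/cvgnyPge : l_oo => /(_ 1%N).
Unshelve. all: by end_near. Qed.

End StirlingFactor.

Section LaplaceTerm.
Context {R : realType}.
Implicit Types (p N k : nat) (b h m M : R).

Lemma sqrtS_cvgy : (Num.sqrt N.+1%:R : R) @[N --> \oo] --> +oo.
Proof.
apply/cvgryPge => A; near=> N.
apply: (@le_trans _ _ `|A|); first exact: ler_norm.
rewrite -[leLHS]sqrtr_sqr ler_wsqrtr//.
apply: (@le_trans _ _ N%:R); last by rewrite ler_nat.
by near: N; exact: nbhs_infty_ger.
Unshelve. all: by end_near. Qed.

(** With M the maximum of H, subtracting it keeps the terms near a maximizer bounded. *)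
Definition laplace_term p b h M N k : R :=
  stirling_factor N k * expR (N%:R * (Hfun p b h (grid N k) - M)).

Lemma laplace_term_ge0 p b h M N k : 0 <= laplace_term p b h M N k.
Proof. by rewrite mulr_ge0 ?expR_ge0 ?stirling_factor_ge0. Qed.

Lemma binomial_weightE p b h M N k : (0 < N)%N ->
  'C(N, k)%:R * expR (N%:R * (b * grid N k ^+ p + h * grid N k)) =
  (2 ^+ N / Num.sqrt N%:R * expR (N%:R * M)) * laplace_term p b h M N k.
Proof.
move=> N0; rewrite /laplace_term /stirling_factor.
have sN : Num.sqrt N%:R != 0 :> R by rewrite gt_eqF// sqrtr_gt0 ltr0n.
have tN : 2 ^+ N != 0 :> R by rewrite expf_neq0// pnatr_eq0.
have -> : N%:R * (b * grid N k ^+ p + h * grid N k) =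
    N%:R * M + N%:R * entropy (grid N k) + N%:R * (Hfun p b h (grid N k) - M).
  by rewrite /Hfun; ring.
by rewrite 2!expRD; field; rewrite tN.
Qed.

(** Passes from the node z to any y in its cell, of width at most 2v, and absorbs the linear tilt.
    The constants come from (y - 2z)^2 >= 0 and (z - 4 tau)^2 >= 0. *)
Lemma gauss_tail_bound (v tau z y : R) : 0 < v -> `|y - z| <= 2 * v ->
  - (z ^+ 2 / (4 * v)) + tau * z / v <=
  - (y ^+ 2 / (16 * v)) + (v / 2 + 2 * tau ^+ 2 / v).
Proof.
move=> v0 yz.
have v160 : 0 < 16 * v by lra.
rewrite -(ler_pM2l v160).
have -> : 16 * v * (- (z ^+ 2 / (4 * v)) + tau * z / v) = - 4 * z ^+ 2 + 16 * tau * z.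
  by field; rewrite gt_eqF.
have -> : 16 * v * (- (y ^+ 2 / (16 * v)) + (v / 2 + 2 * tau ^+ 2 / v)) =
    - y ^+ 2 + 8 * v ^+ 2 + 32 * tau ^+ 2.
  by field; rewrite gt_eqF.
have sq1 : (y - z) ^+ 2 <= 4 * v ^+ 2.
  have -> : 4 * v ^+ 2 = (2 * v) ^+ 2 by ring.
  by rewrite -real_normK ?num_real// ler_sqr ?nnegrE//; lra.
have sq2 : 0 <= (y - 2 * z) ^+ 2 by exact: sqr_ge0.
have sq3 : 0 <= 2 * (z - 4 * tau) ^+ 2 by rewrite mulr_ge0 ?sqr_ge0.
have e1 : (y - 2 * z) ^+ 2 = 2 * (y - z) ^+ 2 + 2 * z ^+ 2 - y ^+ 2 by ring.
have e3 : 2 * (z - 4 * tau) ^+ 2 = 2 * z ^+ 2 - 16 * tau * z + 32 * tau ^+ 2 by ring.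
lra.
Qed.

Lemma normal_pdf_scaledE (s m y : R) : s != 0 ->
  normal_pdf m s y = normal_peak s * expR (- ((y - m) ^+ 2 / (2 * s ^+ 2))).
Proof.
move=> s0; rewrite normal_pdfE//; congr (_ * _); rewrite /normal_fun.
by congr expR; rewrite mulr2n mulNr; congr (- (_ / _)); ring.
Qed.

(** At infinite x both sides are 0. *)
Lemma fine_scale (r : R) (x : \bar R) : fine (r%:E * x)%E = r * fine x.
Proof.
case: x => [x| |]; rewrite ?mulr0 //=.
  by rewrite mulr_infty /=; case: sgrP => _; rewrite ?mul0e ?mul1e ?mulN1e.
by rewrite mulr_infty /=; case: sgrP => _; rewrite ?mul0e ?mul1e ?mulN1e.
Qed.

End LaplaceTerm.

(** * Laplace asymptotics near one maximizer *)

Section LocalLaplace.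
Context {R : realType}.
Variables (p : nat) (b h m D : R).
Hypothesis stirling_D : stirling_defect N @[N --> \oo] --> D.
Hypothesis m_max : global_maximizers p b h m.
Hypothesis m_nondeg : Hfun_deriv2 p b m < 0.

Let v := - Hfun_deriv2 p b m.
Let v0 : 0 < v. Proof. by rewrite oppr_gt0. Qed.
Let M := Hfun p b h m.

(** The factor v gives the limit variance v instead of 1/v, and turns the tilt e^(tau sqrt N (x -
    m)) into e^(tau z / v), a shift of the normal mean to tau. *)
Definition mode_scale N k : R := v * (Num.sqrt N%:R * (grid N k - m)).

Lemma laplace_exponent_cvg (k : nat -> nat) (y : R) :
  mode_scale N.+1 (k N) @[N --> \oo] --> y ->
  grid N.+1 (k N) @[N --> \oo] --> m /\
  N.+1%:R * (Hfun p b h (grid N.+1 (k N)) - M) @[N --> \oo] --> - (y ^+ 2 / (2 * v)).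
Proof.
move=> zy.
have isq : (Num.sqrt N.+1%:R)^-1 @[N --> \oo] --> (0 : R).
  by apply/gtr0_cvgV0; [apply: nearW => N; rewrite sqrtr_gt0|exact: sqrtS_cvgy].
have sN0 N : Num.sqrt N.+1%:R != 0 :> R by rewrite gt_eqF// sqrtr_gt0.
have gE N : grid N.+1 (k N) = m + v^-1 * (mode_scale N.+1 (k N) * (Num.sqrt N.+1%:R)^-1).
  by rewrite /mode_scale; field; rewrite sN0 gt_eqF.
have gm : grid N.+1 (k N) @[N --> \oo] --> m.
  rewrite (funext gE).
  have : m + v^-1 * (mode_scale N.+1 (k N) * (Num.sqrt N.+1%:R)^-1) @[N --> \oo] -->
      m + v^-1 * (y * 0).
    apply: cvgD; first exact: cvg_cst.
    by apply: cvgM; [exact: cvg_cst|exact: cvgM].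
  by rewrite !mulr0 addr0.
split=> //.
have sq_cvg : - (mode_scale N.+1 (k N) ^+ 2 / (2 * v)) @[N --> \oo] --> - (y ^+ 2 / (2 * v)).
  apply: cvgN; apply: cvgM; last exact: cvg_cst.
  by rewrite !expr2; apply: cvgM.
apply/cvgrPdist_le => /= e e0.
(* A bound for N (x - m)^2 = (z / v)^2 once |z| <= |y| + 1; Taylor precision e / 2 / B then costs e
   / 2. *)
pose B := (`|y| + 1) ^+ 2 / v ^+ 2.
have B0 : 0 < B by rewrite divr_gt0// exprn_gt0// ltr_wpDl.
have e2 : 0 < e / 2 by rewrite divr_gt0.
have e20 : 0 < e / 2 / B by rewrite divr_gt0// divr_gt0.
have [d d0 hd] := Hfun_Taylor (maximizer_interior m_max) (maximizer_crit m_max) e20.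
move/cvgrPdist_le : (sq_cvg) => /(_ (e / 2)) sq_near.
near=> N.
have gd : `|grid N.+1 (k N) - m| < d.
  rewrite distrC; near: N; move/cvgrPdist_lt : gm; exact.
have zb : `|mode_scale N.+1 (k N)| <= `|y| + 1.
  near: N; have : `|mode_scale N.+1 (k N)| @[N --> \oo] --> `|y| by exact: cvg_norm.
  by move/cvgr_le; apply; rewrite ltrDl.
have {}sqN : `|- (y ^+ 2 / (2 * v)) + mode_scale N.+1 (k N) ^+ 2 / (2 * v)| <= e / 2.
  by rewrite -[X in - _ + X]opprK; near: N; exact: (sq_near e2).
have sqNE : Num.sqrt N.+1%:R ^+ 2 = N.+1%:R :> R by rewrite sqr_sqrtr.
have zE : mode_scale N.+1 (k N) ^+ 2 / v ^+ 2 = N.+1%:R * (grid N.+1 (k N) - m) ^+ 2.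
  by rewrite /mode_scale !exprMn sqNE; field; rewrite gt_eqF.
have hN : `|N.+1%:R * (Hfun p b h (grid N.+1 (k N)) - M) + mode_scale N.+1 (k N) ^+ 2 / (2 * v)| <= e / 2.
  have -> : mode_scale N.+1 (k N) ^+ 2 / (2 * v) =
      - (N.+1%:R * (Hfun_deriv2 p b m / 2 * (grid N.+1 (k N) - m) ^+ 2)).
    have -> : Hfun_deriv2 p b m = - v by rewrite opprK.
    have -> : N.+1%:R * (- v / 2 * (grid N.+1 (k N) - m) ^+ 2) =
      - v / 2 * (N.+1%:R * (grid N.+1 (k N) - m) ^+ 2) by ring.
    by rewrite -zE; field; rewrite gt_eqF.
  rewrite -mulrBr normrM ger0_norm//.
  apply: (@le_trans _ _ (N.+1%:R * (e / 2 / B * (grid N.+1 (k N) - m) ^+ 2))).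
    by rewrite ler_pM2l//; exact: hd.
  rewrite mulrCA -zE.
  apply: (@le_trans _ _ (e / 2 / B * B)); last by rewrite divfK// gt_eqF.
  rewrite ler_pM2l// ler_pM2r ?invr_gt0 ?exprn_gt0//.
  by rewrite -real_normK ?num_real// ler_sqr ?nnegrE.
set H' := N.+1%:R * _ in hN *; set Z := mode_scale N.+1 (k N) ^+ 2 / (2 * v) in hN sqN.
have -> : - (y ^+ 2 / (2 * v)) - H' = (- (y ^+ 2 / (2 * v)) + Z) - (H' + Z) by ring.
apply: le_trans (ler_normB _ _) _; lra.
Unshelve. all: by end_near. Qed.

(** Stated for every smaller d so that finitely many maximizers can share a radius. The bound on 1 -
    x^2 controls the Stirling factor, the other one the exponential. *)
Lemma local_radius : exists2 d0 : R, 0 < d0 & forall d, 0 < d -> d <= d0 ->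
  exists2 x0, 0 < x0 & forall x, `|x - m| < d -> x0 <= 1 - x ^+ 2 /\
    Hfun p b h x - M <= - (v / 4) * (x - m) ^+ 2.
Proof.
have /andP[m1 m2] := maximizer_interior m_max.
have [d1 d10 hd1] := Hfun_local_quadratic m_max m_nondeg.
pose d2 := Num.min ((1 + m) / 2) ((1 - m) / 2).
have d20 : 0 < d2 by rewrite lt_min; lra.
have [d2a d2b] : d2 <= (1 + m) / 2 /\ d2 <= (1 - m) / 2.
  by split; rewrite ge_min lexx ?orbT.
exists (Num.min d1 d2); first by rewrite lt_min d10.
move=> d dpos; rewrite le_min => /andP[dd1 dd2].
exists (d2 * d2); first exact: mulr_gt0.
move=> x xd; have xd1 := lt_le_trans xd dd1; split; last first.
  by have := hd1 x xd1; rewrite /v /M; lra.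
have := lt_le_trans xd dd2; rewrite ltr_norml => /andP[x1 x2].
have -> : 1 - x ^+ 2 = (1 - x) * (1 + x) by ring.
by apply: ler_pM; lra.
Qed.

(** Convergence of the test functions is required along convergent sequences away from t0, which
    admits indicators whose cut moves with N. *)
Lemma local_laplace_integral (tau t0 d : R) (phi_ : nat -> R -> R) (phi : R -> R) :
  measurable_fun setT phi ->
  (forall N z, 0 <= phi_ N z <= 1) ->
  (forall z (z_ : nat -> R), z != t0 -> z_ N @[N --> \oo] --> z ->
     phi_ N.+1 (z_ N) @[N --> \oo] --> phi z) ->
  0 < d ->
  (exists2 x0, 0 < x0 & forall x, `|x - m| < d -> x0 <= 1 - x ^+ 2 /\
    Hfun p b h x - M <= - (v / 4) * (x - m) ^+ 2) ->
  2 * v / Num.sqrt N.+1%:R * (\sum_(k < N.+2) if `|grid N.+1 k - m| < d then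
     laplace_term p b h M N.+1 k * expR (tau * (Num.sqrt N.+1%:R * (grid N.+1 k - m)))
       * phi_ N.+1 (mode_scale N.+1 k) else 0) @[N --> \oo] -->
  fine (\int[lebesgue_measure]_z
     (expR (- D) * (2 * (1 - m ^+ 2) `^ (- 2^-1)) *
        expR (- (z ^+ 2 / (2 * v)) + tau * z / v) * phi z)%:E)%E.
Proof.
move=> mphi phi01 phi_cvg d0 [x0 x00 hx0].
have sN0 N : 0 < Num.sqrt N.+1%:R :> R by rewrite sqrtr_gt0.
have sN1 N : 1 <= Num.sqrt N.+1%:R :> R.
  by rewrite -[leLHS]sqrtr1 ler_wsqrtr// ler1n.
(* The scaled images of the magnetization -1 and of the lattice spacing 2 / N.+1, so that nodes are
   scaled lattice points. *)
pose a N : R := v * (Num.sqrt N.+1%:R * (-1 - m)).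
pose w N : R := 2 * v / Num.sqrt N.+1%:R.
have w0 N : 0 < w N by rewrite /w divr_gt0// mulr_gt0.
pose c N k : R := if `|grid N.+1 k - m| < d then
     laplace_term p b h M N.+1 k * expR (tau * (Num.sqrt N.+1%:R * (grid N.+1 k - m)))
       * phi_ N.+1 (mode_scale N.+1 k) else 0.
have phi0 N z : 0 <= phi_ N z by have /andP[] := phi01 N z.
have c0 N k : 0 <= c N k.
  rewrite /c; case: ifP => // _.
  by rewrite mulr_ge0// mulr_ge0 ?expR_ge0// laplace_term_ge0.
have nodeE N k : node a w N k = mode_scale N.+1 k.
  have sqNE : Num.sqrt N.+1%:R ^+ 2 = N.+1%:R :> R by rewrite sqr_sqrtr.
  rewrite /node /a /w /mode_scale /grid.
  move: (sN0 N) sqNE; set s := Num.sqrt _ => s0 <-.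
  by field; rewrite gt_eqF.
have s8 : Num.sqrt (8 * v) != 0 by rewrite gt_eqF// sqrtr_gt0 mulr_gt0.
(* The majorant is a Gaussian of variance 8v, written as a multiple of a normal density to inherit
   its integrability; C0 collects the Stirling bound and the constant of [gauss_tail_bound]. *)
pose C0 := 2 * x0 `^ (- 2^-1) * expR (v / 2 + 2 * tau ^+ 2 / v).
pose G y : R := C0 / normal_peak (Num.sqrt (8 * v)) * normal_pdf 0 (Num.sqrt (8 * v)) y.
have pk := normal_peak_gt0 s8.
have GE y : G y = C0 * expR (- (y ^+ 2 / (16 * v))).
  have e16 : 2 * Num.sqrt (8 * v) ^+ 2 = 16 * v.
    by rewrite sqr_sqrtr; [ring|rewrite mulr_ge0// ltW].
  rewrite /G (normal_pdf_scaledE 0 y s8) subr0 e16 mulrA divfK//.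
  exact: lt0r_neq0.
have C00 : 0 <= C0 by rewrite mulr_ge0 ?expR_ge0// mulr_ge0// powR_ge0.
have expE N k : expR (tau * (Num.sqrt N.+1%:R * (grid N.+1 k - m))) =
    expR (tau * mode_scale N.+1 k / v).
  by congr expR; rewrite /mode_scale; field; rewrite gt_eqF.
pose g z : R := expR (- D) * (2 * (1 - m ^+ 2) `^ (- 2^-1)) *
        expR (- (z ^+ 2 / (2 * v)) + tau * z / v) * phi z.
have sqrt_oo : (Num.sqrt N.+1%:R : R) @[N --> \oo] --> +oo by exact: sqrtS_cvgy.
have /andP[m1 m2] := maximizer_interior m_max.
have w_cvg : w N @[N --> \oo] --> 0.
  have : 2 * v * (Num.sqrt N.+1%:R)^-1 @[N --> \oo] --> 2 * v * 0.
    apply: cvgM; first exact: cvg_cst.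
    by apply/gtr0_cvgV0 => //; apply: nearW => N.
  by rewrite mulr0.
have a_cvg : a N @[N --> \oo] --> -oo.
  apply/cvgrNyPle => A; near=> N.
  have vm : 0 < v * (1 + m) by apply: mulr_gt0 => //; lra.
  have -> : a N = - (v * (1 + m) * Num.sqrt N.+1%:R) by rewrite /a; ring.
  rewrite lerNl -ler_pdivrMl//.
  by near: N; move/cvgryPge : sqrt_oo; exact.
have b_cvg : node a w N N.+2 @[N --> \oo] --> +oo.
  apply/cvgryPge => A; near=> N.
  rewrite nodeS nodeE.
  have vm : 0 < v * (1 - m) by apply: mulr_gt0 => //; lra.
  have gN : grid N.+1 N.+1 = 1 :> R by rewrite /grid; field.
  rewrite /mode_scale gN.
  apply: (@le_trans _ _ (v * (1 - m) * Num.sqrt N.+1%:R)); last first.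
    by rewrite -mulrA [(1 - m) * _]mulrC lerDl ltW.
  rewrite -ler_pdivrMl//.
  by near: N; move/cvgryPge : sqrt_oo; exact.
have mg : measurable_fun setT g.
  apply: measurable_funM => //; apply: measurable_funM => //.
  apply: measurableT_comp => //; apply: measurable_funD => //.
    by apply: measurableT_comp => //; apply: measurable_funM.
  by do 2?apply: measurable_funM.
have iG : lebesgue_measure.-integrable setT (EFin \o G).
  have -> : EFin \o G = (fun y => (C0 / normal_peak (Num.sqrt (8 * v)))%:E *
      (normal_pdf 0 (Num.sqrt (8 * v)) y)%:E)%E by [].
  apply: integrableZl => //; exact: integrable_normal_pdf.
have G0 y : 0 <= G y by rewrite GE mulr_ge0 ?expR_ge0.
have cG N k y : (k < N.+2)%N -> node a w N k <= y < node a w N k.+1 -> c N k <= G y.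
  move=> kN; rewrite nodeS nodeE => /andP[y1 y2].
  rewrite /c; case: ifPn => // gd.
  have [xg Hg] := hx0 _ gd.
  have wv : w N <= 2 * v by rewrite /w ler_pdivrMr// ler_peMr// mulr_ge0// ltW.
  have yz : `|y - mode_scale N.+1 k| <= 2 * v by rewrite ger0_norm; lra.
  have tail := gauss_tail_bound tau v0 yz.
  rewrite GE expE.
  apply: (@le_trans _ _ (laplace_term p b h M N.+1 k * expR (tau * mode_scale N.+1 k / v))).
    rewrite ler_piMr//; last by have /andP[] := phi01 N.+1 (mode_scale N.+1 k).
    by rewrite mulr_ge0 ?expR_ge0// laplace_term_ge0.
  rewrite [leLHS](_ : _ = stirling_factor N.+1 k * expR (N.+1%:R * (Hfun p b h (grid N.+1 k) - M) +
    tau * mode_scale N.+1 k / v)); last by rewrite /laplace_term -mulrA -expRD.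
  rewrite [leRHS](_ : _ = 2 * x0 `^ (- 2^-1) * expR (- (y ^+ 2 / (16 * v)) +
    (v / 2 + 2 * tau ^+ 2 / v))); last by rewrite /C0 -mulrA -expRD addrC.
  rewrite ler_pM ?stirling_factor_ge0 ?expR_ge0//.
    exact: stirling_factor_bound.
  rewrite ler_expR; apply: le_trans tail.
  rewrite lerD2r.
  have sqNE : Num.sqrt N.+1%:R ^+ 2 = N.+1%:R :> R by rewrite sqr_sqrtr.
  have -> : - (mode_scale N.+1 k ^+ 2 / (4 * v)) =
      N.+1%:R * (- (v / 4) * (grid N.+1 k - m) ^+ 2).
    by rewrite /mode_scale !exprMn sqNE; field; rewrite gt_eqF.
  by rewrite ler_pM2l.
have cg y (k : nat -> nat) : y != t0 -> (\forall N \near \oo, (k N < N.+2)%N) ->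
    node a w N (k N) @[N --> \oo] --> y -> c N (k N) @[N --> \oo] --> g y.
  move=> yt0 kN; rewrite (funext (fun N => nodeE N (k N))) => zy.
  have [gm Hexp] := laplace_exponent_cvg zy.
  have lim : stirling_factor N.+1 (k N) * (expR (N.+1%:R * (Hfun p b h (grid N.+1 (k N)) - M)) *
      expR (tau * mode_scale N.+1 (k N) / v)) * phi_ N.+1 (mode_scale N.+1 (k N))
      @[N --> \oo] --> expR (- D) * (2 * (1 - m ^+ 2) `^ (- 2^-1)) *
      (expR (- (y ^+ 2 / (2 * v))) * expR (tau * y / v)) * phi y.
    apply: cvgM; last exact: (phi_cvg _ (fun N => mode_scale N.+1 (k N))).
    apply: cvgM; first by apply: stirling_factor_cvg => //; rewrite m1.
    apply: cvgM; first by apply: (cvg_comp _ expR) Hexp _; exact: continuous_expR.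
    apply: (cvg_comp _ expR); last exact: continuous_expR.
    apply: cvgM; last exact: cvg_cst.
    by apply: cvgM; first exact: cvg_cst.
  rewrite /g expRD; apply: cvg_trans lim; apply: near_eq_cvg; near=> N.
  rewrite /c ifT; first by rewrite expE /laplace_term !mulrA.
  by rewrite distrC; near: N; move/cvgrPdist_lt : gm; exact.
exact: (@riemann_sum_dominated R (fun N => N.+2) a w c w0 c0 w_cvg a_cvg b_cvg g G t0 mg iG cG G0 cg).
Unshelve. all: by end_near. Qed.

(* The factor [expR (- D) * Num.sqrt (2 * pi)] is common to all the modes and
   cancels in the Gibbs probabilities. *)
Lemma local_laplace (tau t0 d : R) (phi_ : nat -> R -> R) (phi : R -> R) :
  measurable_fun setT phi -> (forall z, 0 <= phi z) ->
  (forall N z, 0 <= phi_ N z <= 1) ->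
  (forall z (z_ : nat -> R), z != t0 -> z_ N @[N --> \oo] --> z ->
     phi_ N.+1 (z_ N) @[N --> \oo] --> phi z) ->
  0 < d ->
  (exists2 x0, 0 < x0 & forall x, `|x - m| < d -> x0 <= 1 - x ^+ 2 /\
    Hfun p b h x - M <= - (v / 4) * (x - m) ^+ 2) ->
  (Num.sqrt N.+1%:R)^-1 * (\sum_(k < N.+2) if `|grid N.+1 k - m| < d then
     laplace_term p b h M N.+1 k * expR (tau * (Num.sqrt N.+1%:R * (grid N.+1 k - m)))
       * phi_ N.+1 (mode_scale N.+1 k) else 0) @[N --> \oo] -->
  expR (- D) * Num.sqrt (2 * pi) * unnormalized_mode_weight p b h m *
  expR (tau ^+ 2 / (2 * v)) *
  fine (\int[lebesgue_measure]_z (normal_pdf tau (Num.sqrt v) z * phi z)%:E)%E.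
Proof.
move=> mphi phi0 phi01 phi_cvg d0 hx0.
have lim := local_laplace_integral (tau := tau) mphi phi01 phi_cvg d0 hx0.
have s0 : 0 < Num.sqrt v by rewrite sqrtr_gt0.
have sK : Num.sqrt v ^+ 2 = v by rewrite sqr_sqrtr// ltW.
have pk := normal_peak_gt0 (lt0r_neq0 s0).
have /andP[m1 m2] := maximizer_interior m_max.
have m20 : 0 < 1 - m ^+ 2 by nra.
pose K := expR (- D) * (2 * (1 - m ^+ 2) `^ (- 2^-1)) * expR (tau ^+ 2 / (2 * v)) /
  normal_peak (Num.sqrt v).
have gE z : expR (- D) * (2 * (1 - m ^+ 2) `^ (- 2^-1)) *
     expR (- (z ^+ 2 / (2 * v)) + tau * z / v) * phi z =
     K * (normal_pdf tau (Num.sqrt v) z * phi z).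
  rewrite (normal_pdf_scaledE _ _ (lt0r_neq0 s0)) sK /K.
  have -> : - (z ^+ 2 / (2 * v)) + tau * z / v =
     tau ^+ 2 / (2 * v) + - ((z - tau) ^+ 2 / (2 * v)).
    by field; rewrite gt_eqF.
  rewrite expRD; field; exact: lt0r_neq0.
have K0 : 0 <= K.
  apply: divr_ge0; last exact: ltW.
  by rewrite mulr_ge0 ?expR_ge0// mulr_ge0 ?expR_ge0// mulr_ge0// powR_ge0.
have intE : fine (\int[lebesgue_measure]_z (expR (- D) * (2 * (1 - m ^+ 2) `^ (- 2^-1)) *
     expR (- (z ^+ 2 / (2 * v)) + tau * z / v) * phi z)%:E)%E =
   K * fine (\int[lebesgue_measure]_z (normal_pdf tau (Num.sqrt v) z * phi z)%:E)%E.
  rewrite -fine_scale -ge0_integralZl//=.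
  - by congr fine; apply: eq_integral => z _; rewrite gE EFinM.
  - apply/measurable_EFinP; apply: measurable_funM => //.
    exact: measurable_normal_pdf.
  - by move=> z _; rewrite lee_fin mulr_ge0// normal_pdf_ge0.
rewrite intE in lim.
have KE : expR (- D) * Num.sqrt (2 * pi) * unnormalized_mode_weight p b h m *
    expR (tau ^+ 2 / (2 * v)) = (2 * v)^-1 * K.
  rewrite /unnormalized_mode_weight Hfun''E ?m1//.
  have -> : (m ^+ 2 - 1) * Hfun_deriv2 p b m = (1 - m ^+ 2) * v by rewrite /v; ring.
  rewrite powRM ?(ltW v0) ?(ltW m20)// [v `^ _]powRN powR12_sqrt ?(ltW v0)//.
  rewrite /K /normal_peak invrK sK.
  have -> : v * pi *+ 2 = v * (2 * pi) by rewrite mulr2n; ring.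
  rewrite (sqrtrM _ (ltW v0)).
  move: (expR (tau ^+ 2 / _)) (_ `^ _) (Num.sqrt (2 * pi)) => E P Q.
  move: s0 sK; set s := Num.sqrt v => s0' <-.
  by field; rewrite gt_eqF.
rewrite KE -mulrA.
apply: cvg_trans (cvgM (cvg_cst (2 * v)^-1) lim).
apply: near_eq_cvg; apply: nearW => N /=.
rewrite mulrA; congr (_ * _); field.
by rewrite !gt_eqF// sqrtr_gt0.
Qed.

End LocalLaplace.

(** * Negligible sums, and means from generating functions *)

Section FarSums.
Context {R : realType}.

(** The number of terms is polynomial in N; N.+2 <= 2 N.+1 and e^x >= x^3 / 6 bound the quantity by
    12 / (c^3 sqrt N.+1). *)
Lemma far_sum_vanish (F : nat -> nat -> R) (c : R) : 0 < c ->
  (\forall N \near \oo, forall k, (k < N.+2)%N ->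
     0 <= F N k <= Num.sqrt N.+1%:R * expR (- (c * Num.sqrt N.+1%:R))) ->
  (Num.sqrt N.+1%:R)^-1 * (\sum_(k < N.+2) F N k) @[N --> \oo] --> 0.
Proof.
move=> c0 hF.
have s0 N : 0 < Num.sqrt N.+1%:R :> R by rewrite sqrtr_gt0.
apply: (@squeeze_cvgr _ _ _ _ (cst 0) (fun N => 12 / c ^+ 3 * (Num.sqrt N.+1%:R)^-1)).
- apply: filterS hF => N hF; apply/andP; split.
    rewrite mulr_ge0 ?invr_ge0 ?(ltW (s0 N))//; apply: sumr_ge0 => k _.
    by have /andP[] := hF k (ltn_ord k).
  set s := Num.sqrt N.+1%:R in hF *.
  have sp : 0 < s by exact: s0.
  have sK : s ^+ 2 = N.+1%:R by rewrite sqr_sqrtr.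
  have le1 : \sum_(k < N.+2) F N k <= N.+2%:R * (s * expR (- (c * s))).
    rewrite -[X in X%:R * _](card_ord N.+2) mulr_natl -sumr_const.
    by apply: ler_sum => k _; have /andP[] := hF k (ltn_ord k).
  have N2 : N.+2%:R <= 2 * s ^+ 2.
    by rewrite sK -natrM ler_nat; lia.
  have cs : 0 < c * s by exact: mulr_gt0.
  have ex : (c * s) ^+ 3 / 6 <= expR (c * s).
    have := @expR_ge1Dxn R (c * s) 2 (ltW cs); have -> : 3`! = 6%N by [].
    by apply: le_trans; rewrite lerDr.
  have exN : expR (- (c * s)) <= 6 / (c * s) ^+ 3.
    rewrite expRN -[leRHS]invrK lef_pV2 ?posrE ?expR_gt0 ?invf_div//.
    by rewrite divr_gt0// exprn_gt0.
  rewrite ler_pdivrMl//.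
  apply: le_trans le1 _.
  apply: (@le_trans _ _ (2 * s ^+ 2 * (s * (6 / (c * s) ^+ 3)))).
    by rewrite ler_pM ?mulr_ge0 ?expR_ge0 ?(ltW sp)// ler_pM2l.
  by rewrite le_eqVlt; apply/orP; left; apply/eqP; field; rewrite !gt_eqF.
- exact: cvg_cst.
- have : 12 / c ^+ 3 * (Num.sqrt N.+1%:R)^-1 @[N --> \oo] --> 12 / c ^+ 3 * 0.
    apply: cvgM; first exact: cvg_cst.
    by apply/gtr0_cvgV0; [exact: nearW|exact: sqrtS_cvgy].
  by rewrite mulr0.
Qed.

Lemma uniform_radius (s : seq R) (Q : R -> R -> Prop) :
  (forall x, x \in s -> exists2 d0, 0 < d0 & forall d, 0 < d -> d <= d0 -> Q x d) ->
  exists2 d0, 0 < d0 & forall d, 0 < d -> d <= d0 -> forall x, x \in s -> Q x d.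
Proof.
elim: s => [_|y s IH hs]; first by exists 1.
have [|d1 d10 h1] := IH; first by move=> x xs; apply: hs; rewrite inE xs orbT.
have [|d2 d20 h2] := hs y; first by rewrite inE eqxx.
exists (Num.min d1 d2); first by rewrite lt_min d10.
move=> d d0; rewrite le_min => /andP[dd1 dd2] x; rewrite inE => /orP[/eqP ->|xs].
  exact: h2.
exact: h1.
Qed.

(* [1 + x <= e ^ x] compares the mean [q] with the ratio of the Laplace
   transforms [T] at nearby arguments. *)
Lemma mgf_mean_cvg (q : nat -> R) (T : R -> nat -> R) (v t C : R) :
  0 < v -> 0 < C -> t != 0 ->
  (forall tau, 0 < tau * t -> T tau N @[N --> \oo] --> C * expR (tau ^+ 2 / (2 * v))) ->
  (forall tau N, 1 + (tau - t) * q N <= T tau N / T t N) ->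
  q N @[N --> \oo] --> t / v.
Proof.
move=> v0 C0 t0 hT hq.
(* The limit of T (t + e) / T t; its derivative at 0 is the desired limit t / v. *)
pose r (e : R) := expR (((t + e) ^+ 2 - t ^+ 2) / (2 * v)).
have dr : is_derive (0 : R) 1 r (t / v).
  have d1 : is_derive (0 : R) 1 (fun e : R => ((t + e) ^+ 2 - t ^+ 2) / (2 * v)) (t / v).
    have -> : (fun e : R => ((t + e) ^+ 2 - t ^+ 2) / (2 * v)) =
        (fun e : R => (2 * v)^-1 * (2 * t * e + e ^+ 2)).
      by apply/funext => e; ring.
    have d2 := is_derive_exp 2 (0 : R).
    by apply: is_derive_eq; rewrite /GRing.scale /= mulr0 addr0; field; rewrite gt_eqF.
  rewrite /r -[X in is_derive _ _ _ X]mul1r.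
  apply: (@is_derive1_comp _ expR); apply: is_derive_eq (is_derive_expR _) _.
  by rewrite addr0 subrr mul0r expR0.
have rcvg tau : 0 < tau * t -> T tau N / T t N @[N --> \oo] --> r (tau - t).
  move=> taut; have -> : r (tau - t) = C * expR (tau ^+ 2 / (2 * v)) /
      (C * expR (t ^+ 2 / (2 * v))).
    rewrite -mulf_div divff ?gt_eqF// mul1r -expRN -expRD /r; congr expR.
    by field; rewrite gt_eqF.
  apply: cvgM; first exact: hT.
  apply: cvgV; first by rewrite gt_eqF// mulr_gt0 ?expR_gt0.
  by apply: hT; rewrite -expr2 exprn_even_gt0.
have quot : e^-1 * (r e - 1) @[e --> (0:R)^'] --> t / v.
  have [/cvg_ex [l hl] dE] := dr.
  have lE : l = t / v by rewrite -dE; apply/esym/cvg_lim.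
  move: hl; rewrite lE; apply: cvg_trans; apply: near_eq_cvg; apply: nearW => e.
  rewrite /GRing.scale /= mulr1 addr0; congr (_ * (_ - _)).
  by rewrite /r addr0 subrr mul0r expR0.
apply/cvgrPdist_le => /= eta eta0.
have eta20 : 0 < eta / 2 by rewrite divr_gt0.
move/cvgrPdist_lt : quot => /(_ _ eta20) [d /= d0 hd].
(* As e <= |t| / 2, both t + e and t - e keep the sign of t, where the limit of T is known. *)
pose e := Num.min (d / 2) (`|t| / 2).
have nt0 : 0 < `|t| by rewrite normr_gt0.
have e0 : 0 < e by rewrite lt_min; lra.
have [ed et] : e <= d / 2 /\ e <= `|t| / 2 by split; rewrite ge_min lexx ?orbT.
(* Used at x = e and x = - e: the sign of x turns the same inequality into an upper and a lower
   bound for q. *)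
have side (x : R) : `|x| = e -> \forall N \near \oo, x * q N <= x * (t / v) + e * eta.
  move=> xe.
  have x0 : x != 0 by rewrite -normr_gt0 xe.
  have xd : `|t / v - x^-1 * (r x - 1)| < eta / 2.
    by apply: (hd x) => //; rewrite /ball_ /= sub0r normrN xe; lra.
  have rx : r x - 1 <= x * (t / v) + e * (eta / 2).
    have : `|x * (t / v) - (r x - 1)| <= e * (eta / 2).
      have -> : x * (t / v) - (r x - 1) = x * (t / v - x^-1 * (r x - 1)).
        by rewrite mulrBr mulVKf.
      by rewrite normrM xe ler_pM2l// ltW.
    by rewrite ler_norml => /andP[? ?]; lra.
  have tx : 0 < (t + x) * t.
    have : `|x * t| < t * t.
      rewrite normrM xe -[ltRHS]ger0_norm -?expr2 ?sqr_ge0// expr2 normrM ltr_pM2r//.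
      lra.
    by rewrite mulrDl ltr_norml => /andP[? ?]; lra.
  have lim := rcvg _ tx.
  have ee0 : 0 < e * (eta / 2) by exact: mulr_gt0.
  have : \forall N \near \oo, T (t + x) N / T t N < 1 + (x * (t / v) + e * eta).
    apply: cvgr_lt lim _ _; rewrite addrAC subrr add0r.
    have -> : e * eta = e * (eta / 2) + e * (eta / 2) by field.
    lra.
  apply: filterS => N; have := hq (t + x) N; rewrite addrAC subrr add0r.
  move=> ? ?; lra.
have pe := side e (gtr0_norm e0).
have ne : \forall N \near \oo, - e * q N <= - e * (t / v) + e * eta.
  by apply: side; rewrite normrN gtr0_norm.
near=> N.
have h1 : e * q N <= e * (t / v) + e * eta by near: N.
have h2 : - e * q N <= - e * (t / v) + e * eta by near: N.
rewrite ler_norml; apply/andP; split.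
  rewrite -(ler_pM2l e0); lra.
rewrite -(ler_pM2l e0); lra.
Unshelve. all: by end_near. Qed.

End FarSums.

(** * Sums dominated by an extreme maximizer *)

Section ModeSums.
Context {R : realType}.
Variables (p : nat) (b h m D : R).
Hypothesis stirling_D : stirling_defect N @[N --> \oo] --> D.
Hypothesis m_max : global_maximizers p b h m.
Hypothesis m_nondeg : Hfun_deriv2 p b m < 0.

Let v := - Hfun_deriv2 p b m.
Let v0 : 0 < v. Proof. by rewrite oppr_gt0. Qed.
Let M := Hfun p b h m.
Let kappa := expR (- D) * Num.sqrt (2 * pi) : R.
Local Notation term := (laplace_term p b h M).
Local Notation scale := (mode_scale p b m).

Lemma laplace_term_le N k : (0 < N)%N -> (k <= N)%N ->
  term N k <= Num.sqrt N%:R * expR (N%:R * (Hfun p b h (grid N k) - M)).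
Proof. by move=> N0 kN; rewrite ler_wpM2r ?expR_ge0// stirling_factor_le_sqrt. Qed.

(** The last hypothesis is where a tilt or a cut has to suppress the competing maximizers; the rest
    is local. *)
Lemma single_mode_sum (tau t0 : R) (phi_ : nat -> R -> R) (phi : R -> R) :
  measurable_fun setT phi -> (forall z, 0 <= phi z) ->
  (forall N z, 0 <= phi_ N z <= 1) ->
  (forall z (z_ : nat -> R), z != t0 -> z_ N @[N --> \oo] --> z ->
     phi_ N.+1 (z_ N) @[N --> \oo] --> phi z) ->
  (forall d : R, 0 < d -> exists2 c : R, 0 < c & \forall N \near \oo, forall k, (k < N.+2)%N ->
     d <= `|grid N.+1 k - m| ->
     term N.+1 k * expR (tau * (Num.sqrt N.+1%:R * (grid N.+1 k - m))) *
       phi_ N.+1 (scale N.+1 k) <= Num.sqrt N.+1%:R * expR (- (c * Num.sqrt N.+1%:R))) ->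
  (Num.sqrt N.+1%:R)^-1 * (\sum_(k < N.+2)
     term N.+1 k * expR (tau * (Num.sqrt N.+1%:R * (grid N.+1 k - m)))
       * phi_ N.+1 (scale N.+1 k)) @[N --> \oo] -->
  kappa * unnormalized_mode_weight p b h m * expR (tau ^+ 2 / (2 * v)) *
  fine (\int[lebesgue_measure]_z (normal_pdf tau (Num.sqrt v) z * phi z)%:E)%E.
Proof.
move=> mphi phi0 phi01 phi_cvg far.
have [d d0 hd] := local_radius m_max m_nondeg.
have near_cvg := local_laplace stirling_D m_max m_nondeg (tau := tau) mphi phi0 phi01
  phi_cvg d0 (hd d d0 (lexx d)).
have [c c0 hc] := far d d0.
pose F N k : R := if `|grid N.+1 k - m| < d then 0 else
   term N.+1 k * expR (tau * (Num.sqrt N.+1%:R * (grid N.+1 k - m)))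
       * phi_ N.+1 (scale N.+1 k).
have far_cvg : (Num.sqrt N.+1%:R)^-1 * (\sum_(k < N.+2) F N k) @[N --> \oo] --> 0.
  apply: (far_sum_vanish c0); apply: filterS hc => N hc k kN.
  rewrite /F; case: ltP => kd; first by rewrite lexx mulr_ge0 ?expR_ge0.
  rewrite (hc k kN kd) andbT mulr_ge0 ?mulr_ge0 ?expR_ge0 ?laplace_term_ge0//.
  by have /andP[] := phi01 N.+1 (scale N.+1 k).
set L := kappa * _ * _ * _; rewrite -(addr0 L).
apply: cvg_trans (cvgD near_cvg far_cvg).
apply: near_eq_cvg; apply: nearW => N /=.
rewrite -[LHS]/(_ + _) -mulrDr -big_split /=; congr (_ * _).
by apply: eq_bigr => k _; rewrite /F; case: ifP; rewrite ?addr0 ?add0r.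
Qed.

(** The sign is 1 when m is the greatest maximizer and -1 when it is the least, so that both ends
    share one proof. *)
Variable sg : R.
Hypothesis sg1 : `|sg| = 1.
Hypothesis m_extreme : forall x, global_maximizers p b h x -> sg * x <= sg * m.

Let sgsq : sg * sg = 1.
Proof. by rewrite -expr2 -real_normK ?num_real// sg1 expr1n. Qed.

Lemma side_gap (d : R) : 0 < d -> exists2 e : R, 0 < e & forall x, x \in `[-1, 1] ->
  d <= sg * (x - m) -> Hfun p b h x <= M - e.
Proof.
move=> d0; pose K : set R := [set` `[-1, 1]] `&` [set x | d <= sg * (x - m)].
have cK : closed K.
  apply: closedI; first exact: interval_closed.
  have -> : [set x | d <= sg * (x - m)] = (fun x => sg * (x - m)) @^-1` [set y | d <= y] by [].
  apply: closed_comp; last exact: closed_ge.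
  move=> x _; apply: cvgM; first exact: cvg_cst.
  by apply: cvgB; [exact: cvg_id|exact: cvg_cst].
have [|e e0 he] := Hfun_gap cK _ m_max; last by exists e => // x xI xd; apply: he.
move=> x [xI /= xd]; split=> // /m_extreme.
by rewrite mulrBr in xd; lra.
Qed.

Lemma far_sides (d x : R) : d <= `|x - m| -> sg * (x - m) <= - d \/ d <= sg * (x - m).
Proof.
have -> : `|x - m| = `|sg * (x - m)| by rewrite normrM sg1 mul1r.
have [h0|h0] := leP 0 (sg * (x - m)).
  by rewrite ger0_norm// => ?; right.
by rewrite ltr0_norm// => ?; left; lra.
Qed.

(** On the inner side, which holds the other maximizers, H gives no decay and the tilt alone
    supplies e^(-T d sqrt N). On the outer side the tilt grows at most like e^(2 T sqrt N), and the
    gap e^(-eN) leaves e^(-sqrt N) once e sqrt N >= 2 T + 1. *)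
Lemma tilted_mode_sum (tau : R) : 0 < tau * sg ->
  (Num.sqrt N.+1%:R)^-1 * (\sum_(k < N.+2)
     term N.+1 k * expR (tau * (Num.sqrt N.+1%:R * (grid N.+1 k - m))))
     @[N --> \oo] -->
  kappa * unnormalized_mode_weight p b h m * expR (tau ^+ 2 / (2 * v)).
Proof.
move=> tsg.
have tE x : tau * x = (tau * sg) * (sg * x) by rewrite mulrA -(mulrA tau) sgsq mulr1.
have := @single_mode_sum tau 0 (fun=> cst 1) (cst 1).
have -> : (\int[lebesgue_measure]_z (normal_pdf tau (Num.sqrt v) z * cst 1 z)%:E)%E = 1%E :> \bar R.
  by rewrite -(integral_normal_pdf tau (Num.sqrt v)); apply: eq_integral => z _; rewrite mulr1.
rewrite /= mulr1 => H.
have : (Num.sqrt N.+1%:R)^-1 * (\sum_(k < N.+2)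
     term N.+1 k * expR (tau * (Num.sqrt N.+1%:R * (grid N.+1 k - m))) * 1) @[N --> \oo] -->
  kappa * unnormalized_mode_weight p b h m * expR (tau ^+ 2 / (2 * v)).
  apply: H => //.
  - by move=> N z; rewrite /= ler01 lexx.
  - by move=> z z_ _ _; exact: cvg_cst.
  move=> d d0; have [e e0 he] := side_gap d0.
  pose T := tau * sg.
  pose c := Num.min (T * d) 1.
  have c0 : 0 < c by rewrite lt_min mulr_gt0/=.
  have [cT c1] : c <= T * d /\ c <= 1 by split; rewrite ge_min lexx ?orbT.
  exists c => //; near=> N.
  have h3 : 2 * T + 1 <= e * Num.sqrt N.+1%:R.
    by rewrite -ler_pdivrMl//; near: N; move/cvgryPge : (@sqrtS_cvgy R); exact.
  move=> k kN kd; rewrite mulr1; move: h3.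
  set s := Num.sqrt N.+1%:R => h3.
  have s0 : 0 < s by rewrite sqrtr_gt0.
  have sK : N.+1%:R = s ^+ 2 by rewrite sqr_sqrtr.
  have kI := grid_bounds (R := R) (ltn0Sn N) (kN : (k <= N.+1)%N).
  have xI : (grid N.+1 k : R) \in `[-1, 1] by rewrite in_itv; exact: kI.
  apply: le_trans (ler_wpM2r (expR_ge0 _) (laplace_term_le _ _)) _ => //.
  rewrite -mulrA -expRD ler_pM2l// ler_expR tE.
  have -> : tau * sg = T by [].
  have HM : Hfun p b h (grid N.+1 k) <= M by exact: m_max.2.
  have NH : N.+1%:R * (Hfun p b h (grid N.+1 k) - M) <= 0.
    by rewrite pmulr_rle0// subr_le0.
  have T0 : 0 < T by [].
  have mI := maximizer_interior m_max.
  case: (far_sides kd) => sx.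
    have : T * (sg * (s * (grid N.+1 k - m))) <= - (T * d * s).
      have -> : T * (sg * (s * (grid N.+1 k - m))) = T * s * (sg * (grid N.+1 k - m)) by ring.
      have -> : - (T * d * s) = T * s * - d by ring.
      by rewrite ler_pM2l// mulr_gt0.
    have : c * s <= T * d * s by rewrite ler_pM2r.
    lra.
  have h1 : T * (sg * (s * (grid N.+1 k - m))) <= 2 * T * s.
    have -> : T * (sg * (s * (grid N.+1 k - m))) = T * s * (sg * (grid N.+1 k - m)) by ring.
    have -> : 2 * T * s = T * s * 2 by ring.
    have Ts : 0 < T * s by exact: mulr_gt0.
    rewrite (ler_pM2l Ts); apply: (le_trans (ler_norm _)).
    rewrite normrM sg1 mul1r ler_norml; case/andP: kI => ? ?; case/andP: mI => ? ?.
    by apply/andP; split; lra.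
  have h2 : N.+1%:R * (Hfun p b h (grid N.+1 k) - M) <= - (e * s) * s.
    rewrite sK; have -> : - (e * s) * s = s ^+ 2 * - e by ring.
    by rewrite ler_pM2l ?exprn_gt0//; have := he _ xI sx; lra.
  have h4 : (2 * T + 1) * s <= e * s * s by rewrite ler_pM2r.
  have h5 : c * s <= s by rewrite ler_piMl// ltW.
  lra.
apply: cvg_trans; apply: near_eq_cvg; apply: nearW => N.
by congr (_ * _); apply: eq_bigr => k _; rewrite mulr1.
Unshelve. all: by end_near. Qed.

(** Points at distance d on the inner side have scaled coordinate of order sqrt N, beyond the
    convergent cut, so the test function kills them; the outer side has a gap. *)
Lemma cut_mode_sum (t0 l : R) (s_ : nat -> R) (phi_ : nat -> R -> R) (phi : R -> R) :
  measurable_fun setT phi -> (forall z, 0 <= phi z) ->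
  (forall N z, 0 <= phi_ N z <= 1) ->
  (forall z (z_ : nat -> R), z != t0 -> z_ N @[N --> \oo] --> z ->
     phi_ N.+1 (z_ N) @[N --> \oo] --> phi z) ->
  s_ N.+1 @[N --> \oo] --> l ->
  (forall N z, phi_ N z != 0 -> sg * s_ N <= sg * z) ->
  (Num.sqrt N.+1%:R)^-1 * (\sum_(k < N.+2) term N.+1 k * phi_ N.+1 (scale N.+1 k))
     @[N --> \oo] -->
  kappa * unnormalized_mode_weight p b h m *
  fine (\int[lebesgue_measure]_z (normal_pdf 0 (Num.sqrt v) z * phi z)%:E)%E.
Proof.
move=> mphi phi0 phi01 phi_cvg s_l cut.
have := single_mode_sum (tau := 0) mphi phi0 phi01 phi_cvg.
rewrite expr0n /= mul0r expR0 mulr1 => H.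
have : (Num.sqrt N.+1%:R)^-1 * (\sum_(k < N.+2)
     term N.+1 k * expR (0 * (Num.sqrt N.+1%:R * (grid N.+1 k - m)))
       * phi_ N.+1 (scale N.+1 k)) @[N --> \oo] -->
  kappa * unnormalized_mode_weight p b h m *
  fine (\int[lebesgue_measure]_z (normal_pdf 0 (Num.sqrt v) z * phi z)%:E)%E.
  apply: H => d d0; have [e e0 he] := side_gap d0.
  exists e => //; near=> N.
  have sl : - (`|l| + 1) <= sg * s_ N.+1.
    have : `|s_ N.+1| <= `|l| + 1.
      near: N; have : `|s_ N.+1| @[N --> \oo] --> `|l| by exact: cvg_norm.
      by move/cvgr_le; apply; rewrite ltrDl.
    by rewrite -{1}(mul1r `|s_ _|) -sg1 -normrM ler_norml => /andP[].
  have big : (`|l| + 1) < v * d * Num.sqrt N.+1%:R.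
    have vd : 0 < v * d by exact: mulr_gt0.
    rewrite -ltr_pdivrMl//; near: N; move/cvgryPgt : (@sqrtS_cvgy R); exact.
  move=> k kN kd; rewrite mul0r expR0 mulr1; move: big.
  set s := Num.sqrt N.+1%:R => big.
  have s1 : 1 <= s by rewrite -[leLHS]sqrtr1 ler_wsqrtr// ler1n.
  have s0 : 0 < s by lra.
  have sK : N.+1%:R = s ^+ 2 by rewrite sqr_sqrtr.
  have [->|phin0] := eqVneq (phi_ N.+1 (scale N.+1 k)) 0.
    by rewrite mulr0 mulr_ge0 ?expR_ge0// ltW.
  have := cut _ _ phin0; rewrite /mode_scale -/v -/s => zcut.
  have kI := grid_bounds (R := R) (ltn0Sn N) (kN : (k <= N.+1)%N).
  have xI : (grid N.+1 k : R) \in `[-1, 1] by rewrite in_itv; exact: kI.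
  have zc : - d < sg * (grid N.+1 k - m).
    have : - (v * d * s) < sg * (v * (s * (grid N.+1 k - m))) by lra.
    have -> : sg * (v * (s * (grid N.+1 k - m))) = v * s * (sg * (grid N.+1 k - m)) by ring.
    have -> : - (v * d * s) = v * s * - d by ring.
    by rewrite ltr_pM2l// mulr_gt0.
  case: (far_sides kd) => sx; first lra.
  apply: (@le_trans _ _ (term N.+1 k)).
    by rewrite ler_piMr ?laplace_term_ge0//; have /andP[] := phi01 N.+1 (scale N.+1 k).
  apply: le_trans (laplace_term_le _ _) _ => //; rewrite ler_pM2l// ler_expR.
  apply: (@le_trans _ _ (- e * s * s)).
    rewrite sK; have -> : - e * s * s = s ^+ 2 * - e by ring.
    by rewrite ler_pM2l ?exprn_gt0//; have := he _ xI sx; lra.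
  by rewrite !mulNr lerN2 ler_peMr// mulr_ge0// ltW.
apply: cvg_trans; apply: near_eq_cvg; apply: nearW => N.
by congr (_ * _); apply: eq_bigr => k _; rewrite mul0r expR0 mulr1.
Unshelve. all: by end_near. Qed.

End ModeSums.

(** * Total mass as a sum over all maximizers *)

Section ModeMasses.
Context {R : realType}.
Variables (p : nat) (b h : R) (ms : seq R) (D : R).
Hypothesis stirling_D : stirling_defect N @[N --> \oo] --> D.
Hypothesis ms_uniq : uniq ms.
Hypothesis ms_max : forall x, global_maximizers p b h x <-> x \in ms.
Hypothesis ms_nondeg : forall x, x \in ms -> Hfun_deriv2 p b x < 0.
Variable m : R.
Hypothesis m_in : m \in ms.

Let m_max : global_maximizers p b h m. Proof. exact/ms_max. Qed.
Let m_nondeg : Hfun_deriv2 p b m < 0. Proof. exact: ms_nondeg. Qed.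
Let M := Hfun p b h m.
Let v := - Hfun_deriv2 p b m.
Let v0 : 0 < v. Proof. by rewrite oppr_gt0. Qed.
Let kappa := expR (- D) * Num.sqrt (2 * pi) : R.
Local Notation term := (laplace_term p b h M).
Local Notation umw := (unnormalized_mode_weight p b h).

Let kappa0 : 0 < kappa.
Proof. by rewrite mulr_gt0 ?expR_gt0// sqrtr_gt0 mulr_gt0// pi_gt0. Qed.

Lemma modes_gap d : 0 < d -> exists2 e, 0 < e & forall x, x \in `[-1, 1] ->
  (forall y, y \in ms -> d <= `|x - y|) -> Hfun p b h x <= M - e.
Proof.
move=> d0; pose K : set R := [set` `[-1, 1]] `&`
  [set x | forall y, y \in ms -> d <= `|x - y|].
have cK : closed K.
  apply: closedI; first exact: interval_closed.
  have -> : [set x | forall y, y \in ms -> d <= `|x - y|] =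
      \bigcap_(y in [set` ms]) (fun x => `|x - y|) @^-1` [set z | d <= z].
    by apply/seteqP; split=> x /= hx y; exact: hx.
  apply: closed_bigI => y _; apply: closed_comp; last exact: closed_ge.
  move=> x _; apply: cvg_norm.
  by apply: cvgB; [exact: cvg_id|exact: cvg_cst].
have [|e e0 he] := Hfun_gap cK _ m_max; last by exists e => // x xI xd; apply: he.
move=> x [xI /= xd]; split=> // /ms_max /xd.
by rewrite subrr normr0 leNgt d0.
Qed.

(** Maximizers 2d apart have disjoint d-neighbourhoods, so that no lattice point is counted twice in
    the total mass. *)
Lemma modes_radius : exists2 d : R, 0 < d & forall y, y \in ms ->
  (exists2 x0, 0 < x0 & forall x, `|x - y| < d -> x0 <= 1 - x ^+ 2 /\
    Hfun p b h x - Hfun p b h y <= - (- Hfun_deriv2 p b y / 4) * (x - y) ^+ 2) /\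
  (forall z, z \in ms -> z != y -> 2 * d <= `|z - y|).
Proof.
have [y yms|d0 d00 hd0] := @uniform_radius R ms (fun y d =>
  (exists2 x0, 0 < x0 & forall x, `|x - y| < d -> x0 <= 1 - x ^+ 2 /\
    Hfun p b h x - Hfun p b h y <= - (- Hfun_deriv2 p b y / 4) * (x - y) ^+ 2) /\
  (forall z, z \in ms -> z != y -> 2 * d <= `|z - y|)); last by exists d0 => // y; exact: hd0.
have [d1 d10 hd1] := local_radius ((ms_max y).2 yms) (ms_nondeg yms).
have [z zms|d2 d20 hd2] := @uniform_radius R ms (fun z d => z != y -> 2 * d <= `|z - y|).
  have [->|zy] := eqVneq z y; first by exists 1.
  have zy0 : 0 < `|z - y| by rewrite normr_gt0 subr_eq0.
  by exists (`|z - y| / 2); [rewrite divr_gt0|move=> d _ dle _; lra].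
exists (Num.min d1 d2); first by rewrite lt_min d10.
by move=> d d0; rewrite le_min => /andP[dd1 dd2]; split; [exact: hd1|exact: hd2].
Qed.

Lemma total_mass_cvg :
  (Num.sqrt N.+1%:R)^-1 * (\sum_(k < N.+2) term N.+1 k) @[N --> \oo] -->
  kappa * \sum_(y <- ms) umw y.
Proof.
have [d d0 hd] := modes_radius.
have near_cvg y : y \in ms -> (Num.sqrt N.+1%:R)^-1 *
    (\sum_(k < N.+2) if `|grid N.+1 k - y| < d then term N.+1 k else 0)
    @[N --> \oo] --> kappa * umw y.
  move=> yms; have [x0P _] := hd y yms; have ymax := (ms_max y).2 yms.
  have := @local_laplace R p b h y D stirling_D ymax (ms_nondeg yms) 0 0 d (fun=> cst 1) (cst 1).
  have -> : (\int[lebesgue_measure]_z (normal_pdf 0 (Num.sqrt (- Hfun_deriv2 p b y)) z * cst 1 z)%:E)%E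
      = 1%E :> \bar R.
    by rewrite -(integral_normal_pdf 0 (Num.sqrt (- Hfun_deriv2 p b y)));
      apply: eq_integral => z _; rewrite mulr1.
  rewrite /= expr0n /= mul0r expR0 !mulr1 => H.
  have {}H := H _ _ _ _ d0 x0P.
  have : (Num.sqrt N.+1%:R)^-1 * (\sum_(k < N.+2) if `|grid N.+1 k - y| < d then
     laplace_term p b h (Hfun p b h y) N.+1 k * expR (0 * (Num.sqrt N.+1%:R * (grid N.+1 k - y))) * 1
     else 0) @[N --> \oo] --> kappa * umw y.
    apply: H => //.
    - by move=> N z; rewrite /= ler01 lexx.
    - by move=> z z_ _ _; exact: cvg_cst.
  apply: cvg_trans; apply: near_eq_cvg; apply: nearW => N; congr (_ * _).
  apply: eq_bigr => k _; rewrite mul0r expR0 !mulr1.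
  by rewrite /M (maximizers_same_value m_max ymax).
have [e e0 he] := modes_gap d0.
pose F N k : R := if has (fun y => `|grid N.+1 k - y| < d) ms then 0 else term N.+1 k.
have far_cvg : (Num.sqrt N.+1%:R)^-1 * (\sum_(k < N.+2) F N k) @[N --> \oo] --> 0.
  apply: (far_sum_vanish e0); apply: nearW => N k kN.
  have s0 : 0 < Num.sqrt N.+1%:R :> R by rewrite sqrtr_gt0.
  rewrite /F; case: ifPn => [_|/hasPn kd]; first by rewrite lexx mulr_ge0 ?expR_ge0// ltW.
  rewrite laplace_term_ge0/=; apply: le_trans (laplace_term_le _ _ _ _ _ _) _ => //.
  rewrite ler_pM2l// ler_expR.
  have xI : (grid N.+1 k : R) \in `[-1, 1].
    by rewrite in_itv; exact: (@grid_bounds R N.+1 k (ltn0Sn N) kN).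
  have kd' y : y \in ms -> d <= `|grid N.+1 k - y|.
    by move=> /kd; rewrite -leNgt.
  have s1 : 1 <= Num.sqrt N.+1%:R :> R by rewrite -[leLHS]sqrtr1 ler_wsqrtr// ler1n.
  have hk := he _ xI kd'.
  apply: (@le_trans _ _ (N.+1%:R * - e)); first by rewrite ler_pM2l// -/M; lra.
  rewrite mulrN lerN2 mulrC ler_pM2r//.
  by rewrite -[leRHS](@sqr_sqrtr R) // expr2 ler_peMr// ltW.
have sumE N : (Num.sqrt N.+1%:R)^-1 * (\sum_(k < N.+2) term N.+1 k) =
    \sum_(y <- ms | y \in ms) (Num.sqrt N.+1%:R)^-1 *
      (\sum_(k < N.+2) if `|grid N.+1 k - y| < d then term N.+1 k else 0) +
    (Num.sqrt N.+1%:R)^-1 * (\sum_(k < N.+2) F N k).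
  rewrite -big_seq -mulr_sumr -mulrDr; congr (_ * _).
  rewrite exchange_big /= -big_split /=; apply: eq_bigr => k _.
  rewrite /F; case: ifPn => [/hasP[y yms yk]|/hasPn kd].
    rewrite addr0 (bigD1_seq y)//= yk big_seq_cond big1 ?addr0// => z /andP[zms zy].
    have [_ /(_ z zms zy)] := hd y yms.
    case: ifPn => // zk.
    have : `|z - y| <= `|grid N.+1 k - y| + `|grid N.+1 k - z|.
      have -> : z - y = (grid N.+1 k - y) - (grid N.+1 k - z) by ring.
      exact: ler_normB.
    lra.
  by rewrite big_seq big1 ?add0r// => y /kd /negbTE ->.
have -> : kappa * (\sum_(y <- ms) umw y) = \sum_(y <- ms | y \in ms) kappa * umw y + 0.
  by rewrite -big_seq mulr_sumr addr0.
rewrite (funext sumE); apply: cvgD far_cvg.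
by apply: cvg_big => [|y yms]; [exact: add_continuous|exact: near_cvg].
Qed.

End ModeMasses.

(** * Limiting distribution functions *)

Section LimitingCdf.
Context {R : realType}.
Variables (p : nat) (b h : R) (ms : seq R) (D : R).
Hypothesis stirling_D : stirling_defect N @[N --> \oo] --> D.
Hypothesis ms_uniq : uniq ms.
Hypothesis ms_max : forall x, global_maximizers p b h x <-> x \in ms.
Hypothesis ms_nondeg : forall x, x \in ms -> Hfun_deriv2 p b x < 0.
Variable m : R.
Hypothesis m_in : m \in ms.

Let m_max : global_maximizers p b h m. Proof. exact/ms_max. Qed.
Let m_nondeg : Hfun_deriv2 p b m < 0. Proof. exact: ms_nondeg. Qed.
Let M := Hfun p b h m.
Let v := - Hfun_deriv2 p b m.
Let v0 : 0 < v. Proof. by rewrite oppr_gt0. Qed.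
Let kappa := expR (- D) * Num.sqrt (2 * pi) : R.
Local Notation term := (laplace_term p b h M).
Local Notation umw := (unnormalized_mode_weight p b h).

Let kappa0 : 0 < kappa.
Proof. by rewrite mulr_gt0 ?expR_gt0// sqrtr_gt0 mulr_gt0// pi_gt0. Qed.

Lemma mean_magnetization_grid h' N :
  mean_magnetization p b h' N =
  (\sum_(k < N.+1) 'C(N, k)%:R * expR (N%:R * (b * grid N k ^+ p + h' * grid N k)) * grid N k) /
  (\sum_(k < N.+1) 'C(N, k)%:R * expR (N%:R * (b * grid N k ^+ p + h' * grid N k))) :> R.
Proof.
pose f (x : R) := expR (N%:R * (b * x ^+ p + h' * x)).
rewrite -(sum_config N f).
under eq_bigr do rewrite -mulrA.
rewrite -(sum_config N (fun x => f x * x)) mulr_suml.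
apply: eq_bigr => s _; rewrite /gibbs /partition_fun mulVKf ?expf_neq0 ?pnatr_eq0//.
by rewrite mulrAC.
Qed.

Lemma laplace_term_gt0 N k : (0 < N)%N -> (k <= N)%N -> 0 < term N k.
Proof.
move=> N0 kN; rewrite mulr_gt0 ?expR_gt0// mulr_gt0 ?expR_gt0//.
by rewrite divr_gt0 ?exprn_gt0// mulr_gt0 ?sqrtr_gt0 ?ltr0n ?bin_gt0.
Qed.

Let tilt N k tau := term N k * expR (tau * (Num.sqrt N%:R * (grid N k - m))).

Lemma tilt_sum_gt0 N tau : (0 < N)%N -> 0 < \sum_(k < N.+1) tilt N k tau.
Proof.
move=> N0; apply: (@sum_gt0_witness _ _ _ ord0) => [k|].
  by rewrite mulr_ge0 ?expR_ge0 ?laplace_term_ge0.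
by rewrite mulr_gt0 ?expR_gt0 ?laplace_term_gt0.
Qed.

(** Since N t / sqrt N = t sqrt N, the extra field multiplies the weight by e^(t sqrt N x);
    recentring at m costs a constant that cancels. *)
Lemma mean_tiltE t N : (0 < N)%N ->
  Num.sqrt N%:R * (mean_magnetization p b (h + t / Num.sqrt N%:R) N - m) =
  (\sum_(k < N.+1) tilt N k t * (Num.sqrt N%:R * (grid N k - m))) /
  (\sum_(k < N.+1) tilt N k t).
Proof.
move=> N0; rewrite mean_magnetization_grid.
set s := Num.sqrt N%:R.
have s0 : 0 < s by rewrite sqrtr_gt0 ltr0n.
have sK : N%:R = s ^+ 2 by rewrite sqr_sqrtr.
pose C := 2 ^+ N / s * expR (N%:R * M) * expR (t * (s * m)).
have C0 : C != 0.
  by rewrite gt_eqF// !mulr_gt0 ?expR_gt0 ?invr_gt0 ?exprn_gt0.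
have wE k : 'C(N, k)%:R * expR (N%:R * (b * grid N k ^+ p + (h + t / s) * grid N k)) =
    C * tilt N k t.
  have -> : N%:R * (b * grid N k ^+ p + (h + t / s) * grid N k) =
      N%:R * (b * grid N k ^+ p + h * grid N k) + (t * (s * m) + t * (s * (grid N k - m))).
    by rewrite mulrDr sK; field; rewrite gt_eqF.
  rewrite expRD mulrA (binomial_weightE p b h M k N0) expRD /tilt /C -/s; ring.
under eq_bigr do rewrite wE -mulrA.
have -> : \sum_(k < N.+1) 'C(N, k)%:R * expR (N%:R * (b * grid N k ^+ p + (h + t / s) * grid N k)) =
    C * \sum_(k < N.+1) tilt N k t by rewrite mulr_sumr; apply: eq_bigr.
rewrite -mulr_sumr -mulf_div divff// mul1r.
have B0 := tilt_sum_gt0 t N0.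
apply: (@mulIf _ (\sum_(k < N.+1) tilt N k t)); first by rewrite gt_eqF.
rewrite divfK ?gt_eqF// -mulrA mulrBl divfK ?gt_eqF//.
rewrite mulr_sumr -sumrB mulr_sumr; apply: eq_bigr => k _; ring.
Qed.

Lemma umw_gt0 y : y \in ms -> 0 < umw y.
Proof.
move=> yms; rewrite powR_gt0// Hfun''E; last exact: maximizer_interior ((ms_max y).2 yms).
have /andP[y1 y2] := maximizer_interior ((ms_max y).2 yms).
have := ms_nondeg yms; move: (Hfun_deriv2 p b y) => H2 H20.
by rewrite nmulr_rgt0//; nra.
Qed.

Lemma mode_weightE : mode_weight p b h m = umw m / \sum_(y <- ms) umw y.
Proof.
rewrite /mode_weight; congr (_ / _).
have -> : global_maximizers p b h = [set` ms].
  by apply/seteqP; split=> x /=; move/ms_max.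
by rewrite [RHS]fsbig_seq.
Qed.

Lemma umw_sum_gt0 : 0 < \sum_(y <- ms) umw y.
Proof.
rewrite (bigD1_seq m)//= ltr_pwDl ?umw_gt0// big_seq_cond sumr_ge0// => y /andP[yms _].
exact: ltW (umw_gt0 yms).
Qed.

(** Every tilt tau of the sign of t selects the same extreme maximizer, so [tilted_mode_sum]
    provides the limits that [mgf_mean_cvg] needs. *)
Lemma mean_cvg (sg t : R) : `|sg| = 1 ->
  (forall x, global_maximizers p b h x -> sg * x <= sg * m) -> 0 < t * sg ->
  v * (Num.sqrt N.+1%:R * (mean_magnetization p b (h + t / Num.sqrt N.+1%:R) N.+1 - m))
    @[N --> \oo] --> t.
Proof.
move=> sg1 ext tsg.
have t0 : t != 0 by apply/eqP => t0; move: tsg; rewrite t0 mul0r ltxx.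
pose T tau N := (Num.sqrt N.+1%:R)^-1 * (\sum_(k < N.+2) tilt N.+1 k tau).
have T_cvg tau : 0 < tau * t ->
    T tau N @[N --> \oo] --> kappa * umw m * expR (tau ^+ 2 / (2 * v)).
  move=> taut; apply: (tilted_mode_sum stirling_D m_max m_nondeg sg1 ext).
  have : 0 < (tau * t) * (t * sg) by exact: mulr_gt0.
  have -> : tau * t * (t * sg) = tau * sg * t ^+ 2 by ring.
  by rewrite pmulr_lgt0// exprn_even_gt0.
have C0 : 0 < kappa * umw m by rewrite mulr_gt0 ?umw_gt0.
have jensen tau N : 1 + (tau - t) * (Num.sqrt N.+1%:R *
    (mean_magnetization p b (h + t / Num.sqrt N.+1%:R) N.+1 - m)) <= T tau N / T t N.
  have B0 := tilt_sum_gt0 t (ltn0Sn N).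
  have s0 : 0 < Num.sqrt N.+1%:R :> R by rewrite sqrtr_gt0.
  rewrite mean_tiltE// /T -mulf_div divff ?invr_eq0 ?gt_eqF// mul1r ler_pdivlMr//.
  rewrite mulrDl mul1r mulrA divfK ?gt_eqF// mulr_sumr -big_split /=.
  apply: ler_sum => k _; rewrite /tilt.
  set y := Num.sqrt N.+1%:R * (grid N.+1 k - m).
  have -> : expR (tau * y) = expR (t * y) * expR ((tau - t) * y).
    by rewrite -expRD; congr expR; ring.
  set B := term N.+1 k * expR (t * y).
  have Bpos : 0 < B by rewrite mulr_gt0 ?expR_gt0 ?laplace_term_gt0 ?leq_ord.
  have -> : B + (tau - t) * (B * y) = B * (1 + (tau - t) * y) by ring.
  by rewrite mulrA -/B ler_pM2l// expR_ge1Dx.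
have q_cvg := mgf_mean_cvg v0 C0 t0 T_cvg jensen.
have vq_cvg : v * (Num.sqrt N.+1%:R *
    (mean_magnetization p b (h + t / Num.sqrt N.+1%:R) N.+1 - m)) @[N --> \oo] --> v * (t / v).
  by apply: cvgM q_cvg; exact: cvg_cst.
have vt : v * (t / v) = t by field; rewrite gt_eqF.
by rewrite vt in vq_cvg.
Qed.

Lemma gibbs_ratio_cvg (phi_ : nat -> R -> R) (l : R) :
  (Num.sqrt N.+1%:R)^-1 * (\sum_(k < N.+2) term N.+1 k * phi_ N.+1 (grid N.+1 k))
     @[N --> \oo] --> kappa * umw m * l ->
  (\sum_(k < N.+2) 'C(N.+1, k)%:R * expR (N.+1%:R * (b * grid N.+1 k ^+ p + h * grid N.+1 k)) *
     phi_ N.+1 (grid N.+1 k)) /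
  (\sum_(k < N.+2) 'C(N.+1, k)%:R * expR (N.+1%:R * (b * grid N.+1 k ^+ p + h * grid N.+1 k)))
     @[N --> \oo] --> mode_weight p b h m * l.
Proof.
move=> num_cvg.
have den_cvg := total_mass_cvg stirling_D ms_uniq ms_max ms_nondeg m_in.
have S0 := umw_sum_gt0.
have kS : kappa * (\sum_(y <- ms) umw y) != 0 by rewrite gt_eqF// mulr_gt0.
have -> : mode_weight p b h m * l = kappa * umw m * l / (kappa * \sum_(y <- ms) umw y).
  by rewrite mode_weightE; field; rewrite !gt_eqF.
apply: cvg_trans (cvgM num_cvg (cvgV kS den_cvg)).
apply: near_eq_cvg; apply: nearW => N /=.
rewrite -[LHS]/(_ / _).
have s0 : 0 < Num.sqrt N.+1%:R :> R by rewrite sqrtr_gt0.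
rewrite -mulf_div divff ?invr_eq0 ?gt_eqF// mul1r.
pose C := 2 ^+ N.+1 / Num.sqrt N.+1%:R * expR (N.+1%:R * M).
have C0 : 0 < C by rewrite !mulr_gt0 ?expR_gt0 ?invr_gt0 ?exprn_gt0.
under [in RHS]eq_bigr do rewrite (binomial_weightE p b h M _ (ltn0Sn N)) -/C -mulrA.
have -> : \sum_(k < N.+2) 'C(N.+1, k)%:R * expR (N.+1%:R * (b * grid N.+1 k ^+ p + h * grid N.+1 k)) =
    C * \sum_(k < N.+2) term N.+1 k.
  by rewrite mulr_sumr; apply: eq_bigr => k _; rewrite (binomial_weightE p b h M _ (ltn0Sn N)).
by rewrite -mulr_sumr -mulf_div divff ?gt_eqF// mul1r.
Qed.

(** Limits are taken along N.+1 to avoid the empty configuration; the shift is undone here. *)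
Lemma mle_cdf_cvg_shift t (l : R) :
  (\sum_(k < N.+2 | (grid N.+1 k : R) <= mean_magnetization p b (h + t / Num.sqrt N.+1%:R) N.+1)
     'C(N.+1, k)%:R * expR (N.+1%:R * (b * grid N.+1 k ^+ p + h * grid N.+1 k))) /
  (\sum_(k < N.+2) 'C(N.+1, k)%:R * expR (N.+1%:R * (b * grid N.+1 k ^+ p + h * grid N.+1 k)))
    @[N --> \oo] --> l ->
  \sum_(s : config N | (scaled_error p b h s <= t%:E)%E) gibbs p b h s @[N --> \oo] --> l.
Proof.
move=> H.
rewrite -(cvg_shiftS (fun N => \sum_(s : config N | (scaled_error p b h s <= t%:E)%E) gibbs p b h s)).
apply: cvg_trans H; apply: near_eq_cvg; apply: nearW => N.
by rewrite /= mle_cdf.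
Qed.

Let cut t N : R := v * (Num.sqrt N%:R * (mean_magnetization p b (h + t / Num.sqrt N%:R) N - m)).

Lemma cut_le t N k : (0 < N)%N ->
  ((grid N k : R) <= mean_magnetization p b (h + t / Num.sqrt N%:R) N) =
  (mode_scale p b m N k <= cut t N).
Proof.
move=> N0; rewrite /mode_scale /cut -/v ler_pM2l// ler_pM2l ?sqrtr_gt0 ?ltr0n//.
by rewrite lerD2r.
Qed.

Lemma integral_normal_indic (A : set R) : measurable A ->
  (\int[lebesgue_measure]_z (normal_pdf 0 (Num.sqrt v) z * \1_A z)%:E =
   centered_normal v A)%E.
Proof.
move=> mA; rewrite /centered_normal /normal_prob [RHS]integral_mkcond epatch_indic.
by apply: eq_integral => z _; rewrite EFinM.
Qed.

Lemma indic_le_cvg (z c : R) (z_ c_ : nat -> R) : z != c ->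
  z_ N @[N --> \oo] --> z -> c_ N @[N --> \oo] --> c ->
  ((z_ N <= c_ N)%R%:R : R) @[N --> \oo] --> ((z <= c)%R%:R : R).
Proof.
rewrite neq_lt => /orP[zc|cz] z_cvg c_cvg; apply: cvg_near_cst; near=> N.
- have h1 : z_ N < (z + c) / 2 by near: N; apply: cvgr_lt z_cvg _ _; lra.
  have h2 : (z + c) / 2 < c_ N by near: N; apply: cvgr_gt c_cvg _ _; lra.
  by rewrite (ltW zc) (ltW (lt_trans h1 h2)).
- have h1 : (z + c) / 2 < z_ N by near: N; apply: cvgr_gt z_cvg _ _; lra.
  have h2 : c_ N < (z + c) / 2 by near: N; apply: cvgr_lt c_cvg _ _; lra.
  by rewrite !leNgt cz (lt_trans h2 h1).
Unshelve. all: by end_near. Qed.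

Lemma mle_cdf_left t : (forall x, x \in ms -> m <= x) -> t < 0 ->
  \sum_(s : config N | (scaled_error p b h s <= t%:E)%E) gibbs p b h s @[N --> \oo] -->
  mode_weight p b h m * fine (centered_normal v `]-oo, t]).
Proof.
move=> mleft t0; apply: mle_cdf_cvg_shift.
have ext x : global_maximizers p b h x -> -1 * x <= -1 * m.
  by move=> /ms_max /mleft; rewrite !mulN1r lerN2.
have sg1 : `|-1| = 1 :> R by rewrite normrN1.
have tsg : 0 < t * -1 by rewrite mulrN1 oppr_gt0.
have cut_cvg : cut t N.+1 @[N --> \oo] --> t := mean_cvg sg1 ext tsg.
have mA : measurable `]-oo, t] by exact: measurable_itv.
have indicE' z : \1_`]-oo, t] z = (z <= t)%R%:R :> R.
  by rewrite indicE; congr (_%:R); rewrite mem_setE in_itv.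
have H := @cut_mode_sum R p b h m D stirling_D m_max m_nondeg (-1) sg1 ext t t (cut t)
  (fun N z => (z <= cut t N)%R%:R) (\1_`]-oo, t]).
rewrite integral_normal_indic// in H.
have := gibbs_ratio_cvg (phi_ := fun N x => (x <= mean_magnetization p b (h + t / Num.sqrt N%:R) N)%R%:R)
  (l := fine (centered_normal v `]-oo, t])).
have numE N : \sum_(k < N.+2) term N.+1 k *
    ((grid N.+1 k : R) <= mean_magnetization p b (h + t / Num.sqrt N.+1%:R) N.+1)%R%:R =
    \sum_(k < N.+2) term N.+1 k * (mode_scale p b m N.+1 k <= cut t N.+1)%R%:R.
  by apply: eq_bigr => k _; rewrite cut_le.
move=> ratio; apply: cvg_trans (ratio _); last first.
  apply: cvg_trans (H _ _ _ _ cut_cvg _).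
  - by apply: near_eq_cvg; apply: nearW => N; rewrite numE.
  - exact: measurable_indic.
  - by move=> z; rewrite indicE' ler0n.
  - by move=> N z; rewrite ler0n lern1 leq_b1.
  - by move=> z z_ zt z_cvg; rewrite indicE'; exact: indic_le_cvg.
  - by move=> N z; case: leP => [zc _|_]; [rewrite !mulN1r lerN2|rewrite eqxx].
apply: near_eq_cvg; apply: nearW => N; congr (_ / _).
rewrite [RHS]big_mkcond /=; apply: eq_bigr => k _.
by case: ifP => _; rewrite ?mulr1 ?mulr0.
Qed.

(** For t > 0 the event also contains the maximizers to the left, so its complement is evaluated:
    above the cut only the greatest maximizer contributes. *)
Lemma mle_cdf_right t : (forall x, x \in ms -> x <= m) -> 0 < t ->
  \sum_(s : config N | (scaled_error p b h s <= t%:E)%E) gibbs p b h s @[N --> \oo] -->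
  1 - mode_weight p b h m * fine (centered_normal v `]t, +oo[).
Proof.
move=> mright t0; apply: mle_cdf_cvg_shift.
have ext x : global_maximizers p b h x -> 1 * x <= 1 * m.
  by move=> /ms_max /mright; rewrite !mul1r.
have sg1 : `|1| = 1 :> R by rewrite normr1.
have tsg : 0 < t * 1 by rewrite mulr1.
have cut_cvg : cut t N.+1 @[N --> \oo] --> t := mean_cvg sg1 ext tsg.
have mA : measurable `]t, +oo[ by exact: measurable_itv.
have indicE' z : \1_`]t, +oo[ z = 1 - (z <= t)%R%:R :> R.
  rewrite indicE mem_setE in_itv /= andbT ltNge.
  by case: (z <= t); rewrite ?subrr ?subr0.
have negbE (a : bool) : (~~ a)%:R = 1 - a%:R :> R by case: a; rewrite ?subrr ?subr0.
have H := @cut_mode_sum R p b h m D stirling_D m_max m_nondeg 1 sg1 ext t t (cut t)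
  (fun N z => (~~ (z <= cut t N)%R)%:R) (\1_`]t, +oo[).
rewrite integral_normal_indic// in H.
have := gibbs_ratio_cvg (phi_ := fun N x => (~~ (x <= mean_magnetization p b (h + t / Num.sqrt N%:R) N)%R)%:R)
  (l := fine (centered_normal v `]t, +oo[)).
have numE N : \sum_(k < N.+2) term N.+1 k *
    (~~ ((grid N.+1 k : R) <= mean_magnetization p b (h + t / Num.sqrt N.+1%:R) N.+1)%R)%:R =
    \sum_(k < N.+2) term N.+1 k * (~~ (mode_scale p b m N.+1 k <= cut t N.+1)%R)%:R.
  by apply: eq_bigr => k _; rewrite cut_le.
move=> ratio.
have {}ratio := ratio (cvg_trans _ (H _ _ _ _ cut_cvg _)).
apply: cvg_trans (cvgB (cvg_cst (1 : R)) (ratio _ _ _ _ _ _)).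
- apply: near_eq_cvg; apply: nearW => N /=.
  rewrite -[LHS]/(1 - _ / _).
  set W := \sum_(k < N.+2) 'C(N.+1, k)%:R * expR (N.+1%:R * (b * grid N.+1 k ^+ p + h * grid N.+1 k)).
  have W0 : 0 < W.
    apply: (@sum_gt0_witness _ _ _ ord0) => [k|]; first by rewrite mulr_ge0 ?expR_ge0.
    by rewrite mulr_gt0 ?expR_gt0// ltr0n bin0.
  rewrite -[X in X - _](@divff _ W) ?gt_eqF// -mulrBl; congr (_ / _).
  rewrite [RHS]big_mkcond /= /W -sumrB; apply: eq_bigr => k _.
  by case: ifP => _ /=; rewrite ?mulr1 ?mulr0 ?subrr ?subr0.
- by apply: near_eq_cvg; apply: nearW => N; rewrite numE.
- exact: measurable_indic.
- by move=> z; rewrite indicE ler0n.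
- by move=> N z; rewrite ler0n lern1 leq_b1.
- move=> z z_ zt z_cvg; rewrite indicE'.
  under eq_fun do rewrite negbE.
  by apply: cvgB; [exact: cvg_cst|exact: indic_le_cvg].
- by move=> N z; case: leP => [_|zc _]; [rewrite eqxx|rewrite !mul1r ltW].
Qed.

End LimitingCdf.

(** * Distribution functions of normal and half-normal laws *)

Section NormalLaws.
Context {R : realType}.
Variable v : R.
Hypothesis v0 : 0 < v.

Let s0 : Num.sqrt v != 0. Proof. by rewrite gt_eqF// sqrtr_gt0. Qed.
Local Notation P := (@normal_prob R 0 (Num.sqrt v)).

Definition normal_cdf t : R := fine (P `]-oo, t]).
Definition normal_tail t : R := fine (P `]t, +oo[).

Lemma normal_prob_fin A : measurable A -> P A \is a fin_num.
Proof. by move=> mA; exact: fin_num_measure. Qed.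

Lemma normal_probU A B : measurable A -> measurable B -> A `&` B = set0 ->
  P (A `|` B) = (P A + P B)%E.
Proof. by move=> mA mB AB; rewrite measureU. Qed.

Lemma normal_probC A : measurable A -> P (~` A) = (1 - P A)%E.
Proof. by move=> mA; rewrite probability_setC. Qed.

Lemma normal_prob_set1 a : P [set a] = 0%E.
Proof.
have := @normal_prob_dominates R 0 (Num.sqrt v).
move/null_content_dominatesP; apply; first exact: measurable_set1.
exact: lebesgue_measure_set1.
Qed.

Lemma normal_prob_opp_itv t : P `]-oo, - t] = P `[t, +oo[.
Proof.
rewrite /normal_prob ge0_integration_by_substitutionNy.
- apply: eq_integral => z _ /=; congr EFin.
  by rewrite !(normal_pdf_scaledE _ _ s0) !subr0 sqrrN.
- by apply: continuous_subspaceT; exact: continuous_normal_pdf.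
- by move=> z _; exact: normal_pdf_ge0.
Qed.

Lemma normal_prob_closed_tail t : P `[t, +oo[ = P `]t, +oo[.
Proof.
rewrite -(@setU1itv _ _ _ _ false)// normal_probU//; last first.
- by apply/seteqP; split => z //= [->]; rewrite in_itv /= ltxx.
by rewrite normal_prob_set1 add0e.
Qed.

Lemma normal_cdf_opp t : normal_cdf (- t) = normal_tail t.
Proof. by rewrite /normal_cdf normal_prob_opp_itv normal_prob_closed_tail. Qed.

Lemma normal_cdf_tail t : normal_cdf t = 1 - normal_tail t.
Proof.
rewrite /normal_cdf /normal_tail.
have -> : `]t, +oo[%classic = ~` `]-oo, t]%classic :> set R by rewrite setCitvl.
rewrite normal_probC; last exact: measurable_itv.
have : P `]-oo, t] \is a fin_num by apply: normal_prob_fin; exact: measurable_itv.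
by move=> /fineK <-; rewrite -EFinB /= subKr.
Qed.

Lemma half_normal_neg_lt0 t : t < 0 -> half_normal_neg v `]-oo, t] = (2 * normal_cdf t)%:E.
Proof.
move=> t0; rewrite /half_normal_neg /pushforward /centered_normal.
have -> : (fun z : R => - `|z|) @^-1` [set` `]-oo, t]] = `]-oo, t] `|` `[- t, +oo[.
  apply/seteqP; split => z /=; rewrite !in_itv /= ?andbT.
    have [z0|z0] := leP 0 z; first by rewrite ger0_norm// => ?; right; lra.
    by rewrite ltr0_norm// opprK; left.
  case=> zt; last by rewrite ger0_norm; lra.
  by rewrite ltr0_norm; lra.
rewrite normal_probU//; last first.
- by apply/seteqP; split => z //=; rewrite !in_itv /= andbT => -[? ?]; lra.
rewrite -normal_prob_opp_itv opprK /normal_cdf.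
have : P `]-oo, t] \is a fin_num by apply: normal_prob_fin; exact: measurable_itv.
by move=> /fineK {1 2}<-; rewrite -EFinD mulr_natl mulr2n.
Qed.

Lemma half_normal_neg_ge0 t : 0 <= t -> half_normal_neg v `]-oo, t] = 1%E.
Proof.
move=> t0; rewrite /half_normal_neg /pushforward /centered_normal.
have -> : (fun z : R => - `|z|) @^-1` [set` `]-oo, t]] = setT.
  apply/seteqP; split => z //= _; rewrite in_itv /=.
  by apply: le_trans t0; rewrite oppr_le0.
exact: probability_setT.
Qed.

Lemma half_normal_pos_lt0 t : t < 0 -> half_normal_pos v `]-oo, t] = 0%E.
Proof.
move=> t0; rewrite /half_normal_pos /pushforward /centered_normal.
have -> : (fun z : R => `|z|) @^-1` [set` `]-oo, t]] = set0.
  apply/seteqP; split => z //=; rewrite in_itv /= => zt.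
  by have := le_lt_trans zt t0; rewrite ltNge normr_ge0.
by rewrite measure0.
Qed.

Lemma half_normal_pos_ge0 t : 0 <= t ->
  half_normal_pos v `]-oo, t] = (1 - 2 * normal_tail t)%:E.
Proof.
move=> t0; rewrite /half_normal_pos /pushforward /centered_normal.
have -> : (fun z : R => `|z|) @^-1` [set` `]-oo, t]] = ~` (`]-oo, - t[ `|` `]t, +oo[).
  apply/seteqP; split => z /=; rewrite !in_itv /= ?andbT ler_norml.
    by move=> /andP[? ?] []; lra.
  by move=> /not_orP[/negP h1 /negP h2]; rewrite !leNgt h1 h2.
rewrite normal_probC; last by apply: measurableU; exact: measurable_itv.
rewrite normal_probU//; last first.
- by apply/seteqP; split => z //=; rewrite !in_itv /= andbT => -[? ?]; lra.
have -> : P `]-oo, - t[ = P `]t, +oo[.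
  rewrite -normal_prob_closed_tail -normal_prob_opp_itv -[in RHS](@setUitv1 _ _ _ _ true)//.
  rewrite normal_probU//; last first.
  - by apply/seteqP; split => z //= [] /[swap] ->; rewrite in_itv /= ltxx.
  by rewrite normal_prob_set1 adde0.
rewrite /normal_tail.
have : P `]t, +oo[ \is a fin_num by apply: normal_prob_fin; exact: measurable_itv.
by move=> fP; rewrite EFinB EFinM fineK// mule_natl mule2n.
Qed.

Lemma centered_normal_cdf t : centered_normal v `]-oo, t] = (normal_cdf t)%:E.
Proof. by rewrite fineK//; apply: normal_prob_fin; exact: measurable_itv. Qed.

Lemma normal_cdf_le s t : s <= t -> normal_cdf s <= normal_cdf t.
Proof.
move=> st; apply: fine_le; [exact: normal_prob_fin|exact: normal_prob_fin|].
apply: le_measure; rewrite ?inE; [exact: measurable_itv|exact: measurable_itv|].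
by move=> z /=; rewrite !in_itv /= => /le_trans; apply.
Qed.

Lemma normal_cdf_neg_le_half t : t < 0 -> normal_cdf t <= 2^-1.
Proof.
move=> t0; have := normal_cdf_tail t; rewrite -normal_cdf_opp.
have : normal_cdf t <= normal_cdf (- t) by apply: normal_cdf_le; lra.
lra.
Qed.

Lemma normal_tail0_le_half : normal_tail 0 <= 2^-1.
Proof.
have h1 := normal_cdf_opp 0; have h2 := normal_cdf_tail 0; rewrite oppr0 in h1.
by move: h1 h2; move: (normal_tail 0) (normal_cdf 0) => x y; lra.
Qed.

End NormalLaws.

Section PointMass.
Context {R : realType}.

Lemma point_mass0_cdf (t : R) : point_mass 0 `]-oo, t] = ((0 <= t)%R%:R : R)%:E.
Proof. by rewrite /point_mass diracE mem_setE in_itv. Qed.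

Lemma jump_discontinuous (F : R -> R) (w : R) : 0 < w ->
  (forall t, t < 0 -> F t + w <= F 0) -> ~ {for 0, continuous F}.
Proof.
move=> w0 Fw /cvgrPdist_lt /(_ w w0) [d /= d0 hd].
have := hd (- (d / 2)); rewrite /ball_ /= sub0r opprK gtr0_norm ?divr_gt0//.
move=> /(_ ltac:(lra)); have := Fw (- (d / 2)) ltac:(lra).
by rewrite ltr_norml => ? /andP[? ?]; lra.
Qed.

Lemma mle_cvg_away_from0 p b h (mu : set R -> \bar R) :
  ~ {for 0, continuous (law_cdf mu)} ->
  (forall t, t < 0 \/ 0 < t ->
     \sum_(s : config N | (scaled_error p b h s <= t%:E)%E) gibbs p b h s @[N --> \oo] -->
     law_cdf mu t) ->
  mle_cvg p b h mu.
Proof.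
move=> disc H t ct; apply: H.
by have [|t0|t0] := ltgtP t 0; [left|right|case: disc; rewrite -t0].
Qed.

End PointMass.

(** * Identification of the limiting mixtures *)

Section MixtureLimits.
Context {R : realType}.
Implicit Types (p : nat) (b h m : R).

Lemma mode_weight_seq p b h (ms : seq R) m : uniq ms ->
  (forall x, global_maximizers p b h x <-> x \in ms) ->
  (forall x, x \in ms -> Hfun_deriv2 p b x < 0) -> m \in ms ->
  [/\ mode_weight p b h m = unnormalized_mode_weight p b h m /
        \sum_(y <- ms) unnormalized_mode_weight p b h y,
      0 < \sum_(y <- ms) unnormalized_mode_weight p b h y,
      forall y, y \in ms -> 0 < unnormalized_mode_weight p b h y & 0 < mode_weight p b h m].
Proof.
move=> ums hms nms mms.
have W := mode_weightE ums hms m.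
have S0 := umw_sum_gt0 ums hms nms mms.
have u0 := umw_gt0 hms nms.
by split=> //; rewrite W divr_gt0 ?u0.
Qed.

Lemma big_pair (F : R -> R) (x y : R) : \sum_(z <- [:: x; y]) F z = F x + F y.
Proof. by rewrite big_cons big_seq1. Qed.

Lemma half_ratio (u : R) : 0 < u -> u / (u + u) = 1 / 2.
Proof. by move=> u0; field; rewrite gt_eqF ?addr_gt0. Qed.

(** Shows a jump of at least 1/2 at 0: y is the lower tail of one normal law at a negative point, x
    the upper tail of the other at 0. *)
Lemma jump_arith (w x y : R) : 0 < w -> 0 < 1 - w -> x <= 2^-1 -> y <= 2^-1 ->
  w * y + 2^-1 <= 1 - (1 - w) * x.
Proof.
move=> w0 w1 hx hy.
have : w * y <= w * 2^-1 by rewrite ler_pM2l.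
have : (1 - w) * x <= (1 - w) * 2^-1 by rewrite ler_pM2l.
lra.
Qed.

Lemma asymmetric_mle_cvg p b h m1 m2 : m1 < m2 ->
  global_maximizers p b h = [set m1; m2] ->
  Hfun_deriv2 p b m1 < 0 -> Hfun_deriv2 p b m2 < 0 ->
  mle_cvg p b h (mixture
    [:: (mode_weight p b h m1 / 2, half_normal_neg (- Hfun'' p b h m1));
        ((1 - mode_weight p b h m1) / 2, half_normal_pos (- Hfun'' p b h m2));
        (1 / 2, point_mass 0)]).
Proof.
move=> m12 gE d1 d2; have [D stD] := @stirling_defect_cvg R.
pose ms := [:: m1; m2].
have ums : uniq ms by rewrite /= inE lt_eqF.
have hms x : global_maximizers p b h x <-> x \in ms.
  rewrite gE !inE; split=> [[->|->]|/orP[/eqP ->|/eqP ->]]; rewrite ?eqxx ?orbT//.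
    by left.
  by right.
have nms x : x \in ms -> Hfun_deriv2 p b x < 0.
  by rewrite !inE => /orP[] /eqP ->.
have in1 : m1 \in ms by rewrite inE eqxx.
have in2 : m2 \in ms by rewrite !inE eqxx orbT.
have [w1E S0 u0 w10] := mode_weight_seq ums hms nms in1.
have [w2E _ _ w20] := mode_weight_seq ums hms nms in2.
have w2 : mode_weight p b h m2 = 1 - mode_weight p b h m1.
  rewrite w1E w2E; move: S0; rewrite big_pair.
  move: (unnormalized_mode_weight p b h m1) (unnormalized_mode_weight p b h m2) => x y S0.
  by field; rewrite gt_eqF.
rewrite (Hfun''E p b h (maximizer_interior ((hms m1).2 in1))).
rewrite (Hfun''E p b h (maximizer_interior ((hms m2).2 in2))).
set v1 := - Hfun_deriv2 p b m1; set v2 := - Hfun_deriv2 p b m2.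
have v10 : 0 < v1 by rewrite oppr_gt0.
have v20 : 0 < v2 by rewrite oppr_gt0.
set w := mode_weight p b h m1 in w10 w2 *.
rewrite w2 in w20.
set mu := mixture _.
(* A half-normal law doubles a normal tail, which cancels the halved weight; the same happens for
   [cdf_ge0]. *)
have cdf_lt0 t : t < 0 -> law_cdf mu t = w * normal_cdf v1 t.
  move=> t0; rewrite /law_cdf /mu /mixture !big_cons big_nil /=.
  rewrite half_normal_neg_lt0// half_normal_pos_lt0// point_mass0_cdf leNgt t0 /=.
  by field.
have cdf_ge0 t : 0 <= t -> law_cdf mu t = 1 - (1 - w) * normal_tail v2 t.
  move=> t0; rewrite /law_cdf /mu /mixture !big_cons big_nil /=.
  rewrite half_normal_neg_ge0// half_normal_pos_ge0// point_mass0_cdf t0 /=.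
  by field.
apply: mle_cvg_away_from0.
- apply: (@jump_discontinuous _ _ 2^-1); first by rewrite invr_gt0.
  move=> t t0; rewrite cdf_lt0// cdf_ge0//.
  apply: jump_arith => //; first exact: normal_tail0_le_half.
  exact: normal_cdf_neg_le_half.
- move=> t [t0|t0].
  + rewrite cdf_lt0//; apply: (mle_cdf_left stD ums hms nms in1) => // x.
    by rewrite !inE => /orP[] /eqP -> //; exact: ltW.
  + rewrite cdf_ge0 ?ltW// -w2; apply: (mle_cdf_right stD ums hms nms in2) => // x.
    by rewrite !inE => /orP[] /eqP -> //; exact: ltW.
Qed.

(** Covers two and three maximizers alike: by symmetry a is the weight of m as well as of - m, and a
    possible maximizer 0 enters only through a. Taking a by an equation allows the literal 1/2. *)
Lemma symmetric_mle_cvg p b m (ms : seq R) : uniq ms -> 0 < m ->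
  (3 <= p)%N -> ~~ odd p ->
  (forall x, global_maximizers p b 0 x <-> x \in ms) ->
  (forall x, x \in ms -> Hfun_deriv2 p b x < 0) ->
  - m \in ms -> m \in ms -> (forall x, x \in ms -> - m <= x <= m) ->
  forall a, a = mode_weight p b 0 (- m) -> a < 1 ->
  mle_cvg p b 0 (mixture
    [:: (a, centered_normal (- Hfun'' p b 0 m)); (1 - a, point_mass 0)]).
Proof.
move=> ums m0 p3 op hms nms inN inP bnd a aE a1.
have [D stD] := @stirling_defect_cvg R.
have [w1E S0 u0 w10] := mode_weight_seq ums hms nms inN.
have [w2E _ _ _] := mode_weight_seq ums hms nms inP.
have mI := maximizer_interior ((hms m).2 inP).
have mNI := maximizer_interior ((hms (- m)).2 inN).
have w2 : mode_weight p b 0 m = a.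
  rewrite aE w1E w2E /unnormalized_mode_weight !Hfun''E//.
  by rewrite Hfun_deriv2_even// sqrrN.
rewrite Hfun''E//; set v := - Hfun_deriv2 p b m.
have v0 : 0 < v by rewrite oppr_gt0 nms.
set mu := mixture _.
have cdf t : law_cdf mu t = a * normal_cdf v t + (1 - a) * (0 <= t)%R%:R.
  rewrite /law_cdf /mu /mixture !big_cons big_nil /= centered_normal_cdf// point_mass0_cdf.
  by rewrite addr0.
have a0 : 0 < a by rewrite aE.
apply: mle_cvg_away_from0.
- apply: (@jump_discontinuous _ _ (1 - a)); first by rewrite subr_gt0.
  move=> t t0; rewrite !cdf lexx (leNgt 0 t) t0 /= mulr0 addr0 mulr1 lerD2r.
  by rewrite ler_pM2l// normal_cdf_le// ltW.
- move=> t [t0|t0]; rewrite cdf.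
  + rewrite leNgt t0 /= mulr0 addr0 aE.
    have := mle_cdf_left stD ums hms nms inN (t := t).
    rewrite Hfun_deriv2_even//; apply=> // x /bnd /andP[]//.
  + rewrite (ltW t0) mulr1 normal_cdf_tail//.
    have -> : a * (1 - normal_tail v t) + (1 - a) = 1 - a * normal_tail v t by ring.
    rewrite -w2; apply: (mle_cdf_right stD ums hms nms inP) => // x /bnd /andP[]//.
Qed.

End MixtureLimits.

Theorem theorem2p3 (R : realType) (p : nat) (beta h : R)
  (hp : (3 <= p)%N) (hbeta : 0 <= beta) (hcrit : critical p beta h) :
  (odd p ->
    exists m1 m2 : R,
      [/\ m1 < m2, global_maximizers p beta h = [set m1; m2], m1 != - m2 &
        mle_cvg p beta h (mixture
          [:: (mode_weight p beta h m1 / 2, half_normal_neg (- Hfun'' p beta h m1));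
              ((1 - mode_weight p beta h m1) / 2, half_normal_pos (- Hfun'' p beta h m2));
              (1 / 2, point_mass 0)])])
  /\
  (~~ odd p ->
    [/\ (h != 0 ->
          exists m1 m2 : R,
            [/\ m1 < m2, global_maximizers p beta h = [set m1; m2], m1 != - m2 &
              mle_cvg p beta h (mixture
                [:: (mode_weight p beta h m1 / 2, half_normal_neg (- Hfun'' p beta h m1));
                    ((1 - mode_weight p beta h m1) / 2, half_normal_pos (- Hfun'' p beta h m2));
                    (1 / 2, point_mass 0)])]),
        (h = 0 -> beta_tilde p < beta ->
          exists m : R,
            [/\ 0 < m, global_maximizers p beta h = [set - m; m] &
              mle_cvg p beta h (mixture
                [:: (1 / 2, centered_normal (- Hfun'' p beta h m));
                    (1 / 2, point_mass 0)])]) &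
        (h = 0 -> beta = beta_tilde p ->
          exists m : R,
            [/\ 0 < m, global_maximizers p beta h = [set - m; 0; m] &
              mle_cvg p beta h (mixture
                [:: (mode_weight p beta h (- m), centered_normal (- Hfun'' p beta h (- m)));
                    (1 - mode_weight p beta h (- m), point_mass 0)])])]).
Proof.
have p0 : (0 < p)%N by exact: leq_trans hp.
split=> [op|op].
  have [m1 [m2 [m12 gE asym d1 d2]]] := critical_odd hp op hbeta hcrit.
  by exists m1, m2; split=> //; exact: asymmetric_mle_cvg.
split=> [h0|h0 hb|h0 hb].
- have [m1 [m2 [m12 gE asym d1 d2]]] := critical_even hp op h0 hcrit.
  by exists m1, m2; split=> //; exact: asymmetric_mle_cvg.
- rewrite {}h0 in hcrit *.
  have [m [m0 nd two three]] := critical_symmetric hp op hcrit.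
  have gE : global_maximizers p beta 0 = [set - m; m].
    (* Otherwise 0 would be a maximizer, although H is positive somewhere because beta exceeds the
       threshold. *)
    apply: two; rewrite ltNge; apply/negP => Hm.
    have [x xI Hx] := beta_tilde_lt p0 hbeta hb.
    have : global_maximizers p beta 0 0 by rewrite (three Hm); left; right.
    by move=> [_ /(_ x xI)]; rewrite Hfun_at0// leNgt Hx.
  exists m; split=> //.
  have Nm : - m < m by lra.
  have half1 : 1 / 2 < 1 :> R by lra.
  pose ms := [:: - m; m].
  have bnd x : x \in ms -> - m <= x <= m.
    by rewrite !inE => /orP[] /eqP ->; lra.
  have ums : uniq ms by rewrite /= inE lt_eqF.
  have hms x : global_maximizers p beta 0 x <-> x \in ms.
    rewrite gE !inE; split=> [[->|->]|/orP[/eqP ->|/eqP ->]]; rewrite ?eqxx ?orbT//.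
      by left.
    by right.
  have nms x : x \in ms -> Hfun_deriv2 p beta x < 0.
    by rewrite !inE => /orP[] /eqP ->; rewrite ?Hfun_deriv2_even.
  have inN : - m \in ms by rewrite inE eqxx.
  have inP : m \in ms by rewrite !inE eqxx orbT.
  have [wE S0 u0 _] := mode_weight_seq ums hms nms inN.
  have half : 1 / 2 = mode_weight p beta 0 (- m).
    have uE : unnormalized_mode_weight p beta 0 (- m) = unnormalized_mode_weight p beta 0 m.
      rewrite /unnormalized_mode_weight !Hfun''E ?(maximizer_interior ((hms _).2 inN))
        ?(maximizer_interior ((hms _).2 inP))//.
      by rewrite Hfun_deriv2_even// sqrrN.
    rewrite wE big_pair uE; apply/esym.
    by apply: half_ratio; exact: u0.
  rewrite [X in [:: _; (X, _)]](_ : 1 / 2 = 1 - 1 / 2); last by field.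
  exact: (symmetric_mle_cvg ums m0 hp op hms nms inN inP bnd half half1).
- rewrite {}h0 in hcrit *.
  have [m [m0 nd two three]] := critical_symmetric hp op hcrit.
  have /andP[m1 m2] : -1 < m < 1.
    by apply: (@maximizer_interior _ p beta 0); case: (leP (Hfun p beta 0 m) 0) => Hm;
      [rewrite (three Hm)|rewrite (two Hm)]; right.
  have gE : global_maximizers p beta 0 = [set - m; 0; m].
    apply: three; apply: (beta_tilde_ge p0 hb).
    by rewrite in_itv /= (ltW m1) (ltW m2).
  exists m; split=> //.
  pose ms := [:: - m; 0; m].
  have bnd x : x \in ms -> - m <= x <= m.
    by rewrite !inE => /or3P[] /eqP ->; lra.
  have ums : uniq ms.
    have N0 : - m < 0 by lra.
    by rewrite /= !inE (lt_eqF N0) (lt_eqF (lt_trans N0 m0)) (lt_eqF m0).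
  have hms x : global_maximizers p beta 0 x <-> x \in ms.
    rewrite gE !inE; split=> [[[->|->]|->]|/or3P[/eqP ->|/eqP ->|/eqP ->]];
      rewrite ?eqxx ?orbT//; by [left; left|left; right|right].
  have nms x : x \in ms -> Hfun_deriv2 p beta x < 0.
    by rewrite !inE => /or3P[] /eqP ->; rewrite ?Hfun_deriv2_even ?Hfun_deriv2_at0.
  have inN : - m \in ms by rewrite inE eqxx.
  have inP : m \in ms by rewrite !inE eqxx !orbT.
  have in0 : 0 \in ms by rewrite !inE eqxx orbT.
  have [wE S0 u0 _] := mode_weight_seq ums hms nms inN.
  have a1 : mode_weight p beta 0 (- m) < 1.
    rewrite wE ltr_pdivrMr// mul1r big_cons big_pair.
    by rewrite ltrDl addr_gt0 ?u0.
  have -> : Hfun'' p beta 0 (- m) = Hfun'' p beta 0 m.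
    rewrite (Hfun''E p beta 0 (maximizer_interior ((hms _).2 inN))).
    rewrite (Hfun''E p beta 0 (maximizer_interior ((hms _).2 inP))).
    by rewrite Hfun_deriv2_even.
  exact: (symmetric_mle_cvg ums m0 hp op hms nms inN inP bnd erefl a1).
Qed.
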